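(* If $(\mathbf{c},\mathbf{d},\mathbf{Q})$ is a geometric Forward-Reverse Brascamp--Lieb datum, then its Forward-Reverse Brascamp--Lieb constant satisfies $C(\mathbf{c},\mathbf{d},\mathbf{Q})=1$.
   Context: A Euclidean space is a finite dimensional real Hilbert space $V$ with its inner product and its Lebesgue measure (the one induced by the inner product). Direct sums carry the inner product making the summands orthogonal. For self-adjoint linear maps $A,B$ on $V$, $A\ge B$ means that $A-B$ is positive semidefinite; $A^*$ denotes the adjoint. Let $E_1,\dots,E_k$ and $E^1,\dots,E^m$ be Euclidean spaces, $E_0=\oplus_{i=1}^k E_i$, $E^0=\oplus_{j=1}^m E^j$, and let $\pi_{E_i}:E_0\to E_i$, $\pi_{E^j}:E^0\to E^j$ be the orthogonal projections. A Forward-Reverse Brascamp--Lieb datum is a triple $(\mathbf{c},\mathbf{d},\mathbf{Q})$ where $\mathbf{Q}:E_0\to E^0$ is linear, and $\mathbf{c}=(c_i)_{1\le i\le k}$, $\mathbf{d}=(d_j)_{1\le j\le m}$ are collections of positive numbers with $\sum_{i=1}^k c_i\dim(E_i)=\sum_{j=1}^m d_j\dim(E^j)$. Put $\Lambda_{\mathbf{c}}=\sum_{i=1}^k c_i\pi_{E_i}^*\pi_{E_i}$ and $\Lambda_{\mathbf{d}}=\sum_{j=1}^m d_j\pi_{E^j}^*\pi_{E^j}$. The set $\Pi(\mathrm{id}_{E_1},\dots,\mathrm{id}_{E_k})$ consists of the self-adjoint positive semidefinite linear maps $\Sigma$ on $E_0$ with $\pi_{E_i}\Sigma\pi_{E_i}^*=\mathrm{id}_{E_i}$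 for all $i$; similarly $\Pi(\mathrm{id}_{E^1},\dots,\mathrm{id}_{E^m})$ consists of the self-adjoint positive semidefinite linear maps $S$ on $E^0$ with $\pi_{E^j}S\pi_{E^j}^*=\mathrm{id}_{E^j}$ for all $j$. The datum is called geometric if $\mathbf{Q}^*\Lambda_{\mathbf{d}}\mathbf{Q}\le\Lambda_{\mathbf{c}}$ and there exists $\Sigma\in\Pi(\mathrm{id}_{E_1},\dots,\mathrm{id}_{E_k})$ such that $\mathbf{Q}\Sigma\mathbf{Q}^*\in\Pi(\mathrm{id}_{E^1},\dots,\mathrm{id}_{E^m})$. The Forward-Reverse Brascamp--Lieb constant $C(\mathbf{c},\mathbf{d},\mathbf{Q})$ is the smallest constant $C$ (possibly $+\infty$) such that $$\prod_{i=1}^k\Big(\int_{E_i}f_i\Big)^{c_i}\le C\prod_{j=1}^m\Big(\int_{E^j}g_j\Big)^{d_j}$$ for all non-negative measurable functions $f_i:E_i\to[0,+\infty)$, $g_j:E^j\to[0,+\infty)$ satisfying $\prod_{i=1}^k f_i(\pi_{E_i}x)^{c_i}\le\prod_{j=1}^m g_j(\pi_{E^j}\mathbf{Q}x)^{d_j}$ for all $x\in E_0$. Integrals may be $+\infty$, with the convention $0\cdot\infty=0$ in products. *)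

(* Defs.v *)
From HB Require Import structures.
From mathcomp Require Import all_boot all_order all_algebra sesquilinear.
From mathcomp Require Import all_classical all_reals all_analysis.
From mathcomp Require Import measurable_realfun.

Set Implicit Arguments.
Unset Strict Implicit.
Unset Printing Implicit Defensive.

Import Order.TTheory GRing.Theory Num.Theory.

Local Open Scope classical_set_scope.
Local Open Scope ring_scope.

(* A Euclidean space: a finite-dimensional real vector space with a
   positive-definite symmetric bilinear form. *)
Record euclid (R : realType) := Euclid {
  euclid_space :> vectType R;
  dotp : {dot euclid_space for idfun}
}.
Arguments Euclid {R}.
Arguments dotp {R}.

Section dotp_theory.
Context {R : realType} (V : euclid R).
Implicit Types x y z : V.

Lemma dotpC x y : dotp V x y = dotp V y x.
Proof. by rewrite (@hermC R false idfun V (dotp V)) expr0 mul1r. Qed.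

Lemma dotpDr x y z : dotp V x (y + z) = dotp V x y + dotp V x z.
Proof. exact: linearDr. Qed.

Lemma dotpZr a x y : dotp V x (a *: y) = a * dotp V x y.
Proof. exact: linearZr_LR. Qed.

Lemma dotpDl x y z : dotp V (x + y) z = dotp V x z + dotp V y z.
Proof. exact: linearDl. Qed.

Lemma dotpZl a x y : dotp V (a *: x) y = a * dotp V x y.
Proof. exact: linearZl_LR. Qed.

Lemma dotp0r x : dotp V x 0 = 0.
Proof. exact: linear0r. Qed.

Lemma dotpNr x y : dotp V x (- y) = - dotp V x y.
Proof. exact: linearNr. Qed.

Lemma dotp_sumr (I : Type) (r : seq I) (P : pred I) x (F : I -> V) :
  dotp V x (\sum_(i <- r | P i) F i) = \sum_(i <- r | P i) dotp V x (F i).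
Proof. exact: linear_sumr. Qed.

Lemma dotp_suml (I : Type) (r : seq I) (P : pred I) x (F : I -> V) :
  dotp V (\sum_(i <- r | P i) F i) x = \sum_(i <- r | P i) dotp V (F i) x.
Proof. by rewrite dotpC dotp_sumr; apply: eq_bigr => i _; rewrite dotpC. Qed.

Lemma dotp_gt0 x : x != 0 -> 0 < dotp V x x.
Proof. exact: neq0_dnorm_gt0. Qed.

Lemma dotp_eq0 x : dotp V x x = 0 -> x = 0.
Proof. by move=> xx0; apply: contraPP xx0 => /eqP /dotp_gt0 /lt0r_neq0 /eqP. Qed.

End dotp_theory.

Definition is_orthonormal (R : realType) (V : euclid R) (n : nat)
    (b : 'I_n -> V) : Prop :=
  forall i j, dotp V (b i) (b j) = (i == j)%:R.

Lemma orthonormal_exists_le (R : realType) (V : euclid R) (n : nat) :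
  (n <= \dim {:V})%N -> exists b : 'I_n -> V, is_orthonormal b.
Proof.
elim: n => [|n IHn] ltn; first by exists (fun=> 0) => -[].
have [b ob] := IHn (ltnW ltn).
have [v vNb] : exists v : V, v \notin <<codom b>>%VS.
  apply: contrapT => Hall.
  have : ({:V} <= <<codom b>>)%VS.
    by apply/subvP => v _; apply: contrapT => /negP vNb; apply: Hall; exists v.
  move=> /dimvS; apply/negP; rewrite -ltnNge.
  by rewrite (leq_ltn_trans (dim_span _))// size_codom card_ord.
pose w := v - \sum_i dotp V v (b i) *: b i.
have wb i : dotp V w (b i) = 0.
  rewrite dotpC dotpDr dotpNr dotp_sumr (bigD1 i)//= dotpZr ob eqxx mulr1.
  rewrite big1 ?addr0 => [|j ji]; first by rewrite (dotpC v) subrr.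
  by rewrite dotpZr ob eq_sym (negPf ji) mulr0.
have w0 : w != 0.
  apply: contra vNb; rewrite subr_eq0 => /eqP ->.
  by apply: memv_suml => i _; rewrite memvZ// memv_span// codom_f.
pose u := (Num.sqrt (dotp V w w))^-1 *: w.
have uu : dotp V u u = 1.
  rewrite dotpZl dotpZr mulrA -invfM -expr2 sqr_sqrtr ?ltW ?dotp_gt0//.
  by rewrite mulVf// gt_eqF// dotp_gt0.
have ub i : dotp V u (b i) = 0 by rewrite dotpZl wb mulr0.
exists (fun i => oapp b u (unlift ord0 i)) => i j.
case: (unliftP ord0 i) => [i'|] ->; case: (unliftP ord0 j) => [j'|] -> /=.
- by rewrite ob (inj_eq (@lift_inj _ ord0)).
- by rewrite dotpC ub.
- by rewrite ub.
- by rewrite uu.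
Qed.

Lemma orthonormal_exists (R : realType) (V : euclid R) :
  exists b : 'I_(\dim {:V}) -> V, is_orthonormal b.
Proof. exact: orthonormal_exists_le. Qed.

(* Some orthonormal basis; nothing below depends on which one is chosen. *)
Definition onb (R : realType) (V : euclid R) : 'I_(\dim {:V}) -> V :=
  sval (cid (orthonormal_exists V)).
Arguments onb {R} V.

Lemma onbP (R : realType) (V : euclid R) : is_orthonormal (onb V).
Proof. exact: (svalP (cid (orthonormal_exists V))). Qed.

Lemma onb_expand (R : realType) (V : euclid R) (x : V) :
  x = \sum_i dotp V x (onb V i) *: onb V i.
Proof.
pose X := [tuple of codom (onb V)].
have frX : free X.
  apply/freeP => k k0 i.
  have iX (j : 'I_#|'I_(\dim {:V})|) : X`_j = onb V (enum_val j).
    by rewrite /X/= (nth_map (enum_val j)) -?cardE// -enum_val_nth.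
  have := congr1 (dotp V (onb V (enum_val i))) k0.
  rewrite dotp_sumr dotp0r (bigD1 i)//= dotpZr iX onbP eqxx mulr1.
  rewrite big1 ?addr0// => j ji; rewrite dotpZr iX onbP.
  by rewrite (inj_eq enum_val_inj) eq_sym (negPf ji) mulr0.
have /span_basis Xf : basis_of {:V} X.
  by rewrite basisEfree frX subvf/= size_codom card_ord.
apply/eqP; rewrite -subr_eq0; apply/eqP.
set y := x - _.
have yb i : dotp V y (onb V i) = 0.
  rewrite dotpC dotpDr dotpNr dotp_sumr (bigD1 i)//= dotpZr onbP eqxx mulr1.
  rewrite big1 ?addr0 => [|j ji]; first by rewrite dotpC subrr.
  by rewrite dotpZr onbP eq_sym (negPf ji) mulr0.
apply: dotp_eq0; have : y \in <<X>>%VS by rewrite Xf memvf.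
move=> /coord_span yX; rewrite {2}yX dotp_sumr big1// => j _.
rewrite dotpZr /X/= (nth_map (enum_val j)) -?cardE// yb mulr0//.
Qed.

Lemma adjoint_exists (R : realType) (U V : euclid R) (f : 'Hom(U, V)) :
  exists g : 'Hom(V, U), forall x y, dotp V (f x) y = dotp U x (g y).
Proof.
pose h (y : V) : U := \sum_i dotp V (f (onb U i)) y *: onb U i.
have hl : linear h.
  move=> a y z; rewrite /h scaler_sumr -big_split/=; apply: eq_bigr => i _.
  by rewrite dotpDr dotpZr scalerDl scalerA.
pose hL := GRing.isLinear.Build _ _ _ _ h hl.
pose hl' : {linear V -> U} := HB.pack h hL.
exists (linfun hl') => x y; rewrite lfunE/= /h {1}(onb_expand x).
rewrite linear_sum dotp_suml dotp_sumr; apply: eq_bigr => i _.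
by rewrite linearZ dotpZl dotpZr mulrC.
Qed.

Definition adjoint (R : realType) (U V : euclid R) (f : 'Hom(U, V)) :
  'Hom(V, U) := sval (cid (adjoint_exists f)).

Lemma adjointP (R : realType) (U V : euclid R) (f : 'Hom(U, V)) x y :
  dotp V (f x) y = dotp U x (adjoint f y).
Proof. exact: (svalP (cid (adjoint_exists f))). Qed.

Definition psd (R : realType) (V : euclid R) (A : 'End(V)) : Prop :=
  adjoint A = A /\ forall x, 0 <= dotp V (A x) x.

(* The order on self-adjoint maps: [loewner_le A B] is A <= B. *)
Definition loewner_le (R : realType) (V : euclid R) (A B : 'End(V)) : Prop :=
  psd (B - A).

Definition dsum_space (R : realType) (k : nat) (E : 'I_k -> euclid R) : Type :=
  {dffun forall i, E i}.

Section dsum_space.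
Context {R : realType} {k : nat} (E : 'I_k -> euclid R).
Local Notation dsumE := (dsum_space E).
Implicit Types x y z : dsumE.

HB.instance Definition _ := Choice.on dsumE.

Definition dsum_add x y : dsumE := [ffun i => x i + y i].
Definition dsum_opp x : dsumE := [ffun i => - x i].
Definition dsum_zero : dsumE := [ffun i => 0].
Definition dsum_scale (a : R) x : dsumE := [ffun i => a *: x i].

Fact dsum_addA : associative dsum_add.
Proof. by move=> x y z; apply/ffunP => i; rewrite !ffunE addrA. Qed.
Fact dsum_addC : commutative dsum_add.
Proof. by move=> x y; apply/ffunP => i; rewrite !ffunE addrC. Qed.
Fact dsum_add0 : left_id dsum_zero dsum_add.
Proof. by move=> x; apply/ffunP => i; rewrite !ffunE add0r. Qed.
Fact dsum_addN : left_inverse dsum_zero dsum_opp dsum_add.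
Proof. by move=> x; apply/ffunP => i; rewrite !ffunE addNr. Qed.

HB.instance Definition _ :=
  GRing.isZmodule.Build dsumE dsum_addA dsum_addC dsum_add0 dsum_addN.

Fact dsum_scaleA a b x : dsum_scale a (dsum_scale b x) = dsum_scale (a * b) x.
Proof. by apply/ffunP => i; rewrite !ffunE scalerA. Qed.
Fact dsum_scale1 : left_id 1 dsum_scale.
Proof. by move=> x; apply/ffunP => i; rewrite !ffunE scale1r. Qed.
Fact dsum_scaleDr : right_distributive dsum_scale +%R.
Proof. by move=> a x y; apply/ffunP => i; rewrite !ffunE scalerDr. Qed.
Fact dsum_scaleDl x : {morph dsum_scale^~ x : a b / a + b}.
Proof. by move=> a b; apply/ffunP => i; rewrite !ffunE scalerDl. Qed.

HB.instance Definition _ := GRing.Zmodule_isLmodule.Build R dsumE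
  dsum_scaleA dsum_scale1 dsum_scaleDr dsum_scaleDl.

Lemma dsum_addE x y i : (x + y) i = x i + y i. Proof. exact: ffunE. Qed.
Lemma dsum_scaleE a x i : (a *: x) i = a *: x i. Proof. exact: ffunE. Qed.

Fact dsum_vect_iso : Vector.axiom (\sum_i \dim {:E i}) dsumE.
Proof.
exists (fun x => \mxrow_i \row_j dotp (E i) (onb (E i) j) (x i)).
  move=> a x y; apply/matrixP => p q.
  by rewrite !mxE dsum_addE dsum_scaleE dotpDr dotpZr.
exists (fun r => [ffun i => \sum_j submxrow r i ord0 j *: onb (E i) j]).
  move=> x; apply/ffunP => i; rewrite ffunE mxrowK [RHS]onb_expand.
  by apply: eq_bigr => j _; rewrite mxE dotpC.
move=> r; apply/mxrowP => i; rewrite mxrowK ffunE; apply/rowP => j.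
rewrite mxE dotp_sumr (bigD1 j)//= dotpZr onbP eqxx mulr1 big1 ?addr0// => l lj.
by rewrite dotpZr onbP eq_sym (negPf lj) mulr0.
Qed.

HB.instance Definition _ := Lmodule_hasFinDim.Build R dsumE dsum_vect_iso.

Definition dsum_dotp x y : R := \sum_i dotp (E i) (x i) (y i).

Fact dsum_dotp_bilinear : bilinear_for *%R (idfun \; *%R) dsum_dotp.
Proof.
split=> [y|x] a u v /=; rewrite /dsum_dotp mulr_sumr -big_split/=.
  by apply: eq_bigr => i _; rewrite dsum_addE dsum_scaleE dotpDl dotpZl.
by apply: eq_bigr => i _; rewrite dsum_addE dsum_scaleE dotpDr dotpZr.
Qed.

HB.instance Definition _ := @bilinear_isBilinear.Build R dsumE dsumE R
  *%R (idfun \; *%R) dsum_dotp dsum_dotp_bilinear.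

Fact dsum_dotp_sym x y :
  dsum_dotp x y = (-1) ^+ false * idfun (dsum_dotp y x).
Proof. by rewrite expr0 mul1r; apply: eq_bigr => i _; exact: dotpC. Qed.

HB.instance Definition _ :=
  isHermitianSesquilinear.Build R dsumE false idfun dsum_dotp dsum_dotp_sym.

Fact dsum_dotp_gt0 x : x != 0 -> 0 < dsum_dotp x x.
Proof.
have dotp_ge0 i : 0 <= dotp (E i) (x i) (x i).
  have [->|/dotp_gt0/ltW//] := eqVneq (x i) 0; by rewrite dotp0r.
move=> x0; rewrite lt_neqAle sumr_ge0// andbT eq_sym.
apply: contra_neq x0 => /eqP; rewrite /dsum_dotp psumr_eq0// => /allP xx0.
apply/ffunP => i; rewrite [RHS]ffunE; apply: dotp_eq0; apply/eqP.
exact: (xx0 i (mem_index_enum i)).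
Qed.

HB.instance Definition _ := isDotProduct.Build R dsumE dsum_dotp dsum_dotp_gt0.

End dsum_space.

Definition dsum (R : realType) (k : nat) (E : 'I_k -> euclid R) : euclid R :=
  Euclid (dsum_space E) (@dsum_dotp R k E).

Definition dsum_proj (R : realType) (k : nat) (E : 'I_k -> euclid R) (i : 'I_k) :
  'Hom(dsum E, E i) := linfun (fun x : dsum E => (x : dsum_space E) i).

Lemma dsum_projE (R : realType) (k : nat) (E : 'I_k -> euclid R) (i : 'I_k)
    (x : dsum E) : dsum_proj E i x = (x : dsum_space E) i.
Proof.
pose p (x : dsum E) : E i := (x : dsum_space E) i.
have pl : linear p by move=> a u v; rewrite /p dsum_addE dsum_scaleE.
pose pL := GRing.isLinear.Build _ _ _ _ p pl.
pose p' : {linear dsum E -> E i} := HB.pack p pL.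
exact: (lfunE p').
Qed.

(* [pushforward m f] with the measurability of [f] as an explicit argument,
   so that its measure structure is inferred from the term alone. *)
Section image_measure.
Context d1 d2 (T1 : measurableType d1) (T2 : measurableType d2) (R : realType).
Variables (m : {measure set T1 -> \bar R}) (f : T1 -> T2).
Hypothesis mf : measurable_fun setT f.

Definition image_measure of measurable_fun setT f : set T2 -> \bar R :=
  pushforward m f.
Local Notation mu := (image_measure mf).

Let mu0 : mu set0 = 0%E. Proof. exact: measure0. Qed.

Let mu_ge0 A : (0 <= mu A)%E. Proof. exact: measure_ge0. Qed.

Let mu_sigma_additive : semi_sigma_additive mu.
Proof. exact: measure_semi_sigma_additive. Qed.

HB.instance Definition _ :=
  isMeasure.Build _ _ _ mu mu0 mu_ge0 mu_sigma_additive.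

End image_measure.

Section lebesgue_tuple.
Context (R : realType).
Local Notation T := (measurableTypeR R).

Definition tcons n (p : T * n.-tuple T) : n.+1.-tuple T := [tuple of p.1 :: p.2].
Definition tuncons n (t : n.+1.-tuple T) : T * n.-tuple T :=
  (thead t, [tuple of behead t]).

Lemma measurable_tcons n : measurable_fun setT (@tcons n).
Proof. exact: measurable_cons. Qed.

Lemma measurable_tuncons n : measurable_fun setT (@tuncons n).
Proof.
apply/measurable_fun_pairP; split; last exact: measurable_behead.
exact: measurable_tnth.
Qed.

Lemma tconsK n : cancel (@tcons n) (@tuncons n).
Proof. by case=> x t; congr (_, _); apply/val_inj. Qed.

Section lebesgue_tuple_succ.
Variables (n : nat) (mu : {sigma_finite_measure set (n.-tuple T) -> \bar R}).

Definition lebesgue_tuple_succ : set (n.+1.-tuple T) -> \bar R :=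
  image_measure (@lebesgue_measure R \x mu)%E (@measurable_tcons n).

HB.instance Definition _ := Measure.on lebesgue_tuple_succ.

Let lebesgue_tuple_succ_sigma_finite : sigma_finite setT lebesgue_tuple_succ.
Proof.
have /sigma_finiteP[F [TF ndF Foo]] := sigma_finiteT (@lebesgue_measure R).
have /sigma_finiteP[G [TG ndG Goo]] := sigma_finiteT mu.
exists (fun k => @tuncons n @^-1` (F k `*` G k)).
  rewrite -preimage_bigcup (_ : \bigcup_k (F k `*` G k) = setT) ?preimage_setT//.
  apply/seteqP; split => // -[x y] _.
  have [i _ Fx] : (\bigcup_i F i) x by rewrite -TF.
  have [j _ Gy] : (\bigcup_i G i) y by rewrite -TG.
  exists (maxn i j) => //; split => /=.
    by move: x Fx; exact/subsetPset/ndF/leq_maxl.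
  by move: y Gy; exact/subsetPset/ndG/leq_maxr.
move=> k; have [mFk Fkoo] := Foo k; have [mGk Gkoo] := Goo k; split.
  by rewrite -[X in measurable X]setTI; apply: measurable_tuncons => //;
    exact: measurableX.
rewrite /lebesgue_tuple_succ /image_measure /pushforward.
rewrite (_ : @tcons n @^-1` _ = F k `*` G k).
  by rewrite /= product_measure1E// lte_mul_pinfty// ge0_fin_numE.
rewrite -comp_preimage (_ : _ \o _ = id) ?preimage_id//.
by apply/funext => p; exact: tconsK.
Qed.

HB.instance Definition _ := @Measure_isSigmaFinite.Build _ _ _
  lebesgue_tuple_succ lebesgue_tuple_succ_sigma_finite.

End lebesgue_tuple_succ.

(* Lebesgue measure on R^n: the n-fold product of the one-dimensional one, and
   the point mass on R^0. *)
Fixpoint lebesgue_tuple (n : nat) :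
    {sigma_finite_measure set (n.-tuple T) -> \bar R} :=
  match n with
  | 0 => \d_([tuple] : 0.-tuple T)
  | n'.+1 => lebesgue_tuple_succ (lebesgue_tuple n')
  end.

End lebesgue_tuple.

(* [V] with its Borel sigma-algebra, which in finite dimension is generated by
   the linear forms [dotp V u]. *)
Definition borel (R : realType) (V : euclid R) : Type := V.

Section borel.
Context {R : realType} (V : euclid R).

HB.instance Definition _ := Choice.on (borel V).
HB.instance Definition _ := isPointed.Build (borel V) (0 : V).

Definition linear_form_preimages : set (set (borel V)) :=
  [set A | exists u : V, exists2 B : set (measurableTypeR R),
     measurable B & A = dotp V u @^-1` B].

HB.instance Definition _ := @isMeasurable.Build
  (sigma_display linear_form_preimages) (borel V)
  <<s linear_form_preimages >>
  (@sigma_algebra0 _ setT _) (@sigma_algebraC (borel V) _)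
  (@sigma_algebra_bigcup _ setT _).

Definition onb_combination (t : (\dim {:V}).-tuple (measurableTypeR R)) :
  borel V := \sum_(i < \dim {:V}) (tnth t i : R) *: onb V i.

Lemma measurable_onb_combination : measurable_fun setT onb_combination.
Proof.
apply: (measurability linear_form_preimages) => // _ [_ [u [B mB ->]] <-].
rewrite setTI.
pose h (t : (\dim {:V}).-tuple (measurableTypeR R)) : measurableTypeR R :=
  \sum_(i < \dim {:V}) (tnth t i : R) * dotp V u (onb V i).
have mh : measurable_fun setT h.
  apply: measurable_sum => i; apply: measurable_funM => //.
  exact: measurable_tnth.
rewrite (_ : _ @^-1` _ = h @^-1` B).
  by rewrite -[X in measurable X]setTI; exact: mh.
apply/funext => t; rewrite /preimage/= /onb_combination dotp_sumr /h.
by under eq_bigr do rewrite dotpZr.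
Qed.

(* Image of the Lebesgue measure of R^n under the isometry R^n -> V given by an
   orthonormal basis; by rotation invariance, the measure induced by the inner
   product. *)
Definition lebesgue : {measure set (borel V) -> \bar R} :=
  image_measure (@lebesgue_tuple R (\dim {:V})) measurable_onb_combination.

End borel.

Section datum_operators.
Context {R : realType} {k : nat} {E : 'I_k -> euclid R}.

(* The sum of the c_i pi_i^* pi_i. *)
Definition Lambda (c : 'I_k -> R) : 'End(dsum E) :=
  \sum_i c i *: (adjoint (dsum_proj E i) \o dsum_proj E i)%VF.

(* The set Pi(id, ..., id): positive semidefinite maps all of whose diagonal
   blocks are the identity. *)
Definition id_couplings : set 'End(dsum E) :=
  [set S | psd S /\
    forall i, (dsum_proj E i \o S \o adjoint (dsum_proj E i))%VF = \1%VF].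

End datum_operators.

Section forward_reverse_brascamp_lieb.
Context {R : realType} {k m : nat}.
Variables (E : 'I_k -> euclid R) (F : 'I_m -> euclid R).
Variables (c : 'I_k -> R) (d : 'I_m -> R) (Q : 'Hom(dsum E, dsum F)).

Definition FRBL_datum : Prop :=
  [/\ forall i, 0 < c i, forall j, 0 < d j &
      \sum_i c i * (\dim {:E i})%:R = \sum_j d j * (\dim {:F j})%:R].

Definition FRBL_geometric : Prop :=
  loewner_le (adjoint Q \o Lambda d \o Q)%VF (Lambda c) /\
  exists2 S : 'End(dsum E), id_couplings S &
    id_couplings (Q \o S \o adjoint Q)%VF.

Definition FRBL_inequality (C : \bar R) : Prop :=
  forall (f : forall i, borel (E i) -> R) (g : forall j, borel (F j) -> R),
  (forall i, measurable_fun setT (f i)) -> (forall i x, 0 <= f i x) ->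
  (forall j, measurable_fun setT (g j)) -> (forall j y, 0 <= g j y) ->
  (forall x : dsum E,
    \prod_i (f i (dsum_proj E i x)) `^ c i <=
    \prod_j (g j (dsum_proj F j (Q x))) `^ d j) ->
  (\prod_i (\int[lebesgue (E i)]_x (f i x)%:E) `^ c i <=
   C * \prod_j (\int[lebesgue (F j)]_y (g j y)%:E) `^ d j)%E.

(* The least element of the set of admissible constants; [+oo] when even [+oo] is not admissible,
   which can happen because 0 * +oo = 0. *)
Definition FRBL_constant : \bar R :=
  xget +oo%E (FRBL_inequality `&` lbound FRBL_inequality).

End forward_reverse_brascamp_lieb.

(* Main.v *)
(** A discrete heat-flow argument. Write P_t for convolution with the centred
    Gaussian law of covariance t id. Factoring the coupling of the geometric
    condition as B B^* gives a Gaussian vector with standard marginals on every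
    E_i and, through Q, on every F_j, so a pointwise inequality
    sum_i c_i ln f_i(x_i) <= sum_j d_j ln g_j((Qx)_j) can be averaged along it.
    By Gibbs' variational formula, with Y of law N(0, t id),
    ln P_t h(x) >= E[ln h(x + Y + t u)] - t |u|^2 / 2 for every drift u, and for
    regular h the constant drift u = grad h(x) / h(x) attains equality up to
    O(t^(3/2)). Pushing the optimal drifts of the f_i through Q costs no more on
    the g side because Q^* Lambda_d Q <= Lambda_c. Hence the inequality passes
    from (f, g) to (P_t f, P_t g) with an error O(t^(3/2)), and N^2 steps of
    length (n/N)^2, N -> oo, give it for P_(n^2) at 0, that is, for Gaussian
    integrals; the regularity comes from replacing f by exp(P_s (ln f)), s -> 0.
    Rescaling by the masses of the Gaussians, which match by the dimension
    condition, and letting n -> oo gives C <= 1; standard Gaussians give C >= 1. *)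
From HB Require Import structures.
Require Import Defs.
From mathcomp Require Import all_boot all_order all_algebra.
From mathcomp Require Import all_classical all_reals all_analysis.
From mathcomp Require Import measurable_realfun ring lra.

Set Implicit Arguments.
Unset Strict Implicit.
Unset Printing Implicit Defensive.

Import Order.TTheory GRing.Theory Num.Theory.
Import numFieldNormedType.Exports.

Local Open Scope classical_set_scope.
Local Open Scope ring_scope.

(** The two sides are not treated alike. The lower bound for ln P_t g holds for every drift and
    needs only bounds on g; the matching upper bound for ln P_t f needs the optimal drift, hence
    regularity of f. For the errors of the N^2 steps to sum to O(1/N), one constant must serve every
    step, so regularity is expressed by bounds that averaging cannot worsen. Smoothing by P_s f
    would presuppose the result; exp(P_s (ln f)) is available because the hypothesis is linear in
    the logarithms and can be averaged without error. Logarithms require functions bounded away from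
    0 and infinity, so f and g are first clamped at levels for which the pointwise inequality
    survives. As f is merely measurable, P_s (ln f) tends to ln f only in L^1 of a Gaussian law,
    which is why Lipschitz functions are shown to be dense there. The convention 0 * oo = 0 forces a
    separate treatment of a null g_j next to an infinite one. In the code a step usually has length
    t^2, so its error reads t^3. *)

Section dotp_identities.
Context {R : realType} (V : euclid R).
Implicit Types x y : V.

Lemma dotpNl x y : dotp V (- x) y = - dotp V x y.
Proof. by rewrite dotpC dotpNr dotpC. Qed.

Lemma dotp_sqrD x y :
  dotp V (x + y) (x + y) = dotp V x x + 2 * dotp V x y + dotp V y y.
Proof. by rewrite dotpDl !dotpDr (dotpC y x); ring. Qed.

Lemma dotp_sqrB x y :
  dotp V (x - y) (x - y) = dotp V x x - 2 * dotp V x y + dotp V y y.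
Proof. by rewrite dotp_sqrD !(dotpNr, dotpNl) opprK; ring. Qed.

Lemma dotp_ge0 x : 0 <= dotp V x x.
Proof. by have [->|/dotp_gt0/ltW//] := eqVneq x 0; rewrite dotp0r. Qed.

Lemma dotp_ext x y : (forall z, dotp V z x = dotp V z y) -> x = y.
Proof.
move=> xy; apply/eqP; rewrite -subr_eq0; apply/eqP/dotp_eq0.
by rewrite dotpDr dotpNr xy subrr.
Qed.

End dotp_identities.

(** * Lebesgue measure and Gaussian laws *)

Section borel_measurability.
Context {R : realType} (V : euclid R).

Lemma measurable_dotp (u : V) :
  measurable_fun setT (fun x : borel V => dotp V u x).
Proof.
move=> _ B mB; rewrite setTI; apply: sub_sigma_algebra.
by exists u, B.
Qed.

Lemma measurable_fun_borel d (T : measurableType d) (f : T -> borel V) :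
  (forall u : V, measurable_fun setT (fun x => dotp V u (f x))) ->
  measurable_fun setT f.
Proof.
move=> mf; apply: (measurability (@linear_form_preimages R V)) => //.
move=> _ [_ [u [B mB ->]] <-].
by have := mf u measurableT B mB; rewrite !setTI.
Qed.

Lemma measurable_borelD d (T : measurableType d) (f g : T -> borel V) :
  measurable_fun setT f -> measurable_fun setT g ->
  measurable_fun setT (fun x => (f x : V) + (g x : V) : borel V).
Proof.
move=> mf mg; apply: measurable_fun_borel => u.
under eq_fun do rewrite dotpDr.
by apply: measurable_funD; apply: measurableT_comp (measurable_dotp u) _.
Qed.

Lemma measurable_borelZ d (T : measurableType d) (a : R) (f : T -> borel V) :
  measurable_fun setT f ->
  measurable_fun setT (fun x => a *: (f x : V) : borel V).
Proof.
move=> mf; apply: measurable_fun_borel => u.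
under eq_fun do rewrite dotpZr.
by apply: measurable_funM => //; apply: measurableT_comp (measurable_dotp u) _.
Qed.

Lemma dotp_onb (x y : V) :
  dotp V x y = \sum_i dotp V (onb V i) x * dotp V (onb V i) y.
Proof.
rewrite [in LHS](onb_expand x) dotp_suml; apply: eq_bigr => i _.
by rewrite dotpZl (dotpC x).
Qed.

Lemma measurable_dotp2 d (T : measurableType d) (f g : T -> borel V) :
  measurable_fun setT f -> measurable_fun setT g ->
  measurable_fun setT (fun x => dotp V (f x) (g x)).
Proof.
move=> mf mg; under eq_fun do rewrite dotp_onb.
apply: measurable_sum => i; apply: measurable_funM;
  exact: measurableT_comp (measurable_dotp _) _.
Qed.

End borel_measurability.

Lemma measurable_borel_lfun (R : realType) (V W : euclid R) (A : 'Hom(V, W)) d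
  (T : measurableType d) (f : T -> borel V) :
  measurable_fun setT f ->
  measurable_fun setT (fun x => A (f x : V) : borel W).
Proof.
move=> mf; apply: measurable_fun_borel => u.
under eq_fun do rewrite dotpC adjointP dotpC.
exact: measurableT_comp (measurable_dotp _) mf.
Qed.

(** * Translations and products of Lebesgue measures *)

Section lebesgue_line.
Context {R : realType}.
Local Notation mu := (@lebesgue_measure R).
Local Open Scope ereal_scope.

(** By uniqueness of the measure with prescribed values on the intervals ]x, y]. *)
Lemma lebesgue_measure_translate (a : R) (A : set R) : measurable A ->
  pushforward mu (fun x : measurableTypeR R => (x + a)%R : measurableTypeR R) A = mu A.
Proof.
move=> mA.
have ma : measurable_fun setT (fun x : measurableTypeR R => (x + a)%R : measurableTypeR R).
  exact: measurable_funD.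
apply/esym.
apply: (@lebesgue_measure_unique R (image_measure mu ma)) => //= _ [[x y]] _ <-.
rewrite /image_measure /pushforward.
rewrite (_ : _ @^-1` _ = `](x - a)%R, (y - a)%R]%classic); last first.
  by apply/seteqP; split => z /=; rewrite !in_itv/= ltrBlDr lerBrDr.
rewrite !lebesgue_measure_itv/= !lte_fin ltrD2r.
by case: ifP => // _; rewrite -!EFinB; congr EFin; ring.
Qed.

Lemma integral_lebesgue_translate (a : R) (f : R -> \bar R) :
  measurable_fun setT f -> (forall x, 0 <= f x) ->
  \int[mu]_x f (x + a)%R = \int[mu]_x f x.
Proof.
move=> mf f0.
have ma : measurable_fun setT (fun x : measurableTypeR R => (x + a)%R : measurableTypeR R).
  exact: measurable_funD.
have := @ge0_integral_pushforward _ _ _ _ R _ ma mu setT f measurableT mf.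
rewrite preimage_setT => <- //.
apply: eq_measure_integral => /= A mA _; exact: lebesgue_measure_translate.
Qed.

End lebesgue_line.

Section lebesgue_tuple_integral.
Context {R : realType}.
Local Notation T := (measurableTypeR R).
Local Notation mu := (@lebesgue_measure R).
Local Open Scope ereal_scope.

Lemma integral_lebesgue_tupleS n (f : n.+1.-tuple T -> \bar R) :
  measurable_fun setT f -> (forall t, 0 <= f t) ->
  \int[lebesgue_tuple R n.+1]_t f t =
  \int[mu]_x \int[lebesgue_tuple R n]_t f (tcons (x, t)).
Proof.
move=> mf f0.
transitivity (\int[mu \x lebesgue_tuple R n]_z (f \o @tcons R n) z).
  exact: (@ge0_integral_pushforward _ _ _ _ R _ (@measurable_tcons R n)
  (mu \x lebesgue_tuple R n) setT f measurableT mf (fun y _ => f0 y)).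
rewrite (fubini_tonelli1 (f \o @tcons R n))//.
  by apply: measurableT_comp => //; exact: measurable_tcons.
by move=> x; exact: f0.
Qed.

Definition tuple_add n (t a : n.-tuple T) : n.-tuple T :=
  [tuple (tnth t i + tnth a i)%R | i < n].

Lemma measurable_tuple_add n (a : n.-tuple T) :
  measurable_fun setT (fun t => tuple_add t a).
Proof.
apply/measurable_fun_tnthP => i.
rewrite (_ : _ \o _ = fun t : n.-tuple T => (tnth t i + tnth a i)%R); last first.
  by apply/funext => t; rewrite /= tnth_mktuple.
by apply: measurable_funD => //; exact: measurable_tnth.
Qed.

Lemma tuple_add_tcons n (a : n.+1.-tuple T) (x : T) (t : n.-tuple T) :
  tuple_add (tcons (x, t)) a =
  tcons ((x + (tuncons a).1)%R : T, tuple_add t (tuncons a).2).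
Proof.
apply: eq_from_tnth => i; rewrite tnth_mktuple.
case: (unliftP ord0 i) => [j|] ->.
  rewrite /tcons !tnthS tnth_mktuple; congr (_ + _)%R.
  by rewrite !(tnth_nth 0%R)/= nth_behead.
by rewrite /tcons !tnth0.
Qed.

Lemma integral_lebesgue_tuple_translate n (a : n.-tuple T)
  (f : n.-tuple T -> \bar R) :
  measurable_fun setT f -> (forall t, 0 <= f t) ->
  \int[lebesgue_tuple R n]_t f (tuple_add t a) = \int[lebesgue_tuple R n]_t f t.
Proof.
elim: n a f => [|n IHn] a f mf f0.
  by apply: eq_integral => t _; rewrite (tuple0 t) (tuple0 (tuple_add _ _)).
have mft : measurable_fun setT (f \o @tcons R n).
  by apply: measurableT_comp => //; exact: measurable_tcons.
rewrite integral_lebesgue_tupleS//; last first.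
  by apply: measurableT_comp => //; exact: measurable_tuple_add.
under eq_integral do under eq_integral do rewrite tuple_add_tcons.
under eq_integral => x _.
  rewrite (IHn _ (fun t => f (tcons ((x + (tuncons a).1)%R : T, t))))//; last first.
    exact: measurableT_comp mft (measurable_pair1 _).
  over.
rewrite integral_lebesgue_tupleS//.
rewrite (@integral_lebesgue_translate _ _ (fun x => \int[lebesgue_tuple R n]_t f (tcons (x, t))))//.
  exact: (@measurable_fun_fubini_tonelli_F _ _ _ _ _ (lebesgue_tuple R n) (f \o @tcons R n) mft (fun _ => f0 _)).
by move=> x; exact: integral_ge0.
Qed.

Lemma integral_lebesgue_tuple_prod n (h : T -> R) :
  measurable_fun setT h -> (forall x, 0 <= h x)%R ->
  \int[lebesgue_tuple R n]_t (\prod_(i < n) h (tnth t i))%:E =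
  (\int[mu]_x (h x)%:E) ^+ n.
Proof.
move=> mh h0; elim: n => [|n IHn].
  transitivity (\int[\d_([tuple] : 0.-tuple T)]_t (1%:E : \bar R)).
    by apply: eq_integral => t _; rewrite big_ord0.
  by rewrite integral_dirac// diracT mul1e expe0.
rewrite integral_lebesgue_tupleS; last 2 first.
- apply/measurable_EFinP; apply: measurable_prod => i _.
  by apply: measurableT_comp => //; exact: measurable_tnth.
- by move=> t; rewrite lee_fin prodr_ge0.
transitivity (\int[mu]_x ((h x)%:E * (\int[mu]_x (h x)%:E) ^+ n)).
  apply: eq_integral => x _.
  rewrite -IHn -ge0_integralZl//; last 3 first.
  - apply/measurable_EFinP; apply: measurable_prod => i _.
    by apply: measurableT_comp => //; exact: measurable_tnth.
  - by move=> t _; rewrite lee_fin prodr_ge0.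
  - by rewrite lee_fin.
  apply: eq_integral => t _; rewrite big_ord_recl /tcons tnth0 EFinM.
  by congr (_ * _%:E); apply: eq_bigr => i _; rewrite tnthS.
rewrite ge0_integralZr//.
- by rewrite expeS.
- exact/measurable_EFinP.
- by move=> x _; rewrite lee_fin.
- by rewrite expe_ge0// integral_ge0// => x _; rewrite lee_fin.
Qed.

End lebesgue_tuple_integral.

Section volume.
Context {R : realType} (V : euclid R).
Local Notation T := (measurableTypeR R).
Local Open Scope ereal_scope.

Definition onb_coord (x : borel V) : (\dim {:V}).-tuple T :=
  [tuple dotp V (onb V i) x | i < \dim {:V}].

Lemma measurable_onb_coord : measurable_fun setT onb_coord.
Proof.
apply/measurable_fun_tnthP => i.
rewrite (_ : _ \o _ = dotp V (onb V i)); first exact: measurable_dotp.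
by apply/funext => x; rewrite /= tnth_mktuple.
Qed.

Lemma onb_combinationK : cancel (@onb_combination R V) onb_coord.
Proof.
move=> t; apply: eq_from_tnth => i; rewrite tnth_mktuple dotp_sumr.
rewrite (bigD1 i)//= dotpZr onbP eqxx mulr1 big1 ?addr0// => j ji.
by rewrite dotpZr onbP eq_sym (negPf ji) mulr0.
Qed.

Lemma onb_combination_add t (a : V) :
  onb_combination (tuple_add t (onb_coord a)) = ((onb_combination t : V) + a)%R.
Proof.
rewrite [in RHS](onb_expand a) -big_split/=; apply: eq_bigr => i _.
by rewrite !tnth_mktuple (dotpC a) scalerDl.
Qed.

(* A constant of its own, so that sigma-finiteness can be attached to it. *)
Definition volume : set (borel V) -> \bar R := lebesgue V.
HB.instance Definition _ := Measure.on volume.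

Let volume_sigma_finite : sigma_finite setT volume.
Proof.
have /sigma_finiteP[F [TF _ Foo]] := sigma_finiteT (lebesgue_tuple R (\dim {:V})).
exists (fun k => onb_coord @^-1` F k).
  by rewrite -preimage_bigcup -TF preimage_setT.
move=> k; have [mFk Fkoo] := Foo k; split.
  by rewrite -[X in measurable X]setTI; exact: measurable_onb_coord.
rewrite /volume/= /image_measure /pushforward -comp_preimage.
rewrite (_ : _ \o _ = id) ?preimage_id//.
by apply/funext => t; exact: onb_combinationK.
Qed.

HB.instance Definition _ := @Measure_isSigmaFinite.Build _ _ _
  volume volume_sigma_finite.

Lemma integral_volume (f : borel V -> \bar R) :
  measurable_fun setT f -> (forall x, 0 <= f x) ->
  \int[volume]_x f x =
  \int[lebesgue_tuple R (\dim {:V})]_t f (onb_combination t).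
Proof.
move=> mf f0.
exact: (@ge0_integral_pushforward _ _ _ _ R _ (@measurable_onb_combination R V)
  (lebesgue_tuple R (\dim {:V})) setT f measurableT mf (fun y _ => f0 y)).
Qed.

Lemma integral_volume_translate (a : V) (f : borel V -> \bar R) :
  measurable_fun setT f -> (forall x, 0 <= f x) ->
  \int[volume]_x f ((x : V) + a)%R = \int[volume]_x f x.
Proof.
move=> mf f0.
have mfc : measurable_fun setT (f \o @onb_combination R V).
  by apply: measurableT_comp => //; exact: measurable_onb_combination.
rewrite !integral_volume//; last first.
  have ma : measurable_fun setT (fun x : borel V => ((x : V) + a)%R : borel V).
    exact: (@measurable_borelD _ _ _ _ id (cst (a : borel V))).
  exact: (measurableT_comp mf ma).
rewrite -[RHS](@integral_lebesgue_tuple_translate _ _ (onb_coord a) (f \o @onb_combination R V))//; last by move=> t; exact: f0.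
by apply: eq_integral => t _; rewrite /= onb_combination_add.
Qed.

End volume.
Arguments volume {R} V.

(** * Gaussian kernels, densities and laws *)

Section gauss_kernel.
Context {R : realType}.
Local Open Scope ereal_scope.

(** The number sqrt(2 pi t), kept as an integral: masses are compared and cancelled below, never
    evaluated. *)
Definition gauss_mass (t : R) : R :=
  fine (\int[lebesgue_measure]_x (expR (- (x ^+ 2 / (2 * t))))%:E)%E.

(** A positive multiple of the integrand is the normal density of variance t, whose integral is 1;
    this excludes the values 0 and +oo. *)
Lemma gauss_massE (t : R) : (0 < t)%R ->
  (\int[lebesgue_measure]_x (expR (- (x ^+ 2 / (2 * t))))%:E)%E = (gauss_mass t)%:E
  /\ (0 < gauss_mass t)%R.
Proof.
move=> t0; pose s := Num.sqrt t.
have s0 : s != 0%R by rewrite gt_eqF// sqrtr_gt0.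
have st : (s ^+ 2 = t)%R by rewrite sqr_sqrtr// ltW.
have fE x : (normal_pdf 0 s x = normal_peak s * expR (- (x ^+ 2 / (2 * t))))%R.
  rewrite /normal_pdf (negPf s0) /normal_fun subr0 mulNr st.
  by rewrite -(mulr_natl t).
have mf : measurable_fun setT (fun x : R => expR (- (x ^+ 2 / (2 * t)))).
  apply: measurableT_comp => //; apply: measurableT_comp => //.
  by apply: measurable_funM => //; exact: measurable_funX.
have := @integral_normal_pdf R 0 s.
under eq_integral do rewrite fE EFinM.
rewrite ge0_integralZl//; last 2 first.
- exact/measurable_EFinP.
- by rewrite lee_fin normal_peak_ge0.
rewrite /gauss_mass.
have p0 := normal_peak_gt0 s0.
case: (\int[_]_x _) => [r| |] //=.
- rewrite -EFinM => -[pr]; split => //.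
  by rewrite -(pmulr_rgt0 _ p0) pr.
- by rewrite gt0_muley ?lte_fin.
- by rewrite gt0_muleNy ?lte_fin.
Qed.

Lemma gauss_mass_gt0 (t : R) : (0 < t)%R -> (0 < gauss_mass t)%R.
Proof. by move=> /gauss_massE[]. Qed.

Variable V : euclid R.

Definition gauss_kernel (t : R) (x : V) : R := expR (- (dotp V x x / (2 * t))).

Lemma gauss_kernel_gt0 t x : (0 < gauss_kernel t x)%R.
Proof. exact: expR_gt0. Qed.

Lemma gauss_kernel_ge0 t x : (0 <= gauss_kernel t x)%R.
Proof. exact: expR_ge0. Qed.

Lemma measurable_gauss_kernel t :
  measurable_fun setT (gauss_kernel t : borel V -> R).
Proof.
apply: measurableT_comp => //; apply: measurableT_comp => //.
by apply: measurable_funM => //; apply: measurable_dotp2.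
Qed.

Lemma integral_gauss_kernel t : (0 < t)%R ->
  \int[volume V]_x (gauss_kernel t x)%:E = (gauss_mass t ^+ \dim {:V})%:E.
Proof.
move=> t0; rewrite integral_volume//; last 2 first.
- apply/measurable_EFinP; exact: (@measurable_gauss_kernel t).
- by move=> x; rewrite lee_fin gauss_kernel_ge0.
have [massE _] := gauss_massE t0.
rewrite EFin_expe -massE -integral_lebesgue_tuple_prod//; last first.
  apply: measurableT_comp => //; apply: measurableT_comp => //.
  by apply: measurable_funM => //; exact: measurable_funX.
apply: eq_integral => u _; rewrite /gauss_kernel dotp_onb -expR_sum.
rewrite mulr_suml sumrN; congr (expR (- _))%:E; apply: eq_bigr => i _.
rewrite -[X in dotp V _ X]/(onb_combination u).
have := congr1 (fun t => tnth t i) (onb_combinationK u).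
by rewrite tnth_mktuple => ->.
Qed.

End gauss_kernel.

Section integral_density.
Local Open Scope ereal_scope.
Context d (T : measurableType d) (R : realType).
Variables (mu nu : {measure set T -> \bar R}) (p : T -> R).
Hypotheses (mp : measurable_fun setT p) (p0 : forall x, (0 <= p x)%R).
Hypothesis nuE : forall A, measurable A -> nu A = \int[mu]_(x in A) (p x)%:E.

Import HBNNSimple.

(** [nuE] is the case of indicators; linearity gives simple functions, and monotone convergence the
    rest. *)
Lemma ge0_integral_density (f : T -> \bar R) :
  measurable_fun setT f -> (forall x, 0 <= f x) ->
  \int[nu]_x f x = \int[mu]_x (f x * (p x)%:E).
Proof.
move=> mf f0; pose h := nnsfun_approx measurableT mf.
have mpE : measurable_fun setT (EFin \o p) by exact/measurable_EFinP.
transitivity (limn (fun n => \int[nu]_x (h n x)%:E)).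
  rewrite -monotone_convergence//.
  - by apply: eq_integral => x _; apply/esym/cvg_lim => //; exact: cvg_nnsfun_approx.
  - by move=> n; exact/measurable_EFinP.
  - by move=> n x _; rewrite lee_fin.
  - by move=> x _ a b ab; rewrite lee_fin; exact/lefP/nd_nnsfun_approx.
transitivity (limn (fun n => \int[mu]_x ((h n x)%:E * (p x)%:E))); last first.
  rewrite -monotone_convergence//.
  - apply: eq_integral => x _; apply/cvg_lim => //; apply: cvgeZr => //.
    exact: cvg_nnsfun_approx.
  - by move=> n; apply: emeasurable_funM => //; exact/measurable_EFinP.
  - by move=> n x _; rewrite mule_ge0// lee_fin.
  - move=> x _ a b ab; rewrite lee_wpmul2r ?lee_fin//.
    exact/lefP/nd_nnsfun_approx.
congr (limn _); apply/funext => n.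
transitivity (\int[nu]_x
   (\sum_(y \in range (h n)) (y * \1_(h n @^-1` [set y]) x)%:E)).
  by apply: eq_integral => t tE; rewrite /= fimfunE -fsumEFin.
have indich r : measurable_fun setT (fun x => (r * \1_(h n @^-1` [set r]) x)%:E).
  by apply: (measurable_comp measurableT) => //; exact: measurable_funM.
rewrite ge0_integral_fsum//; last by move=> m y Ey; exact: nnfun_muleindic_ge0.
transitivity (\int[mu]_x (\sum_(y \in range (h n))
    (y * \1_(h n @^-1` [set y]) x)%:E * (p x)%:E)); last first.
  under [RHS]eq_integral => x xE.
    rewrite fimfunE -fsumEFin// ge0_mule_fsuml => [|y]; last exact: nnfun_muleindic_ge0.
    over.
  by [].
rewrite ge0_integral_fsum//; last 2 first.
  - by move=> y; apply: emeasurable_funM.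
  - by move=> m y Ey; apply: mule_ge0; [exact: nnfun_muleindic_ge0|rewrite lee_fin].
apply: eq_fsbigr => r rhn.
under [LHS]eq_integral do rewrite EFinM.
rewrite integralZl_indic_nnsfun => //.
under [RHS]eq_integral do rewrite EFinM -muleA.
rewrite ge0_integralZl//.
- under [in RHS]eq_integral do rewrite muleC.
  rewrite [in RHS](eq_integral ((EFin \o p) \_ (h n @^-1` [set r]))); last first.
    by move=> x xE; rewrite epatch_indic.
  by rewrite -integral_mkcondr setTI -nuE// integral_indic// setIT.
- by apply: emeasurable_funM => //; exact/measurable_EFinP.
- by move=> t Et; rewrite mule_ge0 ?lee_fin.
- by move: rhn; rewrite inE => -[t _ <-]; rewrite lee_fin.
Qed.

End integral_density.

Section gauss.
Context {R : realType} (V : euclid R).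
Local Open Scope ereal_scope.
Implicit Types (t : R).

Definition gauss_pdf t (x : borel V) : R :=
  (gauss_kernel t x / gauss_mass t ^+ \dim {:V})%R.

Lemma measurable_gauss_pdf t : measurable_fun setT (gauss_pdf t).
Proof. by apply: measurable_funM => //; exact: measurable_gauss_kernel. Qed.

Lemma gauss_mass_ge0 t : (0 <= gauss_mass t)%R.
Proof. by rewrite fine_ge0// integral_ge0// => x _; rewrite lee_fin expR_ge0. Qed.

Lemma gauss_pdf_ge0 t x : (0 <= gauss_pdf t x)%R.
Proof. by rewrite divr_ge0 ?gauss_kernel_ge0// exprn_ge0// gauss_mass_ge0. Qed.

(* The centred Gaussian law of covariance [t] times the identity; the point
   mass for [t <= 0] makes it a probability for every [t]. *)
Definition gauss t (A : set (borel V)) : \bar R :=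
  if (0 < t)%R then \int[volume V]_(x in A) (gauss_pdf t x)%:E
  else \d_(0%R : borel V) A.

Let gauss0 t : gauss t set0 = 0.
Proof. by rewrite /gauss; case: ifP => _; [rewrite integral_set0|exact: measure0]. Qed.

Let gauss_ge0 t A : 0 <= gauss t A.
Proof.
rewrite /gauss; case: ifP => _ //.
by apply: integral_ge0 => x _; rewrite lee_fin gauss_pdf_ge0.
Qed.

Let gauss_sigma_additive t : semi_sigma_additive (gauss t).
Proof.
have [t0|t0] := boolP (0 < t)%R; last first.
  rewrite (_ : gauss t = \d_(0%R : borel V)); first exact: measure_semi_sigma_additive.
  by apply/funext => A; rewrite /gauss (negPf t0).
rewrite (_ : gauss t = fun A => \int[volume V]_(x in A) (gauss_pdf t x)%:E); last first.
  by apply/funext => A; rewrite /gauss t0.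
move=> F mF tF mUF; rewrite ge0_integral_bigcup//; last 2 first.
- by apply: measurable_funTS; apply/measurable_EFinP; exact: measurable_gauss_pdf.
- by move=> x _; rewrite lee_fin gauss_pdf_ge0.
apply: is_cvg_ereal_nneg_natsum_cond => n _ _.
by apply: integral_ge0 => x _; rewrite lee_fin gauss_pdf_ge0.
Qed.

HB.instance Definition _ t := isMeasure.Build _ _ _
  (gauss t) (gauss0 t) (@gauss_ge0 t) (@gauss_sigma_additive t).

Let gauss_setT t : gauss t setT = 1.
Proof.
rewrite /gauss; case: ifP => t0; last by rewrite diracT.
under eq_integral do rewrite EFinM.
have Z0 : (0 < gauss_mass t ^+ \dim {:V})%R by rewrite exprn_gt0// gauss_mass_gt0.
rewrite ge0_integralZr//.
- by rewrite integral_gauss_kernel// -EFinM divff// gt_eqF.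
- apply/measurable_EFinP; exact: measurable_gauss_kernel.
- by move=> x _; rewrite lee_fin gauss_kernel_ge0.
- by rewrite lee_fin invr_ge0 ltW.
Qed.

HB.instance Definition _ t :=
  @Measure_isProbability.Build _ _ R (gauss t) (gauss_setT t).

Lemma integral_gauss t (f : borel V -> \bar R) : (0 < t)%R ->
  measurable_fun setT f -> (forall x, 0 <= f x) ->
  \int[gauss t]_x f x =
  \int[volume V]_x (f x * (gauss_kernel t x)%:E) * ((gauss_mass t ^+ \dim {:V})^-1)%:E.
Proof.
move=> t0 mf f0; rewrite (@ge0_integral_density _ _ _ (volume V) _ (gauss_pdf t))//.
- rewrite -ge0_integralZr//.
  + by apply: eq_integral => x _; rewrite -muleA -EFinM.
  + by apply: emeasurable_funM => //; apply/measurable_EFinP; exact: measurable_gauss_kernel.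
  + by move=> x _; rewrite mule_ge0// lee_fin gauss_kernel_ge0.
  + by rewrite lee_fin invr_ge0 exprn_ge0// gauss_mass_ge0.
- exact: measurable_gauss_pdf.
- exact: gauss_pdf_ge0.
- by move=> A mA; rewrite -[LHS]/(gauss t A) /gauss t0.
Qed.

Lemma gauss_kernelN t (x : V) : gauss_kernel t (- x) = gauss_kernel t x.
Proof. by rewrite /gauss_kernel dotpNr dotpC dotpNr opprK. Qed.

End gauss.
Arguments gauss {R} V t.

(** * Gaussian laws under translations, coisometries and sums *)

Section coisometry.
Context {R : realType} (V W : euclid R) (A : 'Hom(V, W)).
Hypothesis AA : (A \o adjoint A)%VF = \1%VF.

Lemma coisometryK : cancel (adjoint A) A.
Proof.
move=> y; have := congr1 (fun B : 'End(W) => B y) AA.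
by rewrite /= comp_lfunE id_lfunE.
Qed.

(** |x|^2 - |A x|^2 is the squared norm of the component of x in ker A, and A^* y is orthogonal to
    ker A. *)
Lemma coisometry_defect (x : V) (y : W) :
  dotp V (x - adjoint A y) (x - adjoint A y) -
    dotp W (A (x - adjoint A y)) (A (x - adjoint A y)) =
  dotp V x x - dotp W (A x) (A x).
Proof.
rewrite (linearB A)/= coisometryK !dotp_sqrB -!(adjointP A) coisometryK.
ring.
Qed.

End coisometry.

Section gauss_change_of_variables.
Context {R : realType}.
Local Open Scope ereal_scope.
Implicit Types (t : R) (V W : euclid R).

Lemma measurable_translate V (a : V) :
  measurable_fun setT (fun x : borel V => ((x : V) + a)%R : borel V).
Proof. exact: (@measurable_borelD _ _ _ _ id (cst (a : borel V))). Qed.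

Lemma gauss_kernel_translate V t (w x : V) : t != 0%R ->
  (gauss_kernel t (x - w)
   = gauss_kernel t x * expR (dotp V w x / t - dotp V w w / (2 * t)))%R.
Proof.
move=> t0; rewrite /gauss_kernel -expRD; congr expR.
by rewrite dotp_sqrB (dotpC x w); field.
Qed.

(** Cameron-Martin for non-negative integrands: translate Lebesgue measure by - w and complete the
    square in the kernel. *)
Lemma ge0_integral_gauss_translate V t (w : V) (f : borel V -> \bar R) :
  (0 < t)%R -> measurable_fun setT f -> (forall x, 0 <= f x) ->
  \int[gauss V t]_x f ((x : V) + w)%R =
  \int[gauss V t]_x (f x *
    (expR (dotp V w x / t - dotp V w w / (2 * t)))%:E).
Proof.
move=> t0 mf f0.
have mfw := measurableT_comp mf (measurable_translate w).
have mE : measurable_fun setT (fun x : borel V =>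
    (expR (dotp V w x / t - dotp V w w / (2 * t)))%:E).
  apply/measurable_EFinP; apply: measurableT_comp => //.
  apply: measurable_funB => //; apply: measurable_funM => //.
  exact: measurable_dotp.
rewrite !integral_gauss//; last 2 first.
- exact: emeasurable_funM.
- by move=> x; rewrite mule_ge0// lee_fin expR_ge0.
congr (_ * _).
have mF : measurable_fun setT
    (fun x : borel V => f ((x : V) + w)%R * (gauss_kernel t x)%:E).
  apply: emeasurable_funM => //.
  by apply/measurable_EFinP; exact: measurable_gauss_kernel.
rewrite -[LHS](integral_volume_translate (- w)%R mF)/=; last first.
  by move=> x; rewrite mule_ge0// lee_fin gauss_kernel_ge0.
apply: eq_integral => x _; rewrite subrK gauss_kernel_translate ?gt_eqF//.
by rewrite EFinM muleAC muleA.
Qed.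

Lemma integral_gauss_cst V t (c : R) : \int[gauss V t]_x c%:E = c%:E.
Proof.
rewrite integral_cst// (_ : _ setT = 1) ?mule1//.
exact: (@probability_setT _ _ _ (gauss V t)).
Qed.

(** The Cameron-Martin density of the drift t w has total mass 1. *)
Lemma integral_gauss_mgf V t (w : V) : (0 < t)%R ->
  \int[gauss V t]_x (expR (dotp V w x))%:E = (expR (t * dotp V w w / 2))%:E.
Proof.
move=> t0.
have := @ge0_integral_gauss_translate V t (t *: w) (cst 1) t0.
rewrite integral_gauss_cst => /(_ (measurable_cst _) (fun=> lee01)).
under eq_integral => x _.
  rewrite mul1e !dotpZl dotpZr.
  rewrite (_ : _ - _ = dotp V w x - t * dotp V w w / 2)%R; last first.
    by field; rewrite gt_eqF.
  rewrite expRB EFinM. over.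
rewrite /= ge0_integralZr//; last first.
  apply/measurable_EFinP; apply: measurableT_comp => //; exact: measurable_dotp.
move=> /esym h; rewrite -[RHS]mul1e -h -muleA -EFinM mulVf ?mule1//.
by rewrite gt_eqF// expR_gt0.
Qed.

(** Turns a cross-multiplied identity into an equality of normalised integrals; these may be
    infinite, the masses a and b not. *)
Lemma mule_cross_div (a b : R) (x y : \bar R) : (0 < a)%R -> (0 < b)%R ->
  a%:E * x = y * b%:E -> y * (a^-1)%:E = x * (b^-1)%:E.
Proof.
move=> a0 b0 h.
have -> : y = a%:E * x * (b^-1)%:E.
  by rewrite h -muleA -EFinM divff ?gt_eqF// mule1.
by rewrite muleAC (muleAC a%:E) -EFinM divff ?gt_eqF// mul1e.
Qed.

(** Instead of splitting V along ker A, the double integral of k(x) p(A x) g(y + A x) over V and W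
    is computed in two ways. Integrating over y gives the left side of [key]; substituting x - A^* y
    for x, which fixes k and turns A x into A x - y, gives the right side. *)
Lemma ge0_integral_gauss_coisometry V W t (A : 'Hom(V, W)) (f : borel W -> \bar R) :
  (A \o adjoint A)%VF = \1%VF ->
  (0 < t)%R -> measurable_fun setT f -> (forall x, 0 <= f x) ->
  \int[gauss V t]_x f (A x) = \int[gauss W t]_y f y.
Proof.
move=> AA t0 mf f0.
have AAE := coisometryK AA.
(* The Gaussian kernel factors as k(x) p(A x), where k sees only the component of x in ker A. *)
pose k (x : borel V) := expR (- ((dotp V x x - dotp W (A x) (A x)) / (2 * t))).
have mA : measurable_fun setT (fun x : borel V => A x : borel W).
  exact: (@measurable_borel_lfun _ _ _ A _ _ id).
have mk : measurable_fun setT k.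
  apply: measurableT_comp => //; apply: measurableT_comp => //.
  apply: measurable_funM => //; apply: measurable_funB; exact: measurable_dotp2.
pose p (y : borel W) := gauss_kernel t y.
have mp : measurable_fun setT p by exact: measurable_gauss_kernel.
have p0 y : (0 <= p y)%R by exact: gauss_kernel_ge0.
have k0 x : (0 <= k x)%R by exact: expR_ge0.
have kp x : (k x * p (A x) = gauss_kernel t x)%R.
  by rewrite /k /p /gauss_kernel -expRD; congr expR; field; rewrite gt_eqF.
have kshift (x : V) (y : W) : k (x - adjoint A y)%R = k x.
  by rewrite /k coisometry_defect.
have key (g : borel W -> \bar R) : measurable_fun setT g -> (forall y, 0 <= g y) ->
    \int[volume V]_x (gauss_kernel t x)%:E * \int[volume W]_y g y =
    \int[volume V]_x ((k x)%:E * g (A x)) * \int[volume W]_y (p y)%:E.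
  move=> mg g0.
  have mgA : measurable_fun setT (fun x : borel V => g (A x)).
    exact: measurableT_comp mg mA.
  have mAf d (T : measurableType d) (h : T -> borel V) : measurable_fun setT h ->
      measurable_fun setT (fun z => A (h z) : borel W).
    by move=> mh; exact: measurableT_comp mA mh.
  have m1 : measurable_fun setT (fun z : borel V * borel W =>
      (k z.1)%:E * (p (A z.1))%:E * g ((z.2 : W) + A z.1)%R).
    apply: emeasurable_funM; first apply: emeasurable_funM.
    - by apply/measurable_EFinP; exact: measurableT_comp mk _.
    - by apply/measurable_EFinP; apply: (measurableT_comp mp); exact: mAf.
    - apply: (measurableT_comp mg); apply: measurable_borelD => //; exact: mAf.
  have m2 : measurable_fun setT (fun z : borel V * borel W =>
      (k z.1)%:E * (p (A z.1 - (z.2 : W))%R)%:E * g (A z.1)).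
    apply: emeasurable_funM; first apply: emeasurable_funM.
    - by apply/measurable_EFinP; exact: measurableT_comp mk _.
    - apply/measurable_EFinP; apply: (measurableT_comp mp).
      under eq_fun do rewrite -scaleN1r.
      apply: measurable_borelD; first exact: mAf.
      exact: measurable_borelZ.
    - by apply: (measurableT_comp mg); exact: mAf.
  transitivity (\int[volume V]_x \int[volume W]_y
      ((k x)%:E * (p (A x))%:E * g ((y : W) + A x)%R)).
    rewrite -ge0_integralZr//; last 3 first.
    - by apply/measurable_EFinP; exact: measurable_gauss_kernel.
    - by move=> x _; rewrite lee_fin gauss_kernel_ge0.
    - exact: integral_ge0.
    apply: eq_integral => x _.
    rewrite ge0_integralZl//; last 2 first.
    - exact: measurableT_comp mg (measurable_translate _).
    - by rewrite mule_ge0// lee_fin.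
    by rewrite integral_volume_translate// -kp EFinM.
  rewrite (fubini_tonelli (fun z : borel V * borel W => (k z.1)%:E * (p (A z.1))%:E * g ((z.2 : W) + A z.1)%R) m1)//; last first.
    by move=> z; rewrite !mule_ge0// lee_fin.
  transitivity (\int[volume W]_y \int[volume V]_x
      ((k x)%:E * (p (A x - (y : W)))%:E * g (A x))).
    apply: eq_integral => y _.
    have F0 (x : borel V) : 0 <= (k x)%:E * (p (A x))%:E * g ((y : W) + A x)%R.
      by rewrite !mule_ge0// lee_fin.
    rewrite -[LHS](integral_volume_translate (- adjoint A y)%R
      (measurableT_comp m1 (measurable_pair2 y)) F0)/=.
    apply: eq_integral => x _.
    by rewrite (linearB A)/= AAE kshift (addrC y) subrK.
  rewrite -(fubini_tonelli (fun z : borel V * borel W => (k z.1)%:E * (p (A z.1 - (z.2 : W))%R)%:E * g (A z.1)) m2)//; last first.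
    by move=> z; rewrite !mule_ge0// lee_fin.
  rewrite -ge0_integralZr//; last 3 first.
  - by apply: emeasurable_funM => //; apply/measurable_EFinP.
  - by move=> x _; rewrite mule_ge0// lee_fin.
  - by apply: integral_ge0 => y _; rewrite lee_fin.
  apply: eq_integral => x _.
  have mpx : measurable_fun setT (fun y : borel W => (p ((y : W) + (- A x)))%:E).
    by apply/measurable_EFinP; exact: measurableT_comp mp (measurable_translate _).
  rewrite -(integral_volume_translate (- A x)%R (f := fun y => (p y)%:E))//.
  - rewrite -ge0_integralZl//; last 2 first.
    + by move=> y _; rewrite lee_fin.
    + by rewrite mule_ge0// lee_fin.
    apply: eq_integral => y _.
    by rewrite muleAC -opprB /p gauss_kernelN.
  - exact/measurable_EFinP.
have mfA := measurableT_comp mf mA.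
rewrite !integral_gauss//.
have mfp : measurable_fun setT (fun y => f y * (p y)%:E).
  by apply: emeasurable_funM => //; exact/measurable_EFinP.
have fp0 y : 0 <= f y * (p y)%:E by rewrite mule_ge0// lee_fin.
(* For g = f p the integrand k(x) g(A x) is f(A x) times the kernel on V. *)
have := key _ mfp fp0; rewrite !integral_gauss_kernel//.
rewrite [in X in _ -> X](eq_integral (fun x => (k x)%:E * (f (A x) * (p (A x))%:E))); last first.
  by move=> x _; rewrite muleCA -EFinM kp.
by apply: mule_cross_div; exact/exprn_gt0/gauss_mass_gt0.
Qed.

(** Completing the square in x; s t / (s + t) is the conditional variance of the first summand when
    the sum is known to be y. *)
Lemma gauss_kernel_convolution V (s t : R) (x y : V) : (0 < s)%R -> (0 < t)%R ->
  (gauss_kernel t (y - x) * gauss_kernel s x = gauss_kernel (s + t) y *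
   gauss_kernel (s * t / (s + t)) (x - (s / (s + t)) *: y))%R.
Proof.
move=> s0 t0; rewrite /gauss_kernel -!expRD; congr expR.
rewrite !dotp_sqrB !(dotpZl, dotpZr) (dotpC y x).
by field; rewrite !gt_eqF ?addr_gt0.
Qed.

Lemma ge0_integral_gauss_add V (s t : R) (f : borel V -> \bar R) :
  (0 < s)%R -> (0 < t)%R -> measurable_fun setT f -> (forall x, 0 <= f x) ->
  \int[gauss V s]_x \int[gauss V t]_y f ((x : V) + y)%R =
  \int[gauss V (s + t)]_y f y.
Proof.
move=> s0 t0 mf f0.
have st0 : (0 < s + t)%R by exact: addr_gt0.
pose r := (s * t / (s + t))%R.
have r0 : (0 < r)%R by rewrite divr_gt0 ?mulr_gt0.
pose G u : borel V -> R := gauss_kernel u.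
pose Z u : R := (gauss_mass u ^+ \dim {:V})%R.
have Z0 u : (0 < u)%R -> (0 < Z u)%R by move=> u0; exact/exprn_gt0/gauss_mass_gt0.
have mG u : measurable_fun setT (G u) by exact: measurable_gauss_kernel.
have G0 u x : (0 <= G u x)%R by exact: gauss_kernel_ge0.
have mfxy : measurable_fun setT (fun z : borel V * borel V => f ((z.1 : V) + z.2)%R).
  by apply: (measurableT_comp mf); exact: measurable_borelD.
have key (g : borel V -> \bar R) : measurable_fun setT g -> (forall y, 0 <= g y) ->
    \int[gauss V s]_x \int[gauss V t]_y g ((x : V) + y)%R =
    \int[volume V]_y (g y * (G (s + t) y)%:E) * (Z r * (Z t)^-1 * (Z s)^-1)%:E.
  move=> mg g0.
  have m2 : measurable_fun setT (fun z : borel V * borel V =>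
      g z.2 * (G t ((z.2 : V) + - z.1)%R * G s z.1)%:E).
    apply: emeasurable_funM; first exact: measurableT_comp mg _.
    apply/measurable_EFinP; apply: measurable_funM.
      apply: (measurableT_comp (mG t)); apply: measurable_borelD => //.
      by under eq_fun do rewrite -scaleN1r; exact: measurable_borelZ.
    exact: measurableT_comp (mG s) _.
  have p2 (z : borel V * borel V) : 0 <= g z.2 * (G t ((z.2 : V) + - z.1)%R * G s z.1)%:E.
    by rewrite mule_ge0// lee_fin mulr_ge0// G0.
  pose H (x : borel V) := \int[volume V]_y (g y * (G t ((y : V) - x)%R * G s x)%:E).
  have mH : measurable_fun setT H by exact: (measurable_fun_fubini_tonelli_F _ m2 p2).
  have inner (x : borel V) : \int[gauss V t]_y g ((x : V) + y)%R * (G s x)%:E =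
      H x * ((Z t)^-1)%:E.
    have mgx : measurable_fun setT (fun y : borel V => g ((x : V) + y)%R).
      by under eq_fun do rewrite addrC; exact: measurableT_comp mg (measurable_translate _).
    have mF : measurable_fun setT (fun y : borel V => g ((x : V) + y)%R * (G t y)%:E).
      by apply: emeasurable_funM => //; exact/measurable_EFinP.
    have F0 (y : borel V) : 0 <= g ((x : V) + y)%R * (G t y)%:E.
      by rewrite mule_ge0// lee_fin.
    rewrite integral_gauss// -(integral_volume_translate (- (x : V))%R mF F0).
    rewrite muleAC -ge0_integralZr//; last first.
    - by rewrite lee_fin G0.
    - exact: measurableT_comp mF (measurable_translate _).
    congr (_ * _); apply: eq_integral => y _.
    by rewrite -muleA -EFinM addrC subrK.
  have mI : measurable_fun setT (fun x : borel V => \int[gauss V t]_y g ((x : V) + y)%R).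
    have := @measurable_fun_fubini_tonelli_F _ _ _ _ _ (gauss V t)
      (fun z : borel V * borel V => g ((z.1 : V) + z.2)%R).
    apply => //; apply: (measurableT_comp mg); exact: measurable_borelD.
  rewrite integral_gauss//; last by move=> x; exact: integral_ge0.
  transitivity ((\int[volume V]_x (H x * ((Z t)^-1)%:E)) * ((Z s)^-1)%:E).
    by congr (_ * _); apply: eq_integral => x _; rewrite -inner.
  have H0 x : 0 <= H x by apply: integral_ge0 => y _; exact: (p2 (x, y)).
  have Zi0 u : (0 < u)%R -> 0 <= ((Z u)^-1)%:E by move=> u0; rewrite lee_fin invr_ge0 ltW// Z0.
  rewrite ge0_integralZr ?Zi0// -muleA -EFinM.
  rewrite /H (fubini_tonelli _ m2 p2)/= -[in RHS]mulrA (EFinM (Z r)) muleA; congr (_ * _).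
  transitivity (\int[volume V]_y (g y * (G (s + t) y)%:E * (Z r)%:E)); last first.
    rewrite ge0_integralZr//.
    - by apply: emeasurable_funM => //; exact/measurable_EFinP.
    - by move=> y _; rewrite mule_ge0// lee_fin G0.
    - by rewrite lee_fin ltW// Z0.
  apply: eq_integral => y _.
  have mK : measurable_fun setT (fun x : borel V => (G r x)%:E) by exact/measurable_EFinP.
  have K0 x : 0 <= (G r x)%:E by rewrite lee_fin.
  rewrite /Z -integral_gauss_kernel//.
  rewrite -[X in _ = _ * X](integral_volume_translate (- (s / (s + t) *: (y : V)))%R mK K0).
  rewrite -ge0_integralZl//; last 2 first.
  - exact: measurableT_comp mK (measurable_translate _).
  - by rewrite mule_ge0// lee_fin G0.
  apply: eq_integral => x _.
  by rewrite -muleA -EFinM /G gauss_kernel_convolution.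
(* [key] leaves a constant made of Gaussian masses; the case g = 1 identifies it as 1 / Z (s +
   t). *)
have h1 : \int[gauss V s]_x \int[gauss V t]_y cst 1 ((x : V) + y)%R = 1.
  rewrite -[RHS](integral_gauss_cst V s 1); apply: eq_integral => x _.
  exact: integral_gauss_cst.
have h2 : \int[volume V]_y (cst 1 y * (G (s + t) y)%:E) = (Z (s + t))%:E.
  rewrite /Z -(integral_gauss_kernel V st0).
  by apply: eq_integral => y _; rewrite mul1e.
have k1 := key (cst 1) (measurable_cst _) (fun=> lee01).
have /esym k2 := etrans (esym h1) (etrans k1 (congr1 ( *%E^~ _) h2)).
have h : (Z (s + t) * (Z r * (Z t)^-1 * (Z s)^-1) = 1)%R by case: k2.
have hZ : (Z r * (Z t)^-1 * (Z s)^-1 = (Z (s + t))^-1)%R.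
  by apply: (mulfI (lt0r_neq0 (Z0 _ st0))); rewrite h divff// gt_eqF// Z0.
rewrite [LHS](key f mf f0) [RHS](integral_gauss st0 mf f0).
by rewrite hZ.
Qed.

End gauss_change_of_variables.

(** * Bounds of powers by exponentials *)

Section expR_inequalities.
Context {R : realType}.
Implicit Types x a : R.

Lemma expR_ge1Dx2 x : 0 <= x -> 1 + x + x ^+ 2 / 2 <= expR x.
Proof.
move=> x0; rewrite /expR.
have := @nondecreasing_cvgn_le _ (series (exp_coeff x)) _ _ 3.
rewrite /series/= !big_nat_recl//= big_geq// /exp_coeff/= !expr0 expr1 !factS fact0.
rewrite !mul1n !muln1 divr1 addr0 divr1 addrA; apply.
- by apply: nondecreasing_series => k _ _; exact: exp_coeff_ge0.
- exact: is_cvg_series_exp_coeff.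
Qed.

(* sinh b >= b, applied at b = a / 2 and squared. *)
Lemma sqr_le_cosh a : 2 + a ^+ 2 <= expR a + expR (- a).
Proof.
wlog a0 : a / 0 <= a => [h|].
  have [/h//|a0] := leP 0 a.
  rewrite [leRHS]addrC -[a ^+ 2]sqrrN -[X in _ + expR X](opprK a).
  by apply: h; rewrite oppr_ge0 ltW.
pose b := a / 2; have b0 : 0 <= b by rewrite divr_ge0.
have e1 : 1 + b + b ^+ 2 / 2 <= expR b by exact: expR_ge1Dx2.
have e0 := expR_gt0 b; have e0' := expR_gt0 (- b).
have ee : expR b * expR (- b) = 1 by rewrite expRxMexpNx_1.
have bE : 2 * b <= expR b - expR (- b).
  rewrite -(ler_pM2r e0) mulrBl -expr2 (mulrC (expR (- b))) ee.
  nra.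
have -> : expR a = expR b ^+ 2 by rewrite expr2 -expRD; congr expR; rewrite /b; field.
have -> : expR (- a) = expR (- b) ^+ 2.
  by rewrite expr2 -expRD; congr expR; rewrite /b; field.
have -> : a = 2 * b by rewrite /b; field.
nra.
Qed.

(** a^4 / 4! is one term of the series of exp |a|. Fourth moments will follow from exponential
    ones. *)
Lemma pow4_le_cosh a : a ^+ 4 <= 24 * (expR a + expR (- a)).
Proof.
have h x : 0 <= x -> x ^+ 4 <= 24 * expR x.
  move=> x0; have := @expR_ge1Dxn _ x 3 x0.
  rewrite (_ : 4`!%:R = 24 :> R)//.
  have := exprn_ge0 4 x0; lra.
have := expR_gt0 a; have := expR_gt0 (- a).
have [a0|a0] := leP 0 a.
  by have := h a a0; lra.
have := h (- a); rewrite oppr_ge0 ltW// => /(_ isT).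
rewrite (_ : (- a) ^+ 4 = a ^+ 4); last by ring.
lra.
Qed.

End expR_inequalities.

(** * Gaussian expectations and the heat semigroup *)

Section gauss_expectation.
Context {R : realType} (V : euclid R).
Implicit Types (t c : R) (f g : borel V -> R) (w : V).

Definition gint t f : Prop := (gauss V t).-integrable setT (EFin \o f).

Definition gexp t f : R := \int[gauss V t]_x f x.

Lemma gint_measurable t f : gint t f -> measurable_fun setT f.
Proof. by move=> /integrableP[/measurable_EFinP]. Qed.

Lemma gexpE t f : gint t f -> (\int[gauss V t]_x (f x)%:E)%E = (gexp t f)%:E.
Proof. by move=> fi; rewrite /gexp /Rintegral fineK//; exact: integrable_fin_num. Qed.

Lemma gexp_eqE t f c : (\int[gauss V t]_x (f x)%:E)%E = c%:E -> gexp t f = c.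
Proof. by rewrite /gexp /Rintegral => ->. Qed.

Lemma eq_gexp t f g : f =1 g -> gexp t f = gexp t g.
Proof. by move=> fg; apply: eq_Rintegral => x _; exact: fg. Qed.

Lemma eq_gint t f g : f =1 g -> gint t f -> gint t g.
Proof. by move=> fg; apply: eq_integrable => // x _; rewrite /= fg. Qed.

Lemma gint_bounded t M f : measurable_fun setT f -> (forall x, `|f x| <= M) ->
  gint t f.
Proof.
move=> mf fM; apply: measurable_bounded_integrable => //.
  rewrite [ltLHS](_ : _ = 1%E) ?ltry//.
  exact: (@probability_setT _ _ _ (gauss V t)).
exists M; split => [|x Mx y _]; first by rewrite num_real.
exact: le_trans (fM y) (ltW Mx).
Qed.

Lemma gint_cst t c : gint t (cst c).
Proof. exact: (@gint_bounded _ `|c|). Qed.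

Lemma gintD t f g : gint t f -> gint t g -> gint t (fun x => f x + g x).
Proof. by move=> fi gi; have := integrableD measurableT fi gi. Qed.

Lemma gintZ t c f : gint t f -> gint t (fun x => c * f x).
Proof. by move=> fi; have := integrableZl measurableT c fi. Qed.

Lemma gintN t f : gint t f -> gint t (fun x => - f x).
Proof.
by move=> /(gintZ (-1)); apply: eq_gint => x; rewrite mulN1r.
Qed.

Lemma gintB t f g : gint t f -> gint t g -> gint t (fun x => f x - g x).
Proof. by move=> fi gi; apply: gintD => //; exact: gintN. Qed.

Lemma gint_sum t (I : Type) (s : seq I) (F : I -> borel V -> R) :
  (forall i, gint t (F i)) -> gint t (fun x => \sum_(i <- s) F i x).
Proof.
move=> Fi; elim: s => [|i s IHs].
  by apply: eq_gint (gint_cst t 0) => x; rewrite big_nil.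
by apply: eq_gint (gintD (Fi i) IHs) => x; rewrite big_cons.
Qed.

Lemma gint_le t f g : measurable_fun setT f -> (forall x, `|f x| <= g x) ->
  gint t g -> gint t f.
Proof.
move=> mf fg; apply: le_integrable => //; first exact/measurable_EFinP.
by move=> x _; rewrite lee_fin (le_trans (fg x))// ler_norm.
Qed.

Lemma gint_ltoo t f : measurable_fun setT f -> (forall x, 0 <= f x) ->
  (\int[gauss V t]_x (f x)%:E < +oo)%E -> gint t f.
Proof.
move=> mf f0 foo; apply/integrableP; split; first exact/measurable_EFinP.
by under eq_integral => x _ do rewrite /= ger0_norm//.
Qed.

Lemma gint_norm t f : gint t f -> gint t (fun x => `|f x|).
Proof. exact: integrable_norm. Qed.

Lemma gexp_cst t c : gexp t (cst c) = c.
Proof. by apply: gexp_eqE; exact: integral_gauss_cst. Qed.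

Lemma gexpD t f g : gint t f -> gint t g ->
  gexp t (fun x => f x + g x) = gexp t f + gexp t g.
Proof. by move=> fi gi; exact: RintegralD. Qed.

Lemma gexpB t f g : gint t f -> gint t g ->
  gexp t (fun x => f x - g x) = gexp t f - gexp t g.
Proof. by move=> fi gi; exact: RintegralB. Qed.

Lemma gexpZ t c f : gint t f -> gexp t (fun x => c * f x) = c * gexp t f.
Proof. by move=> fi; exact: RintegralZl. Qed.

Lemma gexpN t f : gint t f -> gexp t (fun x => - f x) = - gexp t f.
Proof.
move=> fi; rewrite -mulN1r -gexpZ//; apply: eq_gexp => x; by rewrite mulN1r.
Qed.

Lemma gexp_sum t (I : Type) (s : seq I) (F : I -> borel V -> R) :
  (forall i, gint t (F i)) ->
  gexp t (fun x => \sum_(i <- s) F i x) = \sum_(i <- s) gexp t (F i).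
Proof.
move=> Fi; elim: s => [|i s IHs].
  by rewrite big_nil -[RHS](gexp_cst t); apply: eq_gexp => x; rewrite big_nil.
rewrite big_cons -IHs -gexpD//; last exact: gint_sum.
by apply: eq_gexp => x; rewrite big_cons.
Qed.

Lemma le_gexp t f g : gint t f -> gint t g -> (forall x, f x <= g x) ->
  gexp t f <= gexp t g.
Proof. by move=> fi gi fg; exact: le_Rintegral. Qed.

Lemma gexp_ge0 t f : (forall x, 0 <= f x) -> 0 <= gexp t f.
Proof. by move=> f0; exact: Rintegral_ge0. Qed.

Lemma gexp_norm t f : gint t f -> `|gexp t f| <= gexp t (fun x => `|f x|).
Proof. by move=> fi; exact: le_normr_Rintegral. Qed.

Lemma gexp_bounds t m M f : gint t f -> (forall x, m <= f x <= M) ->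
  m <= gexp t f <= M.
Proof.
move=> fi fb; apply/andP; split.
  rewrite -[m in leLHS](gexp_cst t); apply: le_gexp => // [|x]; [exact: gint_cst|by case/andP: (fb x)].
rewrite -[M in leRHS](gexp_cst t); apply: le_gexp => // [|x]; [exact: gint_cst|by case/andP: (fb x)].
Qed.

(* The tangent line of exp at the mean. *)
Lemma jensen_expR t f : gint t f -> gint t (fun x => expR (f x)) ->
  expR (gexp t f) <= gexp t (fun x => expR (f x)).
Proof.
move=> fi ei; set m := gexp t f.
rewrite -[leLHS]mulr1 -[X in _ * X](_ : gexp t (fun x => 1 + (f x - m)) = 1).
  rewrite -gexpZ.
    apply: le_gexp => // [|x].
      by apply/gintZ/gintD/gintB/gint_cst => //; exact: gint_cst.
    rewrite -[f x in leRHS](subrK m) [X in _ <= expR X]addrC expRD.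
    by rewrite ler_wpM2l ?expR_ge0// expR_ge1Dx.
  by apply/gintD/gintB/gint_cst => //; exact: gint_cst.
rewrite gexpD; [|exact: gint_cst|exact: gintB fi (gint_cst _ _)].
by rewrite gexpB//; [rewrite !gexp_cst subrr addr0|exact: gint_cst].
Qed.

End gauss_expectation.

(** * Moments of Gaussian laws, read off from exponential moments *)

Section gauss_moments.
Context {R : realType}.
Implicit Types (V W : euclid R) (t : R).

Lemma gauss_mgf V t (w : V) : 0 < t ->
  gint t (fun x : borel V => expR (dotp V w x)) /\
  gexp t (fun x : borel V => expR (dotp V w x)) = expR (t * dotp V w w / 2).
Proof.
move=> t0; split; last by apply: gexp_eqE; exact: integral_gauss_mgf.
apply: gint_ltoo => [|x|]; last by rewrite integral_gauss_mgf// ltry.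
  by apply: measurableT_comp => //; exact: measurable_dotp.
exact: expR_ge0.
Qed.

Lemma gexp_coisometry V W t (A : 'Hom(V, W)) (f : borel W -> R) :
  (A \o adjoint A)%VF = \1%VF -> 0 < t -> gint t f ->
  gint t (fun x : borel V => f (A x)) /\
  gexp t (fun x : borel V => f (A x)) = gexp t f.
Proof.
move=> AA t0 fi.
have mA : measurable_fun setT (fun x : borel V => A x : borel W).
  exact: (@measurable_borel_lfun _ _ _ A _ _ id).
have mf := gint_measurable fi.
have mfA := measurableT_comp mf mA.
have key (g : borel W -> R) : gint t g -> (forall y, 0 <= g y) ->
    gint t (fun x : borel V => g (A x)) /\
    gexp t (fun x : borel V => g (A x)) = gexp t g.
  move=> gi g0; have mg := gint_measurable gi.
  have h : (\int[gauss V t]_x (g (A x))%:E = (gexp t g)%:E)%E.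
    rewrite -(gexpE gi).
    by rewrite -(ge0_integral_gauss_coisometry (f := EFin \o g) AA t0)//;
      exact/measurable_EFinP.
  split; last exact: gexp_eqE.
  by apply: gint_ltoo => //; [exact: measurableT_comp mg mA|rewrite h ltry].
(* Writing f as (|f| + f) - |f| reduces to non-negative integrands. *)
have fp : gint t (fun y => `|f y| + f y) by apply: gintD => //; exact: gint_norm.
have fn := gint_norm fi.
have [i1 e1] := key _ fp (fun y => ltac:(have := ler_norm (- f y); rewrite normrN; lra)).
have [i2 e2] := key _ fn (fun y => normr_ge0 (f y)).
have E : (fun x : borel V => f (A x)) =1 (fun x => (`|f (A x)| + f (A x)) - `|f (A x)|).
  by move=> x; rewrite addrC addKr.
split; first by apply: eq_gint (gintB i1 i2) => x; rewrite -E.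
by rewrite (eq_gexp _ E) gexpB// e1 e2 gexpD// addrC addKr.
Qed.

Lemma gint_dotp_exp4 V t (w : V) : 0 < t ->
  gint t (fun x : borel V => dotp V w x ^+ 4).
Proof.
move=> t0; have [i1 _] := gauss_mgf w t0; have [i2 _] := gauss_mgf (- w) t0.
apply: gint_le (gintZ 24 (gintD i1 i2)).
  by apply: measurable_funX; exact: measurable_dotp.
move=> x; rewrite dotpNl ger0_norm ?pow4_le_cosh//.
by rewrite (_ : 4 = 2 * 2)%N// exprM sqr_ge0.
Qed.

Lemma gint_dotp_exp2 V t (w : V) : 0 < t ->
  gint t (fun x : borel V => dotp V w x ^+ 2).
Proof.
move=> t0; have [i1 _] := gauss_mgf w t0; have [i2 _] := gauss_mgf (- w) t0.
apply: gint_le (gintD i1 i2).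
  by apply: measurable_funX; exact: measurable_dotp.
move=> x; rewrite dotpNl ger0_norm ?sqr_ge0//.
by have := sqr_le_cosh (dotp V w x); lra.
Qed.

Lemma gint_dotp V t (w : V) : 0 < t -> gint t (fun x : borel V => dotp V w x).
Proof.
move=> t0; apply: gint_le (gintD (gint_cst V t 1) (gint_dotp_exp2 w t0)).
  exact: measurable_dotp.
move=> x /=; rewrite -[leRHS](_ : 1 + `|dotp V w x| ^+ 2 = _); last first.
  by rewrite real_normK ?num_real.
by have := sqr_ge0 (`|dotp V w x| - 1); have := sqr_ge0 `|dotp V w x|; nra.
Qed.

Lemma adjoint_opp V : adjoint (- \1%VF : 'End(V)) = - \1%VF.
Proof.
apply/lfunP => y; apply: dotp_ext => z.
by rewrite -adjointP !opp_lfunE !id_lfunE dotpNl dotpNr.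
Qed.

(** The map - id is a coisometry, so the mean equals its own opposite. *)
Lemma gexp_dotp V t (w : V) : 0 < t -> gexp t (fun x : borel V => dotp V w x) = 0.
Proof.
move=> t0; have wi := gint_dotp w t0.
have AA : ((- \1%VF : 'End(V)) \o adjoint (- \1%VF))%VF = \1%VF.
  rewrite adjoint_opp; apply/lfunP => y.
  by rewrite comp_lfunE !opp_lfunE !id_lfunE opprK.
have [_] := gexp_coisometry AA t0 wi.
rewrite (@eq_gexp _ _ _ _ (fun x => - dotp V w x)); last first.
  by move=> x; rewrite opp_lfunE id_lfunE dotpNr.
rewrite gexpN//; lra.
Qed.

(** Averaging 2 + l^2 r^2 <= exp(l r) + exp(- l r) gives l^2 E <= 2 (exp y - 1) with y = l^2 s / 2;
    as exp y <= 1 / (1 - y), this yields E (1 - y) <= s, and l tends to 0. *)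
Lemma gexp_dotp_exp2 V t (w : V) : 0 < t ->
  gexp t (fun x : borel V => dotp V w x ^+ 2) <= t * dotp V w w.
Proof.
move=> t0; set E := gexp _ _; set s := t * _.
have s0 : 0 <= s by rewrite mulr_ge0 ?dotp_ge0// ltW.
have h l : l ^+ 2 * s / 2 < 1 -> E * (1 - l ^+ 2 * s / 2) <= s \/ l = 0.
  move=> ls; have [->|l0] := eqVneq l 0; [by right|left].
  have [i1 e1] := gauss_mgf (l *: w) t0; have [i2 e2] := gauss_mgf (- (l *: w)) t0.
  have i3 := gintZ (l ^+ 2) (gint_dotp_exp2 w t0).
  have i0 := gint_cst V t 2.
  have /(le_gexp (gintD i0 i3) (gintD i1 i2)) : forall x : borel V,
      2 + l ^+ 2 * dotp V w x ^+ 2 <= expR (dotp V (l *: w) x) + expR (dotp V (- (l *: w)) x).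
    by move=> x; rewrite dotpNl dotpZl -exprMn sqr_le_cosh.
  rewrite (gexpD i0 i3) (gexpD i1 i2) gexp_cst gexpZ; last exact: gint_dotp_exp2.
  rewrite e1 e2 -/E dotpNl dotpNr opprK dotpZl dotpZr.
  rewrite (_ : t * _ / 2 = l ^+ 2 * s / 2); last by rewrite /s; ring.
  set y := l ^+ 2 * s / 2 in ls *.
  have y1 : expR y * (1 - y) <= 1.
    rewrite -[leRHS](expRxMexpNx_1 y) ler_wpM2l ?expR_ge0//.
    exact: expR_ge1Dx.
  move=> le1.
  have l20 : 0 < l ^+ 2 by rewrite exprn_even_gt0.
  rewrite -(ler_pM2l l20) mulrA.
  have -> : l ^+ 2 * s = 2 * y by rewrite /y; field.
  have := expR_gt0 y.
  nra.
rewrite leNgt; apply/negP => sE.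
have E0 : 0 < E by exact: le_lt_trans sE.
pose D := E - s; have D0 : 0 < D by rewrite subr_gt0.
(* An explicit l replaces the limit: K makes l <= 1, l s <= 1 and E s l <= D, so that E y <= D / 2
   contradicts E (1 - y) <= s. *)
pose K := D + E * s + s + 1.
have Es0 : 0 <= E * s by rewrite mulr_ge0// ltW.
have K0 : 0 < K by rewrite /K; lra.
pose l := D / K.
have l0 : 0 < l by rewrite divr_gt0.
have lK : l * K = D by rewrite /l divfK// gt_eqF.
have l1 : l <= 1 by rewrite ler_pdivrMr// mul1r /K; nra.
have l2 : l ^+ 2 <= l by rewrite expr2; nra.
have l20 : 0 <= l ^+ 2 by rewrite sqr_ge0.
have ls1 : l ^+ 2 * s / 2 < 1.
  have : l ^+ 2 * s <= l * s by rewrite ler_wpM2r.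
  have : l * s <= s * 1 by rewrite mulrC ler_wpM2l.
  have : l * s <= 1.
    rewrite /l mulrAC ler_pdivrMr// mul1r /K /D; nra.
  lra.
have [|l00] := h l ls1; last by rewrite l00 ltxx in l0.
have : E * s * l ^+ 2 <= E * s * l by rewrite ler_wpM2l.
have : E * s * l <= D.
  rewrite -lK mulrC ler_wpM2l ?ltW//; rewrite /K; lra.
rewrite /D; nra.
Qed.

(** At time t^2 the vectors w / t and - w / t have exponential moment exp(1/2) <= 2, and 96 = 24 *
    (2 + 2). *)
Lemma gexp_dotp_exp4 V t (w : V) : 0 < t -> dotp V w w = 1 ->
  gexp (t ^+ 2) (fun x : borel V => dotp V w x ^+ 4) <= 96 * t ^+ 4.
Proof.
move=> t0 w1; have t20 : 0 < t ^+ 2 by rewrite exprn_gt0.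
have [i1 e1] := gauss_mgf (t^-1 *: w) t20; have [i2 e2] := gauss_mgf (- (t^-1 *: w)) t20.
have tt : t != 0 by rewrite gt_eqF.
have t40 : 0 < t ^+ 4 by rewrite exprn_gt0.
have /(le_gexp (gint_dotp_exp4 w t20) (gintZ (24 * t ^+ 4) (gintD i1 i2))) :
    forall x : borel V, dotp V w x ^+ 4 <= 24 * t ^+ 4 *
      (expR (dotp V (t^-1 *: w) x) + expR (dotp V (- (t^-1 *: w)) x)).
  move=> x; rewrite dotpNl dotpZl; set b := t^-1 * _.
  have -> : dotp V w x ^+ 4 = t ^+ 4 * b ^+ 4 by rewrite -exprMn mulrA divff// mul1r.
  have -> : 24 * t ^+ 4 * (expR b + expR (- b)) = t ^+ 4 * (24 * (expR b + expR (- b))).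
    by ring.
  by apply: ler_wpM2l (pow4_le_cosh b); exact: ltW.
rewrite gexpZ; last exact: gintD.
rewrite gexpD// e1 e2 dotpNl dotpNr opprK dotpZl dotpZr w1 mulr1.
rewrite (_ : _ * (_ * _) / 2 = 1 / 2); last by field.
have : expR (1 / 2 : R) * (1 / 2) <= 1.
  rewrite -[leRHS](expRxMexpNx_1 (1 / 2)) ler_wpM2l ?expR_ge0//.
  by have := @expR_ge1Dx R (- (1 / 2)); lra.
move: (expR _) => e e2' /le_trans; apply; nra.
Qed.

Lemma sqr_sum_le n (a : 'I_n -> R) :
  (\sum_i a i) ^+ 2 <= n%:R * \sum_i a i ^+ 2.
Proof.
elim: n a => [|n IHn] a; first by rewrite !big_ord0 expr0n mulr0.
rewrite !big_ord_recl; have := IHn (fun i => a (lift ord0 i)).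
have : 0 <= \sum_(i < n) a (lift ord0 i) ^+ 2 by apply: sumr_ge0 => i _; exact: sqr_ge0.
case: n {IHn} a => [|n] a.
  by rewrite !big_ord0 !addr0 mul1r.
rewrite -[n.+2%:R]natr1; set m : R := n.+1%:R.
have m0 : 0 < m by rewrite ltr0n.
set S := \sum_i a _; set Q := \sum_i _ ^+ 2; move: (a ord0) => b Q0 SQ.
rewrite -(ler_pM2l m0); have := sqr_ge0 (m * b - S).
have : 0 <= m * (m * Q - S ^+ 2) by rewrite mulr_ge0 ?subr_ge0// ltW.
nra.
Qed.

Lemma gexp_sqnorm V t : 0 < t ->
  gint t (fun x : borel V => dotp V x x) /\
  gexp t (fun x : borel V => dotp V x x) <= (\dim {:V})%:R * t.
Proof.
move=> t0.
have E : (fun x : borel V => dotp V x x) =1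
    (fun x => \sum_i dotp V (onb V i) x ^+ 2).
  by move=> x; rewrite dotp_onb; apply: eq_bigr => i _; rewrite expr2.
have Fi i := gint_dotp_exp2 (onb V i) t0.
split; first by apply: eq_gint (gint_sum _ Fi) => x; rewrite E.
rewrite (eq_gexp _ E) gexp_sum//.
apply: le_trans (ler_sum _ (fun i _ => gexp_dotp_exp2 (onb V i) t0)) _.
under eq_bigr do rewrite onbP eqxx mulr1.
by rewrite sumr_const card_ord mulr_natl.
Qed.

Lemma gexp_sqnorm2 V t : 0 < t ->
  gint (t ^+ 2) (fun x : borel V => dotp V x x ^+ 2) /\
  gexp (t ^+ 2) (fun x : borel V => dotp V x x ^+ 2) <=
    (\dim {:V})%:R ^+ 2 * 96 * t ^+ 4.
Proof.
move=> t0; have t20 : 0 < t ^+ 2 by rewrite exprn_gt0.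
set n := (\dim {:V})%:R.
have Fi i := gint_dotp_exp4 (onb V i) t20.
have le x : dotp V x x ^+ 2 <= n * \sum_i dotp V (onb V i) x ^+ 4.
  rewrite dotp_onb; apply: le_trans (sqr_sum_le _) _.
  by rewrite ler_wpM2l// ler_sum// => i _; rewrite -expr2 -exprM.
have I := gintZ n (gint_sum (index_enum _) Fi).
have i2 : gint (t ^+ 2) (fun x : borel V => dotp V x x ^+ 2).
  apply: gint_le I => [|x]; last by rewrite ger0_norm ?sqr_ge0.
  by apply: measurable_funX; exact: measurable_dotp2.
split => //.
apply: le_trans (le_gexp i2 I le) _.
rewrite gexpZ; last exact: gint_sum.
rewrite gexp_sum// expr2 -!mulrA ler_wpM2l//.
have h i : gexp (t ^+ 2) (fun x : borel V => dotp V (onb V i) x ^+ 4) <= 96 * t ^+ 4.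
  by apply: gexp_dotp_exp4 => //; rewrite onbP eqxx.
apply: le_trans (ler_sum _ (fun i _ => h i)) _.
by rewrite sumr_const card_ord -[leLHS]mulr_natl.
Qed.

End gauss_moments.

(** * Second-order bounds for ln and exp *)

Section ln_inequalities.
Context {R : realType}.
Implicit Types p q x r : R.

Lemma ln_ge1_quadratic p : 1 <= p -> (p - 1) - (p - 1) ^+ 2 / 2 <= ln p.
Proof.
move=> p1; pose f x : R := ln x - (x - 1) + (x - 1) ^+ 2 / 2.
have df x : 0 < x -> is_derive x 1 f (x^-1 - 1 + (x - 1)).
  move=> x0; have dln := is_derive1_ln x0.
  apply: is_derive_eq; rewrite /GRing.scale/=; field; rewrite gt_eqF//.
have dfI c : c \in `]1, p[ -> is_derive c 1 f (c^-1 - 1 + (c - 1)).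
  by rewrite in_itv/= => /andP[c1 _]; apply: df; lra.
have cf : {within `[1, p], continuous f}.
  apply: derivable_within_continuous => x; rewrite in_itv/= => /andP[x1 _].
  by apply: ex_derive; apply: df; lra.
have [c] := MVT_segment p1 dfI cf; rewrite in_itv/= => /andP[c1 cp].
have c0 : 0 < c by lra.
have dc0 : 0 <= c^-1 - 1 + (c - 1).
  have -> : c^-1 - 1 + (c - 1) = (c - 1) ^+ 2 / c by field; rewrite gt_eqF//.
  by rewrite divr_ge0 ?sqr_ge0// ltW.
rewrite /f ln1 subrr expr0n/= mul0r => fE.
have : 0 <= (c^-1 - 1 + (c - 1)) * (p - 1) by rewrite mulr_ge0// subr_ge0.
rewrite -fE; lra.
Qed.

(** With x = - ln p this is x <= sinh x. *)
Lemma ln_le1_sinh p : 0 < p -> p <= 1 -> (p - p^-1) / 2 <= ln p.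
Proof.
move=> p0 p1; have x0 : 0 <= - ln p by rewrite oppr_ge0 ln_le0.
have e1 := expR_ge1Dx2 x0.
have ee : expR (- ln p) = p^-1 by rewrite expRN lnK.
move: e1; rewrite ee; set x := - ln p in x0 *; move=> e1.
have -> : ln p = - x by rewrite opprK.
suff : 2 * x <= p^-1 - p by lra.
have y0 : 0 < p^-1 by rewrite invr_gt0.
rewrite -(ler_pM2l y0) mulrBr mulVf ?gt_eqF// -expr2.
nra.
Qed.

(** A second-order expansion at 1 with a cubic error uniform on p >= k. For p < 1 the sinh bound
    differs from the quadratic part by exactly (1 - p)^3 / (2 p). *)
Lemma ln_ge_cubic p (k : R) : 0 < k -> k <= p -> k <= 1 ->
  (p - 1) - (p - 1) ^+ 2 / 2 - `|p - 1| ^+ 3 / (2 * k) <= ln p.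
Proof.
move=> k0 kp k1; have p0 : 0 < p by exact: lt_le_trans kp.
have [p1|p1] := leP 1 p.
  apply: le_trans (ln_ge1_quadratic p1).
  by rewrite gerBl divr_ge0 ?exprn_ge0// mulr_ge0// ltW.
apply: le_trans (ln_le1_sinh p0 (ltW p1)).
rewrite ltr0_norm ?subr_lt0//.
have -> : (p - p^-1) / 2 = (p - 1) - (p - 1) ^+ 2 / 2 - (- (p - 1)) ^+ 3 / (2 * p).
  by field; rewrite gt_eqF//.
rewrite lerD2l lerN2; apply: ler_wpM2l.
  by rewrite exprn_ge0// oppr_ge0 subr_le0 ltW.
by rewrite lef_pV2 ?posrE ?mulr_gt0// ler_pM2l.
Qed.

Lemma expR_sub1_sub_le r : `|expR r - 1 - r| <= r ^+ 2 * expR `|r|.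
Proof.
have e0 := expR_gt0 r.
have e1 := expR_ge1Dx r.
have e2 := expR_ge1Dx (- r).
have ee : expR r * expR (- r) = 1 by rewrite expRxMexpNx_1.
rewrite ger0_norm; last by lra.
have h : expR r - 1 <= r * expR r by nra.
have [r0|r0] := leP 0 r.
  by rewrite ger0_norm//; nra.
rewrite ltr0_norm//.
have : 1 <= expR (- r) by lra.
nra.
Qed.

End ln_inequalities.

Section heat.
Context {R : realType}.
Implicit Types (V W : euclid R) (t : R).

Lemma dotp_cauchy V (x y : V) : dotp V x y ^+ 2 <= dotp V x x * dotp V y y.
Proof.
have [->|y0] := eqVneq y 0; first by rewrite !dotp0r expr0n mulr0.
have yy := dotp_gt0 y0.
have := dotp_ge0 (dotp V y y *: x - dotp V x y *: y).
rewrite dotp_sqrB !(dotpZl, dotpZr).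
rewrite -(ler_pM2l yy); nra.
Qed.

Definition bmeas V (f : borel V -> R) : Prop :=
  measurable_fun setT f /\ exists M, forall x, `|f x| <= M.

Lemma bmeas_gint V t (f : borel V -> R) : bmeas f -> gint t f.
Proof. by case=> mf [M fM]; exact: gint_bounded fM. Qed.

Lemma bmeas_itv V (m M : R) (f : borel V -> R) :
  measurable_fun setT f -> (forall x, m <= f x <= M) -> bmeas f.
Proof.
move=> mf fb; split => //; exists (`|m| + `|M|) => x.
have /andP[f1 f2] := fb x; rewrite ler_norml; apply/andP; split.
  have := ler_norm (- m); rewrite normrN; have := normr_ge0 M; lra.
have := ler_norm M; have := normr_ge0 m; lra.
Qed.

Lemma bmeas_cst V (c : R) : bmeas (cst c : borel V -> R).
Proof. by split; [exact: measurable_cst|exists `|c|]. Qed.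

Lemma bmeas_translate V (f : borel V -> R) (x : V) :
  bmeas f -> bmeas (fun y : borel V => f (x + (y : V))).
Proof.
move=> [mf [M fM]]; split; last by exists M => y; exact: fM.
rewrite (_ : (fun _ => _) = f \o (fun y : borel V => ((y : V) + x : borel V))).
  exact: measurableT_comp mf (measurable_translate x).
by apply/funext => y; rewrite /= addrC.
Qed.

Lemma measurable_gexp d (T : measurableType d) V t (G : T * borel V -> R) :
  measurable_fun setT G -> (forall x, gint t (fun y => G (x, y))) ->
  measurable_fun setT (fun x => gexp t (fun y => G (x, y))).
Proof.
move=> mG Gi.
have key (H : T * borel V -> R) : measurable_fun setT H -> (forall z, 0 <= H z) ->
    measurable_fun setT (fun x => gexp t (fun y => H (x, y))).
  move=> mH H0; apply: measurableT_comp => //.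
  have := @measurable_fun_fubini_tonelli_F _ _ _ _ _ (gauss V t) (EFin \o H).
  by apply => //; exact/measurable_EFinP.
have mn : measurable_fun setT (fun z => `|G z|) by exact: measurableT_comp.
have np z : 0 <= `|G z| + G z by have := ler_norm (- G z); rewrite normrN; lra.
have m1 := key (fun z => `|G z| + G z) (measurable_funD mn mG) np.
have m2 := key (fun z => `|G z|) mn (fun z => normr_ge0 _).
rewrite (_ : (fun x => _) = (fun x => gexp t (fun y => `|G (x, y)| + G (x, y)) -
  gexp t (fun y => `|G (x, y)|))); first exact: measurable_funB.
apply/funext => x; have i1 := gint_norm (Gi x).
by rewrite gexpD// addrC addKr.
Qed.

Definition heat V t (f : borel V -> R) (x : borel V) : R :=
  gexp t (fun y => f ((x : V) + (y : V))).

Lemma measurable_heat V t (f : borel V -> R) : bmeas f -> measurable_fun setT (heat t f).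
Proof.
move=> fb; have [mf _] := fb.
apply: (@measurable_gexp _ (borel V) V t (fun z => f ((z.1 : V) + (z.2 : V)))).
  by apply: measurableT_comp mf _; exact: measurable_borelD.
by move=> x; exact/bmeas_gint/bmeas_translate.
Qed.

Lemma heat_itv V t (m M : R) (f : borel V -> R) :
  measurable_fun setT f -> (forall x, m <= f x <= M) ->
  forall x, m <= heat t f x <= M.
Proof.
move=> mf fb x; apply: gexp_bounds => [|y]; last exact: fb.
by apply/bmeas_gint/bmeas_translate; exact: bmeas_itv fb.
Qed.

Lemma bmeas_heat V t (f : borel V -> R) : bmeas f -> bmeas (heat t f).
Proof.
move=> fb; split; first exact: measurable_heat.
have [mf [M fM]] := fb; exists M => x.
by rewrite ler_norml; apply: heat_itv => // y; rewrite -ler_norml.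
Qed.

(* Cameron-Martin. *)
Lemma gexp_translate V t (w : V) (f : borel V -> R) : 0 < t -> bmeas f ->
  gint t (fun y => f y * expR (dotp V w y / t - dotp V w w / (2 * t))) /\
  gexp t (fun y => f ((y : V) + w)) =
  gexp t (fun y => f y * expR (dotp V w y / t - dotp V w w / (2 * t))).
Proof.
move=> t0 fb; have [mf [M fM]] := fb.
pose e (y : borel V) := expR (dotp V w y / t - dotp V w w / (2 * t)).
rewrite -[gint _ _]/(gint t (fun y => f y * e y)).
rewrite -[X in _ = X]/(gexp t (fun y => f y * e y)).
have M0 : 0 <= M := le_trans (normr_ge0 _) (fM 0).
have me : measurable_fun setT e.
  apply: measurableT_comp => //; apply: measurable_funB => //.
  by apply: measurable_funM => //; exact: measurable_dotp.
have e0 y : 0 <= e y by exact: expR_ge0.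
have he : (\int[gauss V t]_y (e y)%:E = 1)%E.
  have := @ge0_integral_gauss_translate _ V t w (cst 1%E) t0 (measurable_cst _) (fun=> lee01).
  rewrite integral_gauss_cst => ->.
  by apply: eq_integral => y _; rewrite mul1e.
have ei : gint t e by apply: gint_ltoo => //; rewrite he ltry.
have e1 : gexp t e = 1 by exact: gexp_eqE.
have mfe : measurable_fun setT (fun y => f y * e y) by exact: measurable_funM.
have fei : gint t (fun y => f y * e y).
  apply: gint_le (gintZ M ei) => // y.
  by rewrite normrM (ger0_norm (e0 y)) ler_wpM2r.
split => //.
have fM0 y : 0 <= f y + M by have := fM y; rewrite ler_norml; lra.
have h : (\int[gauss V t]_y (f ((y : V) + w)%R + M)%:E =
    \int[gauss V t]_y (f y * e y + M * e y)%:E)%E.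
  have := @ge0_integral_gauss_translate _ V t w (fun y => (f y + M)%:E) t0.
  move=> -> //; last by apply/measurable_EFinP; exact: measurable_funD.
  by apply: eq_integral => y _; rewrite -EFinM mulrDl.
have fwi : gint t (fun y : borel V => f ((y : V) + w)).
  apply: eq_gint (bmeas_gint _ (bmeas_translate w fb)) => y; by rewrite addrC.
have Mi := gint_cst V t M; have Mei := gintZ M ei.
have := congr1 fine h; rewrite -/(Rintegral _ _ _) -/(Rintegral _ _ _).
rewrite -/(gexp t _) -/(gexp t _) (gexpD fwi Mi) (gexpD fei Mei).
by rewrite gexp_cst gexpZ// e1 mulr1 => /addIr.
Qed.

Lemma gexpE_addr V t (f : borel V -> R) (c : R) : gint t f ->
  (\int[gauss V t]_x (f x + c)%:E = (gexp t f + c)%:E)%E.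
Proof.
move=> fi; have ci := gint_cst V t c.
by rewrite -[X in (_ + X)%:E](gexp_cst V t) -(gexpD fi ci) -(gexpE (gintD fi ci)).
Qed.

Lemma heat_heat V (s t : R) (f : borel V -> R) x : 0 < s -> 0 < t -> bmeas f ->
  heat s (heat t f) x = heat (s + t) f x.
Proof.
move=> s0 t0 fb; have [mf [M fM]] := fb.
pose g (u : borel V) := f ((x : V) + (u : V)) + M.
have fM0 y : 0 <= f y + M by have := fM y; rewrite ler_norml; lra.
have fxb := bmeas_translate x fb.
have fxi r := bmeas_gint r fxb.
have mg : measurable_fun setT g by case: fxb => mfx _; exact: measurable_funD.
have mgE : measurable_fun setT (EFin \o g) by exact/measurable_EFinP.
have h := ge0_integral_gauss_add s0 t0 mgE (fun u => fM0 _ : (0 <= (EFin \o g) u)%E).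
have hr : (\int[gauss V (s + t)]_y (EFin \o g) y = (heat (s + t) f x + M)%:E)%E.
  exact: gexpE_addr (fxi (s + t)).
have hi (y : borel V) : (\int[gauss V t]_z (g ((y : V) + z)%R)%:E =
    (heat t f ((x : V) + y)%R + M)%:E)%E.
  have yi : gint t (fun z : borel V => f (((x : V) + y)%R + (z : V))).
    exact/bmeas_gint/bmeas_translate.
  rewrite -(gexpE_addr M yi).
  by apply: eq_integral => z _; rewrite /g addrA.
have hb := bmeas_translate x (bmeas_heat t fb).
have hl : (\int[gauss V s]_y \int[gauss V t]_z (EFin \o g) ((y : V) + z)%R =
    (heat s (heat t f) x + M)%:E)%E.
  rewrite -(gexpE_addr M (bmeas_gint s hb)).
  by apply: eq_integral => y _; exact: hi.
have := EFin_inj (etrans (esym hl) (etrans h hr)).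
exact: addIr.
Qed.

End heat.

(** * Gradient bounds and their stability under the heat semigroup *)

Section regular.
Context {R : realType}.
Implicit Types (V : euclid R) (t : R).

(* [A] is the gradient of [F]; only these finite-difference consequences of
   [F] being C^{1,1} are ever used. *)
Definition regular V (m M L K : R) (F : borel V -> R) : Prop :=
  [/\ measurable_fun setT F, (forall x, m <= F x <= M) &
   exists A : V -> V,
   [/\ forall v, measurable_fun setT (fun x : borel V => dotp V (A x) v),
       forall x, dotp V (A x) (A x) <= L &
       forall x h : V, `|F (x + h) - F x - dotp V (A x) h| <= K * dotp V h h]].

Lemma riesz V (phi : V -> R) : (forall x y, phi (x + y) = phi x + phi y) ->
  (forall a x, phi (a *: x) = a * phi x) -> exists a, forall v, dotp V a v = phi v.
Proof.
move=> phiD phiZ; exists (\sum_i phi (onb V i) *: onb V i) => v.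
rewrite [in RHS](onb_expand v).
have -> : phi (\sum_i dotp V v (onb V i) *: onb V i) =
    \sum_i phi (dotp V v (onb V i) *: onb V i).
  apply: (big_morph phi) => //.
  by rewrite -(scale0r (0 : V)) phiZ mul0r.
rewrite dotp_suml; apply: eq_bigr => i _.
by rewrite phiZ dotpZl (dotpC v) mulrC.
Qed.

Lemma dotp_le_sqr V (x y : V) : `|dotp V x y| <= (dotp V x x + dotp V y y) / 2.
Proof.
rewrite ler_norml; apply/andP; split.
  have := dotp_ge0 (x + y); rewrite dotp_sqrD; lra.
have := dotp_ge0 (x - y); rewrite dotp_sqrB; lra.
Qed.

(** The average of F has the averaged gradient, and all the bounds are convex conditions, so they
    survive with the same constants. This keeps the error constant the same along the whole flow. *)
Lemma regular_heat V t m M L K (F : borel V -> R) :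
  regular m M L K F -> regular m M L K (heat t F).
Proof.
move=> [mF Fb [A [mA AL AK]]].
have bF := bmeas_itv mF Fb.
split; [exact: measurable_heat|exact: heat_itv|].
have bA v : bmeas (fun x : borel V => dotp V (A x) v).
  split => //; exists ((L + dotp V v v) / 2) => x.
  by apply: le_trans (dotp_le_sqr _ _) _; have := AL x; lra.
have iA x v := bmeas_gint t (bmeas_translate x (bA v)).
have [B BE] : exists B : V -> V, forall (x v : V),
    dotp V (B x) v = heat t (fun x : borel V => dotp V (A x) v) x.
  suff /choice[B BE] : forall x : V, exists b : V, forall v : V,
      dotp V b v = heat t (fun x : borel V => dotp V (A x) v) x by exists B.
  move=> x; apply: riesz => [v w|a v].
    by rewrite /heat -gexpD//; apply: eq_gexp => y; rewrite dotpDr.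
  by rewrite /heat -gexpZ//; apply: eq_gexp => y; rewrite dotpZr.
exists B; split => [v|x|x h].
- under eq_fun do rewrite BE; exact: measurable_heat.
(* |B x|^2 is the average of <A (x + y), B x>, whose integrand is at most (L + |B x|^2) / 2. *)
- have : dotp V (B x) (B x) <= (L + dotp V (B x) (B x)) / 2.
    rewrite [leLHS]BE -[leRHS](gexp_cst V t); apply: le_gexp => // [|y].
      exact: gint_cst.
    apply: le_trans (ler_norm _) _; apply: le_trans (dotp_le_sqr _ _) _ => /=.
    by have := AL (x + y); lra.
  lra.
- have i1 := bmeas_gint t (bmeas_translate (x + h) bF).
  have i2 := bmeas_gint t (bmeas_translate x bF).
  have i3 := iA x h.
  have i4 := gintB (gintB i1 i2) i3.
  rewrite BE /heat -(gexpB i1 i2) -gexpB//; last exact: gintB.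
  apply: le_trans (gexp_norm i4) _.
  rewrite -[leRHS](gexp_cst V t); apply: le_gexp => // [||y].
  + exact: gint_norm.
  + exact: gint_cst.
  + by rewrite [x + h + _]addrAC; exact: AK.
Qed.

Lemma regular_iter_heat V t m M L K n (F : borel V -> R) :
  regular m M L K F -> regular m M L K (iter n (heat t) F).
Proof. by move=> rF; elim: n => [|n IHn] //=; exact: regular_heat. Qed.

(** Gaussian integration by parts puts the derivative on the density: the gradient at x is
    E[phi(x + Y) Y] / s, which makes sense for bounded measurable phi. *)
Lemma heat_gradient V s B (phi : borel V -> R) : 0 < s -> 0 <= B ->
  measurable_fun setT phi -> (forall x, `|phi x| <= B) ->
  exists a : V -> V,
  [/\ forall v, measurable_fun setT (fun x : borel V => dotp V (a x) v),
      forall x, dotp V (a x) (a x) <= 2 * B ^+ 2 / s &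
      forall x h : V, `|heat s phi (x + h) - heat s phi x - dotp V (a x) h| <=
        B / s * dotp V h h].
Proof.
move=> s0 B0 mphi phiB.
have bphi : bmeas phi by split => //; exists B.
have sn0 : s != 0 by rewrite gt_eqF.
pose G v (x y : borel V) := phi ((x : V) + y) * (dotp V v y / s).
have mG v : measurable_fun setT (fun z : borel V * borel V => G v z.1 z.2).
  apply: measurable_funM.
    by apply: measurableT_comp mphi _; exact: measurable_borelD.
  by apply: measurable_funM => //; exact: measurableT_comp (measurable_dotp v) _.
have iT v : gint s (fun y : borel V => dotp V v y / s).
  by apply: eq_gint (gintZ s^-1 (gint_dotp v s0)) => y; rewrite mulrC.
have iG v x : gint s (G v x).
  apply: gint_le (gintZ B (gint_norm (iT v))) => [|y].
    exact: measurableT_comp (mG v) (measurable_pair1 x).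
  by rewrite normrM ler_wpM2r.
have [a aE] : exists a : V -> V, forall (x v : V), dotp V (a x) v = gexp s (G v x).
  suff /choice[a aE] : forall x : V, exists a : V, forall v : V,
      dotp V a v = gexp s (G v x) by exists a.
  move=> x; apply: riesz => [v w|c v].
    rewrite -gexpD//; apply: eq_gexp => y; rewrite /G dotpDl; ring.
  by rewrite -gexpZ//; apply: eq_gexp => y; rewrite /G dotpZl; ring.
exists a; split => [v|x|x h].
- under eq_fun do rewrite aE.
  exact: (measurable_gexp (mG v) (iG v)).
- set u := a x.
  have i2 := gintZ (4 * s)^-1 (gint_dotp_exp2 u s0).
  have i1 := gint_cst V s (B ^+ 2 / s).
  (* From B |<u, Y>| / s <= B^2 / s + <u, Y>^2 / (4 s), whose last term has mean at most |u|^2 /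
     4. *)
  have : dotp V u u <= B ^+ 2 / s + (4 * s)^-1 * (s * dotp V u u).
    have si0 : 0 <= s^-1 by rewrite invr_ge0 ltW.
    rewrite [leLHS]aE; apply: (@le_trans _ _ (gexp s (fun y => cst (B ^+ 2 / s) y +
        (4 * s)^-1 * dotp V u y ^+ 2))).
      apply: le_gexp => // [|y]; first exact: gintD.
      rewrite -/u /G /=; apply: le_trans (ler_norm _) _; rewrite normrM.
      apply: le_trans (ler_wpM2r (normr_ge0 _) (phiB _)) _.
      rewrite normrM (ger0_norm si0).
      rewrite -[dotp V u y ^+ 2]real_normK ?num_real//; set z := `|_|.
      have s4 : 0 < 4 * s by rewrite mulr_gt0.
      rewrite -(ler_pM2r s4).
      have -> : (B ^+ 2 / s + (4 * s)^-1 * z ^+ 2) * (4 * s) = 4 * B ^+ 2 + z ^+ 2 by field.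
      have -> : B * (z / s) * (4 * s) = 4 * B * z by field.
      by have := sqr_ge0 (2 * B - z); nra.
    rewrite (gexpD i1 i2) gexp_cst gexpZ; last exact: gint_dotp_exp2.
    rewrite lerD2l; apply: ler_wpM2l; last exact: gexp_dotp_exp2.
    by rewrite invr_ge0 ltW// mulr_gt0.
  have -> : (4 * s)^-1 * (s * dotp V u u) = dotp V u u / 4 by field.
  have : 0 <= B ^+ 2 / s by rewrite divr_ge0 ?sqr_ge0// ltW.
  rewrite -mulrA; lra.
(* Cameron-Martin moves h into the density exp xi, so the remainder is the mean of phi (exp xi - 1 -
   xi - c0). Since exp xi - 1 - xi >= 0, it is at most B times the mean of exp xi - 1 - xi + c0,
   which is 2 c0 = |h|^2 / s. *)
- pose xi (y : borel V) := dotp V h y / s - dotp V h h / (2 * s).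
  have bx := bmeas_translate x bphi.
  have [i1 e1] := gexp_translate h s0 bx.
  rewrite -/(gint s (fun y => phi (x + y) * expR (xi y))) in i1.
  have i2 := bmeas_gint s bx.
  have [i3 e3] := gexp_translate h s0 (bmeas_cst V 1).
  rewrite -/(gint s (fun y => 1 * expR (xi y))) in i3.
  have {}e3 : gexp s (fun y => expR (xi y)) = 1.
    rewrite -[RHS](gexp_cst V s) [RHS]e3; apply: eq_gexp => y; by rewrite mul1r.
  have {}i3 : gint s (fun y => expR (xi y)) by apply: eq_gint i3 => y; rewrite mul1r.
  set q := dotp V h h; have q0 : 0 <= q by exact: dotp_ge0.
  have ixi : gint s xi by apply: gintB; [exact: iT|exact: gint_cst].
  have exi : gexp s xi = - (q / (2 * s)).
    rewrite /xi gexpB; [|exact: iT|exact: gint_cst].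
    rewrite [X in _ - X](gexp_cst V s).
    rewrite (@eq_gexp _ _ _ _ (fun y => s^-1 * dotp V h y)); last by move=> y; rewrite mulrC.
    by rewrite gexpZ; [rewrite gexp_dotp// mulr0 sub0r|exact: gint_dotp].
  pose D y := phi (x + y) * expR (xi y) - phi (x + y) - G h x y.
  have iD : gint s D by apply: gintB; [exact: gintB|exact: iG].
  have -> : heat s phi (x + h) - heat s phi x - dotp V (a x) h = gexp s D.
    rewrite /D gexpB; [|exact: gintB|exact: iG].
    rewrite gexpB// aE; congr (_ - _ - _).
    rewrite -e1 /heat; apply: eq_gexp => y.
    by rewrite -addrA (addrC h).
  apply: le_trans (gexp_norm iD) _.
  pose c0 := q / (2 * s).
  have ib : gint s (fun y => B * (expR (xi y) - xi y + cst (c0 - 1) y)).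
    by apply/gintZ/gintD; [exact: gintB|exact: gint_cst].
  apply: (@le_trans _ _ (gexp s (fun y => B * (expR (xi y) - xi y + cst (c0 - 1) y)))).
    apply: le_gexp => // [|y]; first exact: gint_norm.
    rewrite /D /G -[X in _ - X - _]mulr1 -!mulrBr normrM ler_pM//.
    have -> : dotp V h y / s = xi y + c0 by rewrite /xi subrK.
    rewrite /=; have := expR_ge1Dx (xi y) => ex.
    have c00 : 0 <= c0 by rewrite divr_ge0// mulr_ge0// ltW.
    by rewrite ler_norml; apply/andP; split; lra.
  rewrite gexpZ; last by apply: gintD; [exact: gintB|exact: gint_cst].
  rewrite gexpD; [|exact: gintB|exact: gint_cst].
  rewrite gexpB// gexp_cst e3 exi /c0.
  by rewrite le_eqVlt; apply/orP; left; apply/eqP; field.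
Qed.

(** [L] and [K] are chosen before the space and the function, so that one pair serves all the f_i at
    once. *)
Lemma regular_expR_heat s B : 0 < s -> 0 <= B ->
  exists L K, [/\ 0 <= L, 0 <= K & forall V (phi : borel V -> R),
    measurable_fun setT phi -> (forall x, `|phi x| <= B) ->
    regular (expR (- B)) (expR B) L K (fun x => expR (heat s phi x))].
Proof.
move=> s0 B0; pose L := 2 * B ^+ 2 / s; pose K := B / s.
have K0 : 0 <= K by rewrite divr_ge0// ltW.
have L0 : 0 <= L by rewrite divr_ge0 ?mulr_ge0 ?sqr_ge0// ltW.
have LE : 0 <= 2 * L + 2 * K ^+ 2 + 4 * B ^+ 2.
  by rewrite !addr_ge0// mulr_ge0// sqr_ge0.
exists (expR B ^+ 2 * L), (expR B * (expR (2 * B) * (2 * L + 2 * K ^+ 2 + 4 * B ^+ 2) + K)).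
split; first by rewrite mulr_ge0// sqr_ge0.
  by rewrite mulr_ge0 ?expR_ge0// addr_ge0// mulr_ge0// expR_ge0.
move=> V phi mphi phiB.
have [a [ma aL aK]] := heat_gradient s0 B0 mphi phiB.
rewrite -/L in aL; rewrite -/K in aK.
have bphi : bmeas phi by split => //; exists B.
set w := heat s phi in aK *.
have wB x : - B <= w x <= B by apply: heat_itv => // y; rewrite -ler_norml.
have mw : measurable_fun setT w by exact: measurable_heat.
clearbody w L K.
split; first exact: measurableT_comp.
  by move=> x; rewrite !ler_expR.
exists (fun x => expR (w x) *: a x); split => [v|x|x h].
- under eq_fun do rewrite dotpZl; apply: measurable_funM => //; exact: measurableT_comp.
- rewrite dotpZl dotpZr mulrA -expr2; apply: ler_pM => //; rewrite ?sqr_ge0 ?dotp_ge0//.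
  by rewrite lerXn2r ?nnegrE ?expR_ge0// ler_expR; case/andP: (wB x).
set r := w (x + h) - w x; set q := dotp V h h.
have q0 : 0 <= q by exact: dotp_ge0.
have rb : `|r| <= 2 * B.
  by rewrite /r ler_norml; have := wB x; have := wB (x + h); lra.
have rK : `|r - dotp V (a x) h| <= K * q by exact: aK.
(* A quadratic bound for all h: the gradient estimate serves for |h| <= 1, the bound |r| <= 2 B for
   |h| > 1. *)
have r2 : r ^+ 2 <= (2 * L + 2 * K ^+ 2 + 4 * B ^+ 2) * q.
  have LK : 0 <= 2 * L * q by rewrite !mulr_ge0.
  have KK : 0 <= K ^+ 2 by exact: sqr_ge0.
  have BB : 0 <= 4 * B ^+ 2 by have := sqr_ge0 B; lra.
  have [q1|q1] := leP q 1.
    have ah : dotp V (a x) h ^+ 2 <= L * q.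
      by apply: le_trans (dotp_cauchy _ _) _; rewrite ler_wpM2r.
    have rho : (r - dotp V (a x) h) ^+ 2 <= K ^+ 2 * q.
      rewrite -real_normK ?num_real//.
      apply: (@le_trans _ _ ((K * q) ^+ 2)); first by rewrite lerXn2r ?nnegrE ?mulr_ge0.
      rewrite exprMn ler_wpM2l// expr2; nra.
    have := sqr_ge0 (r - 2 * dotp V (a x) h).
    have : 0 <= 4 * B ^+ 2 * q by rewrite mulr_ge0.
    nra.
  have : r ^+ 2 <= 4 * B ^+ 2.
    have -> : 4 * B ^+ 2 = (2 * B) ^+ 2 by ring.
    by rewrite -real_normK ?num_real// lerXn2r ?nnegrE// mulr_ge0.
  nra.
have e0 := expR_ge0 (w x).
have -> : expR (w (x + h)) - expR (w x) - dotp V (expR (w x) *: a x) h =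
    expR (w x) * ((expR r - 1 - r) + (r - dotp V (a x) h)).
  rewrite dotpZl -[w (x + h)](subrK (w x)) -/r expRD; ring.
rewrite normrM (ger0_norm e0) -mulrA; apply: ler_pM => //.
  by rewrite ler_expR; case/andP: (wB x).
apply: le_trans (ler_normD _ _) _; rewrite mulrDl; apply: lerD => //.
apply: le_trans (expR_sub1_sub_le r) _.
rewrite mulrC -mulrA; apply: ler_pM => //; rewrite ?expR_ge0 ?sqr_ge0//.
by rewrite ler_expR.
Qed.

End regular.

(** * One step of the heat flow *)

Section one_step.
Context {R : realType}.
Implicit Types (V : euclid R) (t : R).

Lemma measurable_ln_comp V (F : borel V -> R) :
  measurable_fun setT F -> measurable_fun setT (fun x => ln (F x)).
Proof. by move=> mF; apply: measurableT_comp mF. Qed.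

Lemma bmeas_ln V (m M : R) (F : borel V -> R) : 0 < m ->
  measurable_fun setT F -> (forall x, m <= F x <= M) -> bmeas (fun x => ln (F x)).
Proof.
move=> m0 mF Fb; apply: (@bmeas_itv _ _ (ln m) (ln M)).
  exact: measurable_ln_comp.
move=> x; have /andP[f1 f2] := Fb x.
have F0 : 0 < F x by exact: lt_le_trans f1.
by rewrite !ler_ln ?posrE ?f1 ?f2// (lt_le_trans F0).
Qed.

(* Gibbs' variational lower bound for the shifted Gaussian. *)
Lemma ln_heat_ge V t m M (G : borel V -> R) (x v : V) : 0 < t -> 0 < m ->
  measurable_fun setT G -> (forall x, m <= G x <= M) ->
  gexp t (fun y : borel V => ln (G (x + y + t *: v))) - t * dotp V v v / 2
  <= ln (heat t G x).
Proof.
move=> t0 m0 mG Gb; set w := t *: v.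
have G0 y : 0 < G y by have /andP[+ _] := Gb y; exact: lt_le_trans.
have bG := bmeas_itv mG Gb.
pose H (y : borel V) := G (x + w + y).
have bH : bmeas H by exact: bmeas_translate.
(* The shift - w undoes the drift built into [H], at the price of the density exp xi. Jensen is then
   applied to ln H + xi, where xi has mean - t |v|^2 / 2. *)
have [] := gexp_translate (- w) t0 bH.
pose xi (y : borel V) := - dotp V v y - t * dotp V v v / 2.
have xiE y : dotp V (- w) y / t - dotp V (- w) (- w) / (2 * t) = xi y.
  rewrite /xi /w dotpNr !dotpNl opprK !dotpZl !dotpZr; field.
  by rewrite gt_eqF.
have HE (y : borel V) : H y * expR (dotp V (- w) y / t - dotp V (- w) (- w) / (2 * t)) =
    expR (ln (H y) + xi y).
  by rewrite xiE expRD lnK ?posrE ?G0.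
move=> /(eq_gint HE) i1; rewrite (eq_gexp _ HE).
have -> : gexp t (fun y : borel V => H (y - w)) = heat t G x.
  by apply: eq_gexp => y; rewrite /H; congr (G _); rewrite addrA (addrAC x) addrK.
move=> hE.
have iv := gint_dotp v t0; have ic := gint_cst V t (t * dotp V v v / 2).
have ilnH : gint t (fun y => ln (H y)).
  apply/bmeas_gint; apply: bmeas_ln m0 _ _; first by case: bH.
  by move=> y; exact: Gb.
have ixi : gint t xi by apply: gintB ic; exact: gintN.
have := jensen_expR (gintD ilnH ixi) i1.
rewrite -hE (gexpD ilnH ixi) (gexpB (gintN iv) ic) (gexpN iv) (gexp_dotp v t0) oppr0 sub0r.
rewrite gexp_cst => h.
have h0 : 0 < heat t G x.
  by have /andP[+ _] := heat_itv t mG Gb x; exact: lt_le_trans.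
rewrite -ler_expR (lnK (h0 : heat t G x \is Num.pos)); apply: le_trans h.
rewrite ler_expR lerD2r le_eqVlt; apply/orP; left; apply/eqP.
by apply: eq_gexp => y; rewrite /H -!addrA (addrC w).
Qed.

Ltac nonneg := repeat first
  [by [] | exact: sqr_ge0 | apply: addr_ge0 | apply: mulr_ge0 | rewrite invr_ge0
  | by apply: ltW].

Lemma regular_ln_pointwise V (m M L K : R) :
  0 < m -> m <= M -> 0 <= L -> 0 <= K ->
  exists2 C : R, 0 <= C & forall (F : borel V -> R) (A : V -> V),
  (forall x, m <= F x <= M) ->
  (forall x, dotp V (A x) (A x) <= L) ->
  (forall x h : V, `|F (x + h) - F x - dotp V (A x) h| <= K * dotp V h h) ->
  forall (x y u : V) (t : R), 0 < t -> t <= 1 -> A x = F x *: u ->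
  ln (F x) + (F (x + y) - F x) / F x + t ^+ 2 * dotp V u u - dotp V u y ^+ 2 / 2
  - C * (t ^+ 3 + t * dotp V y y + dotp V y y ^+ 2 / t)
  <= ln (F (x + y + t ^+ 2 *: u)).
Proof.
move=> m0 mM L0 K0.
have M0 : 0 < M by exact: lt_le_trans mM.
pose U0 := L / m ^+ 2; pose a := K / m.
have U00 : 0 <= U0 by nonneg.
have a0 : 0 <= a by rewrite divr_ge0// ltW.
(* With h = y + t^2 u, s = t^2 + |y|^2 and q the relative increment of F over h, the constants are
   made for |h|^2 <= c1 s, |q - <u, y>| <= c2 s, q^2 <= c3 |h|^2, q^2 <= c4 s and 1 + q >= k. *)
pose c1 := 2 * (1 + U0).
have c10 : 0 <= c1 by rewrite mulr_ge0// addr_ge0.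
pose c2 := U0 + a * c1.
have c20 : 0 <= c2 by rewrite addr_ge0// mulr_ge0.
pose c3 := 2 * U0 + 2 * a ^+ 2 + (2 * M / m) ^+ 2.
have c30 : 0 <= c3 by nonneg.
pose c4 := c3 * c1.
have c40 : 0 <= c4 by rewrite mulr_ge0.
pose k := m / M.
have k0 : 0 < k by rewrite divr_gt0.
have k1 : k <= 1 by rewrite ler_pdivrMr// mul1r.
pose C1 := (2 * k)^-1.
have C10 : 0 <= C1 by rewrite invr_ge0 mulr_ge0// ltW.
exists (a * (4 * U0 + 3) + (U0 + 4 * c2 ^+ 2) / 2 + C1 * (c4 / 2 + c4 ^+ 2)).
  by nonneg.
move=> F A Fb AL AK x y u t t0 t1 AE.
have /andP[F0m F0M] := Fb x.
have F00 : 0 < F x by exact: lt_le_trans F0m.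
set U := dotp V u u; set N := dotp V y y.
have U_ge0 : 0 <= U by exact: dotp_ge0.
have N_ge0 : 0 <= N by exact: dotp_ge0.
have UU0 : U <= U0.
  rewrite /U0 ler_pdivlMr ?exprn_gt0//.
  apply: le_trans (AL x); rewrite AE dotpZl dotpZr mulrA -/U mulrC -expr2.
  by rewrite ler_wpM2r// lerXn2r// nnegrE ltW.
set h := y + t ^+ 2 *: u.
have xh : x + y + t ^+ 2 *: u = x + h by rewrite addrA.
rewrite xh.
pose q := (F (x + h) - F x) / F x.
set s := t ^+ 2 + N.
pose W := t ^+ 3 + t * N + N ^+ 2 / t.
have t30 : 0 < t ^+ 3 by rewrite exprn_gt0.
have t20 : 0 < t ^+ 2 by rewrite exprn_gt0.
have Nt0 : 0 <= N ^+ 2 / t by rewrite divr_ge0 ?sqr_ge0// ltW.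
have tN0 : 0 <= t * N by rewrite mulr_ge0// ltW.
have s0 : 0 < s by rewrite ltr_wpDr.
have tsE : t * s = t ^+ 3 + t * N by rewrite /s mulrDr -exprS.
have tsW : t * s <= W by rewrite tsE /W lerDl.
have ssW : s ^+ 2 / t <= 2 * W.
  have tn0 : t != 0 by rewrite gt_eqF.
  have -> : s ^+ 2 / t = t ^+ 3 + 2 * (t * N) + N ^+ 2 / t by rewrite /s; field.
  rewrite /W; lra.
have hs : dotp V h h <= c1 * s.
  have : dotp V h h <= 2 * N + 2 * (t ^+ 4 * U).
    rewrite /h dotp_sqrD !(dotpZr, dotpZl) -/U -/N.
    have := dotp_ge0 (y - t ^+ 2 *: u).
    rewrite dotp_sqrB !(dotpZr, dotpZl) -/U -/N.
    have -> : t ^+ 4 * U = t ^+ 2 * (t ^+ 2 * U) by ring.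
    lra.
  have : t ^+ 4 * U <= t ^+ 2 * U0.
    rewrite (exprD t 2 2) -mulrA; apply: ler_wpM2l; first exact: ltW.
    rewrite -[U0]mul1r; apply: ler_pM => //; first exact: ltW.
    by rewrite expr_le1// ltW.
  have : 0 <= N * U0 by rewrite mulr_ge0.
  rewrite /c1 /s; nra.
have hh0 : 0 <= dotp V h h by exact: dotp_ge0.
pose rho := q - dotp V u h.
have rhoE : q = dotp V u y + (t ^+ 2 * U + rho).
  by rewrite /rho /h dotpDr dotpZr -/U; ring.
have rhob : `|rho| <= a * dotp V h h.
  have -> : rho = (F (x + h) - F x - dotp V (A x) h) / F x.
    by rewrite /rho /q AE dotpZl; field; rewrite gt_eqF.
  rewrite normrM (ger0_norm (_ : 0 <= (F x)^-1)) ?invr_ge0 ?(ltW F00)//.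
  rewrite ler_pdivrMr//; apply: le_trans (AK x h) _.
  rewrite /a mulrAC; apply: ler_wpM2r => //.
  rewrite -mulrA ler_peMr//.
  by rewrite mulrC ler_pdivlMr// mul1r.
have Kdiv Z : 0 <= Z -> K / F x * Z <= a * Z.
  move=> Z0; apply: ler_wpM2r => //; apply: ler_wpM2l => //.
  by rewrite lef_pV2 ?posrE.
(* The gradient at x + y has to be compared with the one at x. Differences of F over a step t u
   ([e2], [e3], [e4]) do so up to O(|y|^2 + t^2 |u|^2) / t; [e1] then takes the actual step t^2
   u. *)
have q1 : (F (x + y) - F x) / F x + t ^+ 2 * U - a * (4 * U0 + 3) * W <= q.
  have := AK (x + y) (t ^+ 2 *: u); rewrite xh ler_norml => /andP[e1 _].
  have := AK (x + y) (t *: u); rewrite ler_norml => /andP[_ e2].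
  have := AK x (y + t *: u); rewrite addrA ler_norml => /andP[e3 _].
  have := AK x y; rewrite ler_norml => /andP[_ e4].
  have e5 := dotp_ge0 (y - t *: u).
  move: e1 e2 e3 e4 e5.
  rewrite AE dotp_sqrD dotp_sqrB !(dotpZr, dotpZl) !dotpDr !(dotpZr, dotpZl) -/U -/N.
  set T1 := dotp V (A (x + y)) u; set a1 := F (x + y + t *: u).
  set P := dotp V u y; set P' := dotp V y u => e1 e2 e3 e4 e5.
  pose Z := 3 * (t * N) + 3 * (t ^+ 3 * U) + t ^+ 4 * U.
  have Z0 : 0 <= Z by rewrite /Z; nonneg.
  have T1b : t * (F x * U) - K * (3 * N + 3 * (t ^+ 2 * U)) <= t * T1.
    have : K * (2 * (t * P')) <= K * (N + t ^+ 2 * U).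
      by apply: ler_wpM2l => //; lra.
    lra.
  have E1 : t ^+ 2 * (F x * U) - K * Z <= F (x + h) - F (x + y).
    have := ler_wpM2l (ltW t0) T1b.
    rewrite /Z; lra.
  have -> : q = (F (x + y) - F x) / F x + (F (x + h) - F (x + y)) / F x.
    by rewrite /q -mulrDl; congr (_ / _); ring.
  rewrite -addrA lerD2l.
  have : (t ^+ 2 * (F x * U) - K * Z) / F x <= (F (x + h) - F (x + y)) / F x.
    by rewrite ler_pM2r// invr_gt0.
  apply: le_trans.
  have -> : (t ^+ 2 * (F x * U) - K * Z) / F x = t ^+ 2 * U - K / F x * Z.
    by field; rewrite gt_eqF.
  rewrite lerD2l lerN2; apply: le_trans (Kdiv _ Z0) _.
  rewrite -mulrA; apply: ler_wpM2l => //.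
  have : t ^+ 3 * U <= t ^+ 3 * U0 by rewrite ler_wpM2l// ltW.
  have : t ^+ 4 * U <= t ^+ 3 * U0.
    rewrite exprS -mulrA; apply: (@le_trans _ _ (1 * (t ^+ 3 * U))).
      by rewrite ler_wpM2r// mulr_ge0// ltW.
    by rewrite mul1r ler_wpM2l// ltW.
  have : 0 <= U0 * (t * N) by nonneg.
  have : 0 <= U0 * (N ^+ 2 / t) by nonneg.
  rewrite /Z /W; lra.
have W0 : 0 <= W by rewrite /W; nonneg.
have q2 : q ^+ 2 <= dotp V u y ^+ 2 + (U0 + 4 * c2 ^+ 2) * W.
  have p2 : dotp V u y ^+ 2 <= U0 * N.
    by apply: le_trans (dotp_cauchy _ _) _; exact: ler_wpM2r.
  rewrite rhoE; set p := dotp V u y in p2 *; set e := t ^+ 2 * U + rho.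
  have eb : `|e| <= c2 * s.
    apply: le_trans (ler_normD _ _) _; rewrite /c2 mulrDl; apply: lerD.
      rewrite ger0_norm; last by nonneg.
      rewrite (mulrC U0); apply: ler_pM => //.
        exact: ltW.
      by rewrite /s lerDl.
    apply: le_trans rhob _; rewrite -mulrA; exact: ler_wpM2l.
  have e2 : e ^+ 2 <= c2 ^+ 2 * s ^+ 2.
    rewrite -exprMn -real_normK ?num_real// lerXn2r// nnegrE.
    by rewrite mulr_ge0// ltW.
  have et : e ^+ 2 <= e ^+ 2 / t.
    by rewrite ler_peMr ?sqr_ge0// invf_ge1.
  have e3 : e ^+ 2 / t <= 2 * c2 ^+ 2 * W.
    apply: (@le_trans _ _ (c2 ^+ 2 * (s ^+ 2 / t))).
      by rewrite mulrA ler_pM2r// invr_gt0.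
    have -> : 2 * c2 ^+ 2 * W = c2 ^+ 2 * (2 * W) by ring.
    by apply: ler_wpM2l => //; exact: sqr_ge0.
  (* Young's inequality weighted by t balances p, of size t, against e, of size t^2. *)
  have pe : 2 * (p * e) <= t * p ^+ 2 + e ^+ 2 / t.
    rewrite -subr_ge0.
    have -> : t * p ^+ 2 + e ^+ 2 / t - 2 * (p * e) = (t * p - e) ^+ 2 / t.
      by field; rewrite gt_eqF.
    by nonneg.
  have tp : t * p ^+ 2 <= U0 * W.
    apply: (@le_trans _ _ (t * (U0 * N))); first by apply: ler_wpM2l p2; exact: ltW.
    rewrite mulrCA; apply: ler_wpM2l => //.
    by rewrite /W; have := ltW t30; lra.
  have -> : (p + e) ^+ 2 = p ^+ 2 + 2 * (p * e) + e ^+ 2 by ring.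
  lra.
have qh : q ^+ 2 <= c3 * dotp V h h.
  have [h1|h1] := leP (dotp V h h) 1.
    have uh : dotp V u h ^+ 2 <= U0 * dotp V h h.
      by apply: le_trans (dotp_cauchy _ _) _; exact: ler_wpM2r.
    have r2 : rho ^+ 2 <= a ^+ 2 * dotp V h h.
      rewrite -real_normK ?num_real//.
      apply: (@le_trans _ _ ((a * dotp V h h) ^+ 2)).
        by rewrite lerXn2r// nnegrE mulr_ge0.
      rewrite exprMn; apply: ler_wpM2l; first exact: sqr_ge0.
      by rewrite expr2 ler_piMl.
    have -> : q = dotp V u h + rho by rewrite /rho addrC subrK.
    have := sqr_ge0 (dotp V u h - rho).
    have : 0 <= (2 * M / m) ^+ 2 * dotp V h h by nonneg.
    rewrite /c3; nra.
  have qb : `|q| <= 2 * M / m.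
    rewrite /q normrM (ger0_norm (_ : 0 <= (F x)^-1)) ?invr_ge0 ?(ltW F00)//.
    apply: ler_pM => //; first by rewrite invr_ge0 ltW.
      by have := Fb (x + h); rewrite ler_norml; lra.
    by rewrite lef_pV2 ?posrE.
  have qb2 : q ^+ 2 <= (2 * M / m) ^+ 2.
    by rewrite -real_normK ?num_real// lerXn2r// nnegrE; nonneg.
  apply: le_trans qb2 _; apply: (@le_trans _ _ ((2 * M / m) ^+ 2 * dotp V h h)).
    by rewrite ler_peMr ?sqr_ge0// ltW.
  by apply: ler_wpM2r => //; rewrite /c3 lerDr; nonneg.
have q3 : `|q| ^+ 3 <= (c4 / 2 + c4 ^+ 2) * W.
  set z := `|q|.
  have z2 : z ^+ 2 <= c4 * s.
    rewrite /z real_normK ?num_real//; apply: le_trans qh _.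
    by rewrite /c4 -mulrA; exact: ler_wpM2l.
  have z4 : z ^+ 4 / t <= c4 ^+ 2 * (2 * W).
    apply: (@le_trans _ _ (c4 ^+ 2 * (s ^+ 2 / t))); last first.
      by apply: ler_wpM2l => //; exact: sqr_ge0.
    rewrite mulrA ler_pM2r ?invr_gt0// -exprMn (exprM z 2 2) lerXn2r// nnegrE ?sqr_ge0//.
    by rewrite mulr_ge0// ltW.
  have z2t : t * z ^+ 2 <= c4 * W.
    apply: (@le_trans _ _ (t * (c4 * s))); first by apply: ler_wpM2l z2; exact: ltW.
    by rewrite mulrCA; exact: ler_wpM2l.
  have : z ^+ 3 <= (t * z ^+ 2 + z ^+ 4 / t) / 2.
    rewrite -subr_ge0.
    have -> : (t * z ^+ 2 + z ^+ 4 / t) / 2 - z ^+ 3 = z ^+ 2 * ((t - z) ^+ 2 / t) / 2.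
      by field; rewrite gt_eqF.
    by nonneg.
  lra.
have kp : k <= 1 + q.
  have -> : 1 + q = F (x + h) / F x by rewrite /q; field; rewrite gt_eqF.
  have /andP[f1 f2] := Fb (x + h).
  by apply: ler_pM => //; [exact: ltW|rewrite invr_ge0 ltW|rewrite lef_pV2 ?posrE].
have Fh0 : 0 < F (x + h) by have /andP[+ _] := Fb (x + h); exact: lt_le_trans.
have lnE : ln (F (x + h)) = ln (F x) + ln (1 + q).
  have -> : 1 + q = F (x + h) / F x by rewrite /q; field; rewrite gt_eqF.
  by rewrite ln_div ?posrE//; ring.
have := ln_ge_cubic k0 kp k1.
rewrite (_ : 1 + q - 1 = q); last by rewrite addrC addKr.
rewrite lnE [_ / (2 * k)]mulrC -/C1.
have : C1 * `|q| ^+ 3 <= C1 * ((c4 / 2 + c4 ^+ 2) * W) by exact: ler_wpM2l.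
rewrite -/W; lra.
Qed.

End one_step.

Section one_step_upper.
Context {R : realType} (V : euclid R).

(** Averaging [regular_ln_pointwise] leaves p - 1 with p = heat (t ^+ 2) F x / F x, and ln p <= p -
    1. Of the term t^2 |u|^2, at most half is lost to the variance of <u, y>. The drift u depends on
    x but not on t. *)
Lemma ln_heat_le (m M L K : R) : 0 < m -> m <= M -> 0 <= L -> 0 <= K ->
  exists2 C : R, 0 <= C & forall F : borel V -> R, regular m M L K F ->
  forall x : V, exists u : V, forall t : R, 0 < t -> t <= 1 ->
  ln (heat (t ^+ 2) F x) <=
  gexp (t ^+ 2) (fun y : borel V => ln (F (x + y + t ^+ 2 *: u)))
  - t ^+ 2 * dotp V u u / 2 + C * t ^+ 3.
Proof.
move=> m0 mM L0 K0; have [C C0 CP] := regular_ln_pointwise V m0 mM L0 K0.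
set n : R := (\dim {:V})%:R.
have n0 : 0 <= n by [].
exists (C * (1 + n + n ^+ 2 * 96)).
  by rewrite mulr_ge0// !addr_ge0// mulr_ge0// sqr_ge0.
move=> F [mF Fb [A [mA AL AK]]] x; exists ((F x)^-1 *: A x) => t t0 t1.
set u := (F x)^-1 *: A x; have t20 : 0 < t ^+ 2 by rewrite exprn_gt0.
have F0 : 0 < F x by have /andP[+ _] := Fb x; exact: lt_le_trans.
have AE : A x = F x *: u by rewrite /u scalerA divff ?gt_eqF// scale1r.
have bF := bmeas_itv mF Fb.
have h0 : 0 < heat (t ^+ 2) F x.
  by have /andP[+ _] := heat_itv (t ^+ 2) mF Fb x; exact: lt_le_trans.
have [iN EN] := gexp_sqnorm V t20; have [iN2 EN2] := gexp_sqnorm2 V t0.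
have iu := gint_dotp_exp2 u t20; have Eu := gexp_dotp_exp2 u t20.
have iF := bmeas_gint (t ^+ 2) (bmeas_translate x bF).
have iln : gint (t ^+ 2) (fun y : borel V => ln (F (x + y + t ^+ 2 *: u))).
  have bl := bmeas_ln m0 mF Fb.
  apply: eq_gint (bmeas_gint (t ^+ 2) (bmeas_translate (x + t ^+ 2 *: u) bl)) => y.
  by rewrite addrAC.
pose c0 := ln (F x) - 1 + t ^+ 2 * dotp V u u - C * t ^+ 3.
pose P (y : borel V) := (cst c0 y + (F x)^-1 * F (x + y)) -
  (2^-1 * dotp V u y ^+ 2 +
   (C * t * dotp V y y + C / t * dotp V y y ^+ 2)).
have i1 : gint (t ^+ 2) (fun y : borel V => cst c0 y + (F x)^-1 * F (x + y)).
  by apply: gintD (gint_cst _ _ _) _; exact: gintZ.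
have i3 : gint (t ^+ 2) (fun y : borel V =>
    C * t * dotp V y y + C / t * dotp V y y ^+ 2).
  by apply: gintD; exact: gintZ.
have i2 : gint (t ^+ 2) (fun y : borel V => 2^-1 * dotp V u y ^+ 2 +
   (C * t * dotp V y y + C / t * dotp V y y ^+ 2)).
  by apply: gintD => //; exact: gintZ.
have le : gexp (t ^+ 2) P <=
    gexp (t ^+ 2) (fun y : borel V => ln (F (x + y + t ^+ 2 *: u))).
  apply: le_gexp => // [|y]; first exact: gintB.
  apply: le_trans (CP F A Fb AL AK x y u t t0 t1 AE).
  rewrite /P /c0 /= le_eqVlt; apply/orP; left; apply/eqP.
  by field; rewrite !gt_eqF.
move: le; rewrite (gexpB i1 i2) (gexpD (gint_cst _ _ _) (gintZ _ iF)) gexp_cst.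
rewrite (gexpZ _ iF) -/(heat (t ^+ 2) F x) (gexpD (gintZ _ iu) i3) (gexpZ _ iu).
rewrite (gexpD (gintZ _ iN) (gintZ _ iN2)) (gexpZ _ iN) (gexpZ _ iN2).
have hl : ln (heat (t ^+ 2) F x) - ln (F x) <= (F x)^-1 * heat (t ^+ 2) F x - 1.
  rewrite -ln_div ?posrE//.
  have p0 : 0 < heat (t ^+ 2) F x / F x by rewrite divr_gt0.
  rewrite [(F x)^-1 * _]mulrC; move: (_ / _) p0 => p p0.
  have /le_ln1Dx : -1 < p - 1 by lra.
  by rewrite addrC subrK.
have e1 : C * t * gexp (t ^+ 2) (fun x : borel V => dotp V x x) <= C * n * t ^+ 3.
  have -> : C * n * t ^+ 3 = C * t * (n * t ^+ 2) by ring.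
  by apply: ler_wpM2l => //; rewrite mulr_ge0// ltW.
have e2 : C / t * gexp (t ^+ 2) (fun x : borel V => dotp V x x ^+ 2) <=
    C * (n ^+ 2 * 96) * t ^+ 3.
  have -> : C * (n ^+ 2 * 96) * t ^+ 3 = C / t * (n ^+ 2 * 96 * t ^+ 4).
    by field; rewrite gt_eqF.
  by apply: ler_wpM2l => //; rewrite divr_ge0// ltW.
rewrite /c0; lra.
Qed.

End one_step_upper.

(** * Factoring positive semidefinite maps *)

Section psd_factorization.
Context {R : realType}.

Lemma adjoint_comp (U V W : euclid R) (f : 'Hom(V, W)) (g : 'Hom(U, V)) :
  adjoint (f \o g)%VF = (adjoint g \o adjoint f)%VF.
Proof.
apply/lfunP => y; apply: dotp_ext => z.
by rewrite -adjointP !comp_lfunE -!adjointP.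
Qed.

Section rank_one.
Variable V : euclid R.

Let rank1 (w x : V) : V := dotp V w x *: w.
Let rank1_linear w : linear (rank1 w).
Proof. by move=> a x y; rewrite /rank1 dotpDr dotpZr scalerDl scalerA. Qed.

Lemma sqr_dotp_le (S : 'End(V)) (x y : V) : psd S ->
  dotp V (S x) y ^+ 2 <= dotp V (S x) x * dotp V (S y) y.
Proof.
move=> [Ssym Sge0].
have sym a b : dotp V (S a) b = dotp V (S b) a by rewrite adjointP Ssym dotpC.
have h l k : 0 <= l ^+ 2 * dotp V (S x) x + 2 * (l * k) * dotp V (S x) y + k ^+ 2 * dotp V (S y) y.
  have := Sge0 (l *: x + k *: y).
  have -> : S (l *: x + k *: y) = l *: S x + k *: S y by rewrite linearD !linearZ.
  rewrite !(dotpDl, dotpDr, dotpZl, dotpZr) (sym y x).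
  by congr (0 <= _); ring.
have := Sge0 x; have := Sge0 y.
move: (dotp V (S x) x) (dotp V (S y) y) (dotp V (S x) y) h => a b c h b0 a0.
have ha : 0 <= a * (a * b - c ^+ 2).
  by have := h (- c) a; congr (0 <= _); ring.
have hb : 0 <= b * (a * b - c ^+ 2).
  by have := h b (- c); congr (0 <= _); ring.
rewrite -subr_ge0.
have [a00|an0] := eqVneq a 0; last by rewrite -(pmulr_rge0 _ (_ : 0 < a)) ?lt0r ?an0.
have [b00|bn0] := eqVneq b 0; last by rewrite -(pmulr_rge0 _ (_ : 0 < b)) ?lt0r ?bn0.
(* In the degenerate case a = b = 0 the form takes the value - 2 c^2, so c = 0. *)
have := h 1 (- c); rewrite a00 b00; nra.
Qed.

(** Rank-one maps are peeled off: if <S x, x> = 1 and w = S x, subtracting y -> <w, y> w keeps S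
    semidefinite by Cauchy-Schwarz and adds x to its kernel. The induction is on the rank. *)
Lemma psd_decomposition n (S : 'End(V)) : psd S ->
  (\dim {:V} - \dim (lker S) <= n)%N ->
  exists s : seq V, (size s <= n)%N /\
  forall x, S x = \sum_(w <- s) dotp V w x *: w.
Proof.
elim: n S => [|n IHn] S pS dS.
  exists [::]; split => // x; rewrite big_nil.
  have /eqP : (lker S == fullv)%VS.
    by rewrite eqEdim subvf/= -subn_eq0 -leqn0.
  by move=> kS; apply/eqP; rewrite -memv_ker kS memvf.
have [S0|] := pselect (forall x, dotp V (S x) x = 0).
  exists [::]; split => // x; rewrite big_nil; apply: dotp_eq0; apply/eqP.
  have := sqr_dotp_le x (S x) pS; rewrite S0 mul0r => h.
  by rewrite -sqrf_eq0 eq_le h sqr_ge0.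
move=> /existsNP[x0 /eqP x0n].
have x0gt : 0 < dotp V (S x0) x0 by rewrite lt0r x0n (proj2 pS).
pose r := Num.sqrt (dotp V (S x0) x0).
have r0 : r != 0 by rewrite gt_eqF// sqrtr_gt0.
pose x := r^-1 *: x0.
have Sx : dotp V (S x) x = 1.
  have -> : S x = r^-1 *: S x0 by rewrite linearZ.
  rewrite /x dotpZl dotpZr -[dotp V (S x0) x0]sqr_sqrtr ?ltW// -/r.
  by field.
pose w := S x.
pose hL := GRing.isLinear.Build _ _ _ _ (rank1 w) (rank1_linear w).
pose h : {linear V -> V} := HB.pack (rank1 w) hL.
pose S' : 'End(V) := S - linfun h.
have S'E y : S' y = S y - dotp V w y *: w.
  by rewrite /S' add_lfunE opp_lfunE lfunE.
have [Ssym Sge0] := pS.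
have sym a b : dotp V (S a) b = dotp V (S b) a by rewrite adjointP Ssym dotpC.
have pS' : psd S'.
  split=> [|y].
    apply/lfunP => y; apply: dotp_ext => z; rewrite -adjointP !S'E.
    rewrite !(dotpDl, dotpDr, dotpNl, dotpNr, dotpZl, dotpZr).
    by rewrite (sym z y) (dotpC z (S y)) (dotpC z w); ring.
  rewrite S'E dotpDl dotpNl dotpZl subr_ge0 -expr2.
  by have := sqr_dotp_le x y pS; rewrite Sx mul1r.
have kk : (\dim (lker S) < \dim (lker S'))%N.
  have sub : (lker S <= lker S')%VS.
    apply/subvP => y; rewrite !memv_ker S'E => /eqP Sy.
    by rewrite Sy /w sym Sy dotpC dotp0r scale0r subrr.
  rewrite (ltn_leqif (dimv_leqif_sup sub)); apply/negP => /subvP/(_ x).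
  rewrite !memv_ker S'E -/w /w Sx scale1r subrr eqxx => /(_ isT)/eqP Sx0.
  by move: Sx; rewrite Sx0 dotpC dotp0r => /esym/eqP; rewrite oner_eq0.
have [|s [ss sE]] := IHn S' pS'.
  rewrite -ltnS; apply: leq_trans dS; apply: ltn_sub2l => //.
  by apply: leq_trans kk _; rewrite dimvS// subvf.
exists (w :: s); split => // y.
by rewrite big_cons -sE S'E addrC subrK.
Qed.

(** B sends the l-th basis vector to the l-th vector of the decomposition. There are at most dim V
    of them, and the default 0 of [nth] pads the list. *)
Lemma psd_factor (S : 'End(V)) : psd S ->
  exists B : 'End(V), (B \o adjoint B)%VF = S.
Proof.
move=> pS; have [|s [ss sE]] := psd_decomposition (n := \dim {:V}) pS.
  exact: leq_subr.
pose h (x : V) : V := \sum_(l < \dim {:V}) dotp V (onb V l) x *: nth 0 s l.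
have hl : linear h.
  move=> a x y; rewrite /h scaler_sumr -big_split/=; apply: eq_bigr => l _.
  by rewrite dotpDr dotpZr scalerDl scalerA.
pose hL := GRing.isLinear.Build _ _ _ _ h hl.
pose h' : {linear V -> V} := HB.pack h hL.
have hE x : linfun h' x = h x by rewrite lfunE.
exists (linfun h'); apply/lfunP => y; rewrite comp_lfunE hE sE.
have -> : \sum_(w <- s) dotp V w y *: w =
    \sum_(l < \dim {:V}) dotp V (nth 0 s l) y *: nth 0 s l.
  rewrite (big_nth 0) big_mkord (big_ord_widen_cond (\dim {:V}) xpredT
    (fun l => dotp V (nth 0 s l) y *: nth 0 s l))//= [RHS](bigID (fun l : 'I__ => (l < size s)%N))/=.
  rewrite [X in _ + X]big1 ?addr0// => l; rewrite -leqNgt => sl.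
  by rewrite nth_default// dotpC dotp0r scale0r.
apply: eq_bigr => l _; congr (_ *: _).
rewrite -adjointP hE; congr (dotp V _ y).
rewrite /h (bigD1 l)//= onbP eqxx scale1r big1 ?addr0// => j jl.
by rewrite onbP (negPf jl) scale0r.
Qed.

End rank_one.
End psd_factorization.

Lemma loewner_dotp (R : realType) (V : euclid R) (A B : 'End(V)) (x : V) :
  loewner_le A B -> dotp V (A x) x <= dotp V (B x) x.
Proof.
by move=> [_ /(_ x)]; rewrite add_lfunE opp_lfunE dotpDl dotpNl subr_ge0.
Qed.

(** * The flow of a geometric datum *)

Section datum.
Context {R : realType} {k m : nat}.
Variables (E : 'I_k -> euclid R) (F : 'I_m -> euclid R).
Variables (c : 'I_k -> R) (d : 'I_m -> R) (Q : 'Hom(dsum E, dsum F)).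
Hypotheses (c0 : forall i, 0 < c i) (d0 : forall j, 0 < d j).
Hypothesis geom : FRBL_geometric c d Q.

Lemma dotp_Lambda (l : nat) (W : 'I_l -> euclid R) (a : 'I_l -> R) (x : dsum W) :
  dotp (dsum W) (Lambda a x) x =
  \sum_i a i * dotp (W i) (dsum_proj W i x) (dsum_proj W i x).
Proof.
rewrite /Lambda sum_lfunE dotp_suml; apply: eq_bigr => i _.
by rewrite scale_lfunE comp_lfunE dotpZl dotpC -adjointP.
Qed.

Lemma drift_cost (u : dsum E) :
  \sum_j d j * dotp (F j) (dsum_proj F j (Q u)) (dsum_proj F j (Q u)) <=
  \sum_i c i * dotp (E i) (dsum_proj E i u) (dsum_proj E i u).
Proof.
have [/(loewner_dotp u) + _] := geom; rewrite !comp_lfunE.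
by rewrite dotpC -adjointP dotpC !dotp_Lambda.
Qed.

(** The marginal conditions on S and Q S Q^*, with B a factor of S, say that the blocks of B and of
    Q B are coisometries, the form needed by [gexp_coisometry]. *)
Lemma joint_gauss : exists B : 'End(dsum E),
  (forall i, ((dsum_proj E i \o B) \o adjoint (dsum_proj E i \o B))%VF = \1%VF) /\
  (forall j, ((dsum_proj F j \o (Q \o B)) \o
     adjoint (dsum_proj F j \o (Q \o B)))%VF = \1%VF).
Proof.
have [_ [S [pS SE] [_ SF]]] := geom.
have [B BB] := psd_factor pS; exists B; split => [i|j].
  by rewrite adjoint_comp comp_lfunA -(comp_lfunA _ B) BB SE.
rewrite !adjoint_comp !comp_lfunA -(comp_lfunA _ B) BB.
by rewrite -[RHS](SF j) !comp_lfunA.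
Qed.

(* Averaging a pointwise inequality along the coupled Gaussian vector. *)
Lemma gexp_coupling (t : R) (f : forall i, borel (E i) -> R)
    (g : forall j, borel (F j) -> R) (e : R) : 0 < t ->
  (forall i, bmeas (f i)) -> (forall j, bmeas (g j)) ->
  (forall x : dsum E, \sum_i c i * f i (dsum_proj E i x) <=
    \sum_j d j * g j (dsum_proj F j (Q x)) + e) ->
  forall x : dsum E,
  \sum_i c i * gexp t (fun y : borel (E i) => f i (dsum_proj E i x + y)) <=
  \sum_j d j * gexp t (fun y : borel (F j) => g j (dsum_proj F j (Q x) + y)) + e.
Proof.
move=> t0 bf bg fg x; have [B [BE BF]] := joint_gauss.
have hf i := gexp_coisometry (BE i) t0
  (bmeas_gint t (bmeas_translate (dsum_proj E i x) (bf i))).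
have hg j := gexp_coisometry (BF j) t0
  (bmeas_gint t (bmeas_translate (dsum_proj F j (Q x)) (bg j))).
under eq_bigr do rewrite -(proj2 (hf _)) -(gexpZ _ (proj1 (hf _))).
under [in leRHS]eq_bigr do rewrite -(proj2 (hg _)) -(gexpZ _ (proj1 (hg _))).
have i1 i := gintZ (c i) (proj1 (hf i)).
have i2 j := gintZ (d j) (proj1 (hg j)).
rewrite -(gexp_sum _ i1) -(gexp_sum _ i2) -[X in _ + X](gexp_cst (dsum E) t).
rewrite -(gexpD (gint_sum _ i2) (gint_cst _ _ _)).
apply: le_gexp => [||y]; first exact: gint_sum.
  by apply: gintD (gint_cst _ _ _); exact: gint_sum.
have := fg (x + B y); congr (_ <= _ + _); apply: eq_bigr => l _.
  by rewrite linearD comp_lfunE.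
by rewrite !linearD !comp_lfunE.
Qed.

(** Only the f side needs regularity, Gibbs' bound on the g side being valid for any drift. For
    iteration, the constant is independent of the functions and the incoming error [e] is carried
    along. *)
Lemma heat_step (m0 M0 L K : R) : 0 < m0 -> m0 <= M0 -> 0 <= L -> 0 <= K ->
  exists2 C, 0 <= C & forall (f : forall i, borel (E i) -> R)
    (g : forall j, borel (F j) -> R) (e : R),
  (forall i, regular m0 M0 L K (f i)) ->
  (forall j, measurable_fun setT (g j)) -> (forall j y, m0 <= g j y <= M0) ->
  (forall x : dsum E, \sum_i c i * ln (f i (dsum_proj E i x)) <=
    \sum_j d j * ln (g j (dsum_proj F j (Q x))) + e) ->
  forall t, 0 < t -> t <= 1 ->
  forall x : dsum E, \sum_i c i * ln (heat (t ^+ 2) (f i) (dsum_proj E i x)) <=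
    \sum_j d j * ln (heat (t ^+ 2) (g j) (dsum_proj F j (Q x))) + (e + C * t ^+ 3).
Proof.
move=> m00 mM L0 K0.
have /choice[C CP] : forall i, exists C : R, 0 <= C /\ forall f : borel (E i) -> R,
    regular m0 M0 L K f -> forall x, exists u : E i, forall t : R, 0 < t -> t <= 1 ->
    ln (heat (t ^+ 2) f x) <=
    gexp (t ^+ 2) (fun y : borel (E i) => ln (f (x + y + t ^+ 2 *: u)))
    - t ^+ 2 * dotp (E i) u u / 2 + C * t ^+ 3.
  by move=> i; have [C C0 CP] := ln_heat_le (E i) m00 mM L0 K0; exists C.
exists (\sum_i c i * C i).
  by apply: sumr_ge0 => i _; rewrite mulr_ge0 ?(ltW (c0 i))//; case: (CP i).
move=> f g e rf mg gb fg t t0 t1 x; have t20 : 0 < t ^+ 2 by rewrite exprn_gt0.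
pose u i := sval (cid (proj2 (CP i) _ (rf i) (dsum_proj E i x))).
have uP i : ln (heat (t ^+ 2) (f i) (dsum_proj E i x)) <=
    gexp (t ^+ 2) (fun y : borel (E i) => ln (f i (dsum_proj E i x + y + t ^+ 2 *: u i)))
    - t ^+ 2 * dotp (E i) (u i) (u i) / 2 + C i * t ^+ 3.
  exact: (svalP (cid (proj2 (CP i) _ (rf i) (dsum_proj E i x)))).
pose U : dsum E := [ffun i => u i] : dsum_space E.
have UE i : dsum_proj E i U = u i by rewrite dsum_projE /U ffunE.
pose v j := dsum_proj F j (Q U).
have vP j : gexp (t ^+ 2) (fun y : borel (F j) =>
      ln (g j (dsum_proj F j (Q x) + y + t ^+ 2 *: v j)))
    - t ^+ 2 * dotp (F j) (v j) (v j) / 2 <= ln (heat (t ^+ 2) (g j) (dsum_proj F j (Q x))).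
  exact: ln_heat_ge m00 (mg j) (gb j).
have bf i : bmeas (fun y : borel (E i) => ln (f i y)).
  by case: (rf i) => mf fb _; exact: bmeas_ln m00 mf fb.
have bg j : bmeas (fun y : borel (F j) => ln (g j y)).
  exact: bmeas_ln m00 (mg j) (gb j).
have cost : \sum_j d j * dotp (F j) (v j) (v j) <= \sum_i c i * dotp (E i) (u i) (u i).
  by have := drift_cost U; congr (_ <= _); apply: eq_bigr => i _; rewrite UE.
have keyL i : gexp (t ^+ 2) (fun y : borel (E i) => ln (f i (dsum_proj E i (x + t ^+ 2 *: U) + y))) =
    gexp (t ^+ 2) (fun y : borel (E i) => ln (f i (dsum_proj E i x + y + t ^+ 2 *: u i))).
  by apply: eq_gexp => y; rewrite linearD linearZ/= UE addrAC.
have keyR j : gexp (t ^+ 2) (fun y : borel (F j) =>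
      ln (g j (dsum_proj F j (Q (x + t ^+ 2 *: U)) + y))) =
    gexp (t ^+ 2) (fun y : borel (F j) => ln (g j (dsum_proj F j (Q x) + y + t ^+ 2 *: v j))).
  by apply: eq_gexp => y; rewrite linearD linearZ/= linearD linearZ/= addrAC.
have key : \sum_i c i * gexp (t ^+ 2) (fun y : borel (E i) =>
      ln (f i (dsum_proj E i x + y + t ^+ 2 *: u i))) <=
    \sum_j d j * gexp (t ^+ 2) (fun y : borel (F j) =>
      ln (g j (dsum_proj F j (Q x) + y + t ^+ 2 *: v j))) + e.
  (* Averaging around x + t^2 U builds the drifts u i and v j into the arguments. *)
  have := gexp_coupling t20 bf bg fg (x + t ^+ 2 *: U).
  by congr (_ <= _ + _); apply: eq_bigr => l _; rewrite ?keyL ?keyR.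
have sumL : \sum_i c i * ln (heat (t ^+ 2) (f i) (dsum_proj E i x)) <=
  \sum_i c i * gexp (t ^+ 2) (fun y : borel (E i) =>
    ln (f i (dsum_proj E i x + y + t ^+ 2 *: u i)))
  - t ^+ 2 / 2 * (\sum_i c i * dotp (E i) (u i) (u i)) + (\sum_i c i * C i) * t ^+ 3.
  rewrite mulr_sumr mulr_suml -sumrB -big_split/=; apply: ler_sum => i _.
  by have := ler_wpM2l (ltW (c0 i)) (uP i); lra.
have sumR : \sum_j d j * gexp (t ^+ 2) (fun y : borel (F j) =>
    ln (g j (dsum_proj F j (Q x) + y + t ^+ 2 *: v j)))
  - t ^+ 2 / 2 * (\sum_j d j * dotp (F j) (v j) (v j)) <=
  \sum_j d j * ln (heat (t ^+ 2) (g j) (dsum_proj F j (Q x))).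
  rewrite mulr_sumr -sumrB; apply: ler_sum => j _.
  by have := ler_wpM2l (ltW (d0 j)) (vP j); lra.
have t22 : 0 <= t ^+ 2 / 2 by rewrite divr_ge0// ltW.
have := ler_wpM2l t22 cost.
lra.
Qed.

Lemma heat_iter (m0 M0 L K : R) (f : forall i, borel (E i) -> R)
    (g : forall j, borel (F j) -> R) (n : nat) :
  0 < m0 -> m0 <= M0 -> 0 <= L -> 0 <= K -> (0 < n)%N ->
  (forall i, regular m0 M0 L K (f i)) ->
  (forall j, measurable_fun setT (g j)) -> (forall j y, m0 <= g j y <= M0) ->
  (forall x : dsum E, \sum_i c i * ln (f i (dsum_proj E i x)) <=
    \sum_j d j * ln (g j (dsum_proj F j (Q x)))) ->
  \sum_i c i * ln (heat (n%:R ^+ 2) (f i) 0) <=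
    \sum_j d j * ln (heat (n%:R ^+ 2) (g j) 0).
Proof.
move=> m00 mM L0 K0 n0 rf mg gb fg.
have [C C0 CP] := heat_step m00 mM L0 K0.
have iter_heat (V : euclid R) (h : borel V -> R) (t : R) l : 0 < t -> bmeas h ->
    (0 < l)%N -> iter l (heat t) h = heat (l%:R * t) h.
  move=> t0 bh; elim: l => [//|[|l] IHl] _; first by rewrite [1%:R * t]mul1r.
  have l0 : 0 < l.+1%:R * t by rewrite mulr_gt0// ltr0n.
  rewrite iterS (IHl isT); apply/funext => x; rewrite (heat_heat x t0 l0 bh).
  by congr (heat _ h x); rewrite -[l.+2%:R]natr1 mulrDl mul1r addrC.
have step (t : R) : 0 < t -> t <= 1 -> forall l (x : dsum E),
    \sum_i c i * ln (iter l (heat (t ^+ 2)) (f i) (dsum_proj E i x)) <=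
    \sum_j d j * ln (iter l (heat (t ^+ 2)) (g j) (dsum_proj F j (Q x))) +
    l%:R * C * t ^+ 3.
  move=> t0 t1; elim=> [|l IHl] x; first by rewrite !mul0r addr0; exact: fg.
  have mgl j : measurable_fun setT (iter l (heat (t ^+ 2)) (g j)) /\
      forall y, m0 <= iter l (heat (t ^+ 2)) (g j) y <= M0.
    elim: l {IHl} => [|l [IH1 IH2]] //=; split; last exact: heat_itv.
    by apply: measurable_heat; exact: bmeas_itv IH2.
  have := CP _ _ _ (fun i => regular_iter_heat (t ^+ 2) l (rf i))
    (fun j => proj1 (mgl j)) (fun j => proj2 (mgl j)) IHl t t0 t1 x.
  move/le_trans; apply; rewrite lerD2l -natr1 le_eqVlt; apply/orP; left.
  by apply/eqP; ring.
apply/ler_addgt0Pr => eps eps0.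
have nR0 : 0 < n%:R :> R by rewrite ltr0n.
(* N >= n gives t = n / N <= 1, and the N^2 steps cost N^2 C t^3 = C n^3 / N <= eps in all. *)
have [N [nN epsN]] : exists N, (n <= N)%N /\ C * n%:R ^+ 3 / eps <= N%:R.
  exists (n + (Num.truncn (C * n%:R ^+ 3 / eps)).+1)%N; rewrite leq_addr; split => //.
  by apply: le_trans (ltW (truncnS_gt _)) _; rewrite ler_nat leq_addl.
have N1 : (0 < N)%N by exact: leq_trans nN.
have N0 : 0 < N%:R :> R by rewrite ltr0n.
pose t : R := n%:R / N%:R.
have t0 : 0 < t by rewrite divr_gt0.
have t1 : t <= 1 by rewrite ler_pdivrMr// mul1r ler_nat.
have NN : (0 < N ^ 2)%N by rewrite expn_gt0 N1.
have tE : (N ^ 2)%:R * t ^+ 2 = n%:R ^+ 2.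
  by rewrite natrX -exprMn mulrC divfK// gt_eqF.
have t20 : 0 < t ^+ 2 by rewrite exprn_gt0.
have fE i : iter (N ^ 2) (heat (t ^+ 2)) (f i) = heat (n%:R ^+ 2) (f i).
  have bf : bmeas (f i) by case: (rf i) => mf fb _; exact: bmeas_itv fb.
  by rewrite (iter_heat _ _ _ _ t20 bf NN) tE.
have gE j : iter (N ^ 2) (heat (t ^+ 2)) (g j) = heat (n%:R ^+ 2) (g j).
  by rewrite (iter_heat _ _ _ _ t20 (bmeas_itv (mg j) (gb j)) NN) tE.
have h := step t t0 t1 (N ^ 2)%N 0.
have eL : \sum_i c i * ln (heat (n%:R ^+ 2) (f i) 0) =
    \sum_i c i * ln (iter (N ^ 2) (heat (t ^+ 2)) (f i) (dsum_proj E i 0)).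
  by apply: eq_bigr => i _; rewrite fE linear0.
have eR : \sum_j d j * ln (heat (n%:R ^+ 2) (g j) 0) =
    \sum_j d j * ln (iter (N ^ 2) (heat (t ^+ 2)) (g j) (dsum_proj F j (Q 0))).
  by apply: eq_bigr => j _; rewrite gE !linear0.
rewrite [leLHS]eL; apply: le_trans h _; rewrite -eR lerD2l.
have -> : (N ^ 2)%:R * C * t ^+ 3 = C * n%:R ^+ 3 / N%:R.
  by rewrite /t natrX; field; rewrite gt_eqF.
by rewrite ler_pdivrMr// (mulrC eps) -ler_pdivrMr.
Qed.

End datum.

(** * Continuity of the heat semigroup *)

Section gauss_comparison.
Context {R : realType}.

Lemma gauss_kernel_homo (V : euclid R) (a b : R) (x : V) : 0 < a -> a <= b ->
  gauss_kernel a x <= gauss_kernel b x.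
Proof.
move=> a0 ab; rewrite ler_expR lerN2; apply: ler_wpM2l; first exact: dotp_ge0.
by rewrite lef_pV2 ?posrE ?mulr_gt0 ?ler_pM2l// (lt_le_trans a0).
Qed.

Lemma gauss_mass_homo (a b : R) : 0 < a -> a <= b -> gauss_mass a <= gauss_mass b.
Proof.
move=> a0 ab; have b0 : 0 < b by exact: lt_le_trans ab.
rewrite -lee_fin -(proj1 (gauss_massE a0)) -(proj1 (gauss_massE b0)).
have m t : measurable_fun setT (fun x : R => (expR (- (x ^+ 2 / (2 * t))))%:E).
  apply/measurable_EFinP; apply: measurableT_comp => //; apply: measurableT_comp => //.
  by apply: measurable_funM => //; exact: measurable_funX.
apply: ge0_le_integral => //=; [exact: m|exact: m|move=> x _]; rewrite lee_fin ler_expR lerN2.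
apply: ler_wpM2l; first exact: sqr_ge0.
by rewrite lef_pV2 ?posrE ?mulr_gt0 ?ler_pM2l.
Qed.

(** For T <= a <= 2 T the kernel of time a lies below that of time 2 T, and its mass is at least
    that of time T. One approximation in L^1 at time 2 T thus serves all times T + s with s <= T. *)
Lemma gexp_comparison (V : euclid R) (T : R) : 0 < T ->
  exists2 C : R, 0 <= C & forall (a : R) (f : borel V -> R), T <= a -> a <= 2 * T ->
  bmeas f -> (forall x, 0 <= f x) -> gexp a f <= C * gexp (2 * T) f.
Proof.
move=> T0; pose Z t : R := gauss_mass t ^+ \dim {:V}.
have T20 : 0 < 2 * T by rewrite mulr_gt0.
have Z0 t : 0 < t -> 0 < Z t by move=> t0; exact/exprn_gt0/gauss_mass_gt0.
exists (Z (2 * T) / Z T); first by rewrite divr_ge0 ?ltW// Z0.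
move=> a f Ta a2T bf f0; have a0 : 0 < a by exact: lt_le_trans Ta.
have [mf _] := bf; have mfE : measurable_fun setT (EFin \o f) by exact/measurable_EFinP.
have f0E x : (0 <= (EFin \o f) x)%E by rewrite lee_fin.
have mk t : measurable_fun setT (fun x : borel V => ((f x)%:E * (gauss_kernel t x)%:E)%E).
  apply: emeasurable_funM => //.
  by apply/measurable_EFinP; exact: measurable_gauss_kernel.
have k0 t (x : borel V) : (0 <= (f x)%:E * (gauss_kernel t x)%:E)%E.
  by apply: mule_ge0; rewrite lee_fin // gauss_kernel_ge0.
have := etrans (esym (gexpE (bmeas_gint a bf))) (integral_gauss a0 mfE f0E).
have := etrans (esym (gexpE (bmeas_gint (2 * T) bf))) (integral_gauss T20 mfE f0E).
set I1 := (\int[_]_x _)%E; set I2 := (\int[volume V]_x ((EFin \o f) x * (gauss_kernel a x)%:E))%E.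
have I10 : (0 <= I1)%E by apply: integral_ge0 => x _; exact: k0.
have I20 : (0 <= I2)%E by apply: integral_ge0 => x _; exact: k0.
have I12 : (I2 <= I1)%E.
  apply: ge0_le_integral => //= x _; rewrite -!EFinM lee_fin.
  by apply: ler_wpM2l => //; exact: gauss_kernel_homo.
have ZTa : Z T <= Z a.
  by rewrite /Z lerXn2r ?nnegrE ?gauss_mass_ge0//; exact: gauss_mass_homo.
have ZT := Z0 _ T0; have Za := Z0 _ a0; have Z2 := Z0 _ T20.
move: I10 I20 I12; rewrite -/(Z a) -/(Z (2 * T)).
move: (Z a) (Z T) (Z (2 * T)) ZT Za Z2 ZTa => za zT z2 zT0 za0 z20 zTa.
case: I1 I2 => [r1| |] [r2| |]//=; rewrite ?lee_fin//.
- move=> r10 r20 r12; rewrite -!EFinM => -[e1] [e2]; rewrite e1 e2.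
  have -> : z2 / zT * (r1 * z2^-1) = r1 * zT^-1 by field; rewrite !gt_eqF.
  by apply: ler_pM => //; [rewrite invr_ge0 ltW|rewrite lef_pV2 ?posrE].
- by rewrite gt0_mulye// lte_fin invr_gt0.
- by rewrite gt0_mulye// lte_fin invr_gt0.
Qed.

End gauss_comparison.

(** * Density of Lipschitz functions in L^1 of a Gaussian law *)

Section lipschitz_approximation.
Context {R : realType} (V : euclid R) (t : R).

(** Squaring the increments expresses the Lipschitz condition without a norm; [l] is the square of
    the Lipschitz constant. *)
Definition lip (h : borel V -> R) : Prop :=
  bmeas h /\ exists2 l : R, 0 <= l & forall x y : V, (h (x + y) - h x) ^+ 2 <= l * dotp V y y.

Definition lip_approximable (f : borel V -> R) : Prop :=
  bmeas f /\ forall e, 0 < e -> exists2 h, lip h & gexp t (fun x => `|f x - h x|) <= e.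

Lemma bmeasD (f g : borel V -> R) : bmeas f -> bmeas g -> bmeas (fun x => f x + g x).
Proof.
move=> [mf [M fM]] [mg [N gN]]; split; first exact: measurable_funD.
by exists (M + N) => x; apply: le_trans (ler_normD _ _) _; exact: lerD.
Qed.

Lemma bmeasM (f g : borel V -> R) : bmeas f -> bmeas g -> bmeas (fun x => f x * g x).
Proof.
move=> [mf [M fM]] [mg [N gN]]; split; first exact: measurable_funM.
by exists (M * N) => x; rewrite normrM; exact: ler_pM.
Qed.

Lemma bmeasB (f g : borel V -> R) : bmeas f -> bmeas g -> bmeas (fun x => f x - g x).
Proof.
move=> bf bg; have := bmeasD bf (bmeasM (bmeas_cst V (-1)) bg).
by congr bmeas; apply/funext => x; rewrite /= mulN1r.
Qed.

Lemma bmeas_norm (f : borel V -> R) : bmeas f -> bmeas (fun x => `|f x|).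
Proof.
move=> [mf [M fM]]; split; first exact: measurableT_comp.
by exists M => x; rewrite normr_id.
Qed.

Lemma lip_cst (c : R) : lip (cst c).
Proof.
split; first exact: bmeas_cst.
by exists 0 => // x y; rewrite subrr expr0n mul0r.
Qed.

Lemma lipD (f g : borel V -> R) : lip f -> lip g -> lip (fun x => f x + g x).
Proof.
move=> [bf [l l0 fl]] [bg [k k0 gk]]; split; first exact: bmeasD.
exists (2 * l + 2 * k) => [|x y]; first by lra.
have := fl x y; have := gk x y; have := sqr_ge0 ((f (x + y) - f x) - (g (x + y) - g x)).
lra.
Qed.

Lemma lipM (f g : borel V -> R) : lip f -> lip g -> lip (fun x => f x * g x).
Proof.
move=> [bf [l l0 fl]] [bg [k k0 gk]]; split; first exact: bmeasM.
have [_ [M fM]] := bf; have [_ [N gN]] := bg.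
have sq (a b : R) : `|a| <= b -> a ^+ 2 <= b ^+ 2.
  move=> ab; rewrite -real_normK ?num_real// lerXn2r// ?nnegrE//.
  exact: le_trans ab.
exists (2 * M ^+ 2 * k + 2 * N ^+ 2 * l) => [|x y].
  by rewrite addr_ge0// mulr_ge0// mulr_ge0// sqr_ge0.
have f2 := sq _ _ (fM (x + y)); have g2 := sq _ _ (gN x).
have q0 := dotp_ge0 y.
pose a := f (x + y); pose b := g (x + y) - g x; pose c := f (x + y) - f x.
have -> : f (x + y) * g (x + y) - f x * g x = a * b + c * g x.
  by rewrite /a /b /c; ring.
have h1 : (a * b) ^+ 2 <= M ^+ 2 * (k * dotp V y y).
  by rewrite exprMn; apply: ler_pM; rewrite ?sqr_ge0//; exact: gk.
have h2 : (c * g x) ^+ 2 <= N ^+ 2 * (l * dotp V y y).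
  by rewrite exprMn mulrC; apply: ler_pM; rewrite ?sqr_ge0//; exact: fl.
have := sqr_ge0 (a * b - c * g x); lra.
Qed.

Lemma lip_approximable_lip (h : borel V -> R) : lip h -> lip_approximable h.
Proof.
move=> lh; split=> [|e e0]; first by case: lh.
exists h => //; rewrite (_ : (fun _ => _) = cst 0) ?gexp_cst ?ltW//.
by apply/funext => x; rewrite subrr normr0.
Qed.

Lemma lip_approximable_lim (f : borel V -> R) : bmeas f ->
  (forall e, 0 < e -> exists2 g, lip_approximable g & gexp t (fun x => `|f x - g x|) <= e) ->
  lip_approximable f.
Proof.
move=> bf fg; split => // e e0; have e20 : 0 < e / 2 by rewrite divr_gt0.
have [g [bg gh] fge] := fg _ e20; have [h lh ghe] := gh _ e20; exists h => //.
have bh : bmeas h by case: lh.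
have i1 := bmeas_gint t (bmeas_norm (bmeasB bf bg)).
have i2 := bmeas_gint t (bmeas_norm (bmeasB bg bh)).
have i3 := bmeas_gint t (bmeas_norm (bmeasB bf bh)).
apply: (@le_trans _ _ (gexp t (fun x => `|f x - g x| + `|g x - h x|))).
  apply: le_gexp => // [|x]; first exact: gintD.
  by have := ler_distD (g x) (f x) (h x).
by rewrite gexpD//; lra.
Qed.

Lemma lip_approximableD (f g : borel V -> R) :
  lip_approximable f -> lip_approximable g -> lip_approximable (fun x => f x + g x).
Proof.
move=> [bf fa] [bg ga]; split; first exact: bmeasD.
move=> e e0; have e20 : 0 < e / 2 by rewrite divr_gt0.
have [h lh fhe] := fa _ e20; have [k lk gke] := ga _ e20.
exists (fun x => h x + k x); first exact: lipD.
have [bh _] := lh; have [bk _] := lk.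
have i1 := bmeas_gint t (bmeas_norm (bmeasB bf bh)).
have i2 := bmeas_gint t (bmeas_norm (bmeasB bg bk)).
have i3 := bmeas_gint t (bmeas_norm (bmeasB (bmeasD bf bg) (bmeasD bh bk))).
apply: (@le_trans _ _ (gexp t (fun x => `|f x - h x| + `|g x - k x|))).
  apply: le_gexp => // [|x]; first exact: gintD.
  by apply: le_trans (ler_normD _ _); rewrite le_eqVlt; apply/orP; left; apply/eqP; congr `|_|; ring.
by rewrite gexpD//; lra.
Qed.

Lemma lip_approximableZ (c : R) (f : borel V -> R) :
  lip_approximable f -> lip_approximable (fun x => c * f x).
Proof.
move=> [bf fa]; split; first by apply: bmeasM => //; exact: bmeas_cst.
move=> e e0; have c0 : 0 < `|c| + 1 by rewrite ltr_wpDl.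
have e20 : 0 < e / (`|c| + 1) by rewrite divr_gt0.
have [h lh fhe] := fa _ e20.
exists (fun x => c * h x); first by apply: lipM => //; exact: lip_cst.
have [bh _] := lh.
have i1 := bmeas_gint t (bmeas_norm (bmeasB bf bh)).
rewrite (_ : (fun _ => _) = (fun x => `|c| * `|f x - h x|)); last first.
  by apply/funext => x; rewrite -normrM mulrBr.
rewrite gexpZ//; apply: le_trans (ler_wpM2l (normr_ge0 c) fhe) _.
by rewrite mulrCA ler_piMr// ?(ltW e0)// ler_pdivrMr// mul1r lerDl.
Qed.

(* The two factors are replaced one at a time: how well [g] must be approximated
   depends on the bound of the approximant [h] of [f]. *)
Lemma lip_approximableM (f g : borel V -> R) :
  lip_approximable f -> lip_approximable g -> lip_approximable (fun x => f x * g x).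
Proof.
move=> [bf fa] ag; have [bg ga] := ag.
have [_ [M gM]] := bg; have M0 : 0 <= M := le_trans (normr_ge0 _) (gM 0).
apply: lip_approximable_lim; first exact: bmeasM.
move=> e e0; have M10 : 0 < M + 1 by lra.
have [h lh fhe] := fa _ (divr_gt0 e0 M10); have [bh _] := lh.
exists (fun x => h x * g x); last first.
  have i1 := bmeas_gint t (bmeas_norm (bmeasB bf bh)).
  apply: (@le_trans _ _ (gexp t (fun x => M * `|f x - h x|))).
    apply: le_gexp => // [||x]; last by rewrite -mulrBl normrM mulrC ler_wpM2r.
      exact: bmeas_gint (bmeas_norm (bmeasB (bmeasM bf bg) (bmeasM bh bg))).
    exact: gintZ.
  rewrite gexpZ//; apply: le_trans (ler_wpM2l M0 fhe) _.
  by rewrite mulrCA ler_piMr// ?(ltW e0)// ler_pdivrMr// mul1r lerDl.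
have [_ [N hN]] := bh; have N0 : 0 <= N := le_trans (normr_ge0 _) (hN 0).
split=> [|e' e'0]; first exact: bmeasM.
have N10 : 0 < N + 1 by lra.
have [k lk gke] := ga _ (divr_gt0 e'0 N10); have [bk _] := lk.
exists (fun x => h x * k x); first exact: lipM.
have i1 := bmeas_gint t (bmeas_norm (bmeasB bg bk)).
apply: (@le_trans _ _ (gexp t (fun x => N * `|g x - k x|))).
  apply: le_gexp => // [||x]; last by rewrite -mulrBr normrM ler_wpM2r.
    exact: bmeas_gint (bmeas_norm (bmeasB (bmeasM bh bg) (bmeasM bh bk))).
  exact: gintZ.
rewrite gexpZ//; apply: le_trans (ler_wpM2l N0 gke) _.
by rewrite mulrCA ler_piMr// ?(ltW e'0)// ler_pdivrMr// mul1r lerDl.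
Qed.

End lipschitz_approximation.

Section lipschitz_density.
Context {R : realType} (V : euclid R) (t : R).
Local Notation lipa := (lip_approximable t).

Definition lip_set (A : set (borel V)) : Prop := measurable A /\ lipa (\1_A).

Lemma bmeas_indic (A : set (borel V)) : measurable A -> bmeas (\1_A : borel V -> R).
Proof.
move=> mA; split; first exact: measurable_indic.
by exists 1 => x; rewrite indicE; case: (_ \in _); rewrite ?normr1 ?normr0.
Qed.

Lemma gexp_indic_lim (A : set (borel V)) (C : (set (borel V))^nat) :
  measurable A -> (forall n, measurable (C n)) -> nondecreasing_seq C ->
  A = \bigcup_n C n -> forall e, 0 < e ->
  exists n, gexp t (fun x => \1_A x - \1_(C n) x) <= e.
Proof.
move=> mA mC ndC AC e e0.
have E B : measurable B -> gexp t (\1_B : borel V -> R) = fine (gauss V t B).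
  by move=> mB; rewrite /gexp /Rintegral integral_indic// setIT.
have mUC : measurable (\bigcup_n C n) by rewrite -AC.
have := @nondecreasing_cvg_mu _ _ _ (gauss V t) C mC mUC ndC.
rewrite -AC -[X in _ --> X]fineK ?fin_num_measure//.
move=> /fine_cvg/cvgrPdist_le/(_ e e0)[n _ /(_ n (leqnn n))] h.
exists n; rewrite gexpB; [|exact: bmeas_gint (bmeas_indic _)|exact: bmeas_gint (bmeas_indic _)].
rewrite !E//; apply: le_trans (ler_norm _) _; exact: h.
Qed.

(** Complements and finite unions come from the algebra of approximable functions; a countable union
    is the increasing limit of finite ones, along which the measure converges. *)
Lemma lip_set_sigma_algebra : sigma_algebra setT lip_set.
Proof.
have lC A : lip_set A -> lip_set (setT `\` A).
  move=> [mA lA]; split; first exact: measurableD.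
  rewrite (_ : \1_(_ `\` _) = (fun x => cst 1 x + -1 * \1_A x)).
    apply: lip_approximableD; first exact/lip_approximable_lip/lip_cst.
    exact: lip_approximableZ.
  apply/funext => x; rewrite !indicE in_setD in_setT /=.
  by case: (_ \in A) => /=; rewrite ?mulr1 ?mulr0 ?addr0 ?subrr.
have lU A B : lip_set A -> lip_set B -> lip_set (A `|` B).
  move=> [mA lA] [mB lB]; split; first exact: measurableU.
  rewrite (_ : \1_(_ `|` _) = (fun x => \1_A x + (\1_B x + -1 * (\1_A x * \1_B x)))).
    apply: lip_approximableD => //; apply: lip_approximableD => //.
    exact/lip_approximableZ/lip_approximableM.
  apply/funext => x; rewrite !indicE in_setU.
  by case: (_ \in A); case: (_ \in B) => /=; ring.
have l0 : lip_set set0.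
  split => //; rewrite indic0; exact/lip_approximable_lip/lip_cst.
split => // A lA.
pose C n := \bigcup_(i < n) A i.
have lCn n : lip_set (C n).
  elim: n => [|n IHn]; first by rewrite /C bigcup_mkord big_ord0.
  by rewrite /C bigcup_mkord big_ord_recr/= -bigcup_mkord; exact: lU.
have mUA : measurable (\bigcup_n A n).
  by apply: bigcupT_measurable => n; case: (lA n).
have AC : \bigcup_n A n = \bigcup_n C n.
  apply/seteqP; split => x [n _ Anx]; first by exists n.+1 => //; exists n => /=.
  by case: Anx => i _ Aix; exists i.
have ndC : nondecreasing_seq C.
  move=> n p np; apply/subsetPset => x [i /= ilt Aix]; exists i => //=.
  exact: leq_trans np.
split=> //; apply: lip_approximable_lim; first exact: bmeas_indic.
move=> e e0.
have [n ne] := gexp_indic_lim mUA (fun n => proj1 (lCn n)) ndC AC e0.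
exists (\1_(C n)); first by case: (lCn n).
apply: le_trans ne; rewrite le_eqVlt; apply/orP; left; apply/eqP.
apply: eq_gexp => x; rewrite ger0_norm// subr_ge0 AC !indicE.
have [Cx|] := boolP (x \in C n); last by rewrite ler0n.
by rewrite (_ : x \in _)//; apply/mem_set; exists n => //; exact/set_mem.
Qed.

(** The open half-space is an increasing union of closed ones, and a Lipschitz ramp fits between it
    and each of them. *)
Lemma lip_set_ray (u : V) (a : R) : lip_set (dotp V u @^-1` `]a, +oo[%classic).
Proof.
rewrite -[_ @^-1` _]/(dotp V u @^-1` `]a, +oo[%classic : set (borel V)).
set A : set (borel V) := _ @^-1` _.
have md := @measurable_dotp _ V u.
have mA : measurable A by rewrite -[A]setTI; exact: md.
split=> //; pose C n : set (borel V) := dotp V u @^-1` `[a + n.+1%:R^-1, +oo[%classic.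
have mC n : measurable (C n) by rewrite -[C n]setTI; exact: md.
have ndC : nondecreasing_seq C.
  move=> n p np; apply/subsetPset => x; rewrite /C /= !in_itv/= !andbT.
  apply: le_trans; rewrite lerD2l lef_pV2 ?posrE ?ltr0n//.
  by rewrite ler_nat ltnS.
have AC : A = \bigcup_n C n.
  apply/seteqP; split => x; rewrite /A /C /= in_itv/= andbT.
    move=> ax; pose r := dotp V u x - a.
    have r0 : 0 < r by rewrite subr_gt0.
    exists (Num.truncn r^-1) => //=; rewrite in_itv/= andbT -lerBrDl -/r.
    by rewrite -[leRHS]invrK lef_pV2 ?posrE ?invr_gt0 ?ltr0n// ltW// truncnS_gt.
  move=> [n _]; rewrite /= in_itv/= andbT; apply: lt_le_trans.
  by rewrite ltrDl invr_gt0 ltr0n.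
apply: lip_approximable_lim; first exact: bmeas_indic.
move=> e e0; have [n ne] := gexp_indic_lim mA mC ndC AC e0.
(* The ramp [h] is 0 off A and 1 on [C n], so |1_A - h| is at most the difference of the indicators
   of A and [C n]. *)
pose clamp (r : R) := Num.max 0 (Num.min 1 r).
pose h (x : borel V) := clamp (n.+1%:R * (dotp V u x - a)).
have clampP r s : `|clamp r - clamp s| <= `|r - s|.
  have := ler_norm (s - r); rewrite (distrC s r) => n2; have n1 := ler_norm (r - s).
  rewrite ler_norml /clamp !maxEle !minEle.
  by case: (leP 1 r) => r1; case: (leP 1 s) => s1; rewrite ?ler01;
    case: (leP 0 r) => r0; case: (leP 0 s) => s0; lra.
have clamp01 r : 0 <= clamp r <= 1.
  by rewrite /clamp le_max lexx/= ge_max ler01/= ge_min lexx.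
have mh : measurable_fun setT h.
  apply: measurable_maxr => //; apply: measurable_minr => //.
  by apply: measurable_funM => //; exact: measurable_funB.
have lh : lip h.
  split; first exact: bmeas_itv mh (fun x => clamp01 _).
  exists (n.+1%:R ^+ 2 * dotp V u u) => [|x y].
    by rewrite mulr_ge0 ?sqr_ge0// dotp_ge0.
  rewrite -[leLHS]real_normK ?num_real//.
  apply: (@le_trans _ _ (`|n.+1%:R * dotp V u y| ^+ 2)).
    apply: lerXn2r; rewrite ?nnegrE//; apply: le_trans (clampP _ _) _.
    by rewrite -mulrBr dotpDr (_ : _ + _ - _ - _ = dotp V u y)//; ring.
  rewrite real_normK ?num_real// exprMn -[leRHS]mulrA; apply: ler_wpM2l; first exact: sqr_ge0.
  exact: dotp_cauchy.
exists h; first exact: lip_approximable_lip.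
have [bh _] := lh.
apply: le_trans ne; apply: le_gexp.
- exact: bmeas_gint (bmeas_norm (bmeasB (bmeas_indic mA) bh)).
- exact: bmeas_gint (bmeasB (bmeas_indic mA) (bmeas_indic (mC n))).
move=> x; have hA : x \notin A -> h x = 0.
  rewrite notin_setE /A /= in_itv/= andbT => /negP; rewrite -leNgt => xa.
  rewrite /h /clamp; apply/max_idPl; rewrite ge_min; apply/orP; right.
  by rewrite mulr_ge0_le0// subr_le0.
have hC : x \in C n -> h x = 1.
  move=> /set_mem; rewrite /C /= in_itv/= andbT -lerBrDl => xa.
  rewrite /h /clamp; have -> : Num.min 1 (n.+1%:R * (dotp V u x - a)) = 1.
    by apply/min_idPl; rewrite mulrC -ler_pdivrMr ?ltr0n// mul1r.
  by apply/max_idPr.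
have CA : x \in C n -> x \in A.
  by move=> /set_mem Cx; apply/mem_set; rewrite AC; exists n.
rewrite !indicE; have /andP[h0 h1] := clamp01 (n.+1%:R * (dotp V u x - a)).
rewrite -/(h x) in h0 h1.
have [xA|xA] := boolP (x \in A); last first.
  by rewrite (contraNF CA xA) hA// subrr normr0.
have [xC|xC] := boolP (x \in C n); first by rewrite hC// subrr normr0.
by rewrite /= ger0_norm; lra.
Qed.

Lemma lip_set_measurable (A : set (borel V)) : measurable A -> lip_set A.
Proof.
(* Two nested inductions over generators: preimages under linear forms for V, then intervals ]a, b]
   for the line. *)
have [s0 sC sU] := lip_set_sigma_algebra.
move: A; apply: smallest_sub => //.
move=> _ [u [B mB ->]]; move: B mB.
apply: smallest_sub.
  split=> [|B lB|B lB].
  - by rewrite preimage_set0.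
  - exact: sC lB.
  - by rewrite preimage_bigcup; exact: sU.
move=> _ [[a b] _ <-] /=.
have -> : `]a, b]%classic = ~` (~` `]a, +oo[%classic `|` `]b, +oo[%classic).
  apply/seteqP; split => x /=; rewrite !in_itv/= !andbT.
    by move=> /andP[ax xb] [/negP|]; [rewrite ax|rewrite ltNge xb].
  move/not_orP => [/contrapT ax /negP]; rewrite -leNgt => xb.
  by rewrite ax.
have lU X Y : lip_set X -> lip_set Y -> lip_set (X `|` Y).
  by move=> lX lY; rewrite -bigcup2E; apply: sU => -[|[|i]].
have lC X : lip_set X -> lip_set (~` X) by move=> lX; rewrite -setTD; exact: sC.
exact: lC (lU _ _ (lC _ (lip_set_ray u a)) (lip_set_ray u b)).
Qed.

End lipschitz_density.

Section heat_continuity.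
Context {R : realType} (V : euclid R).

(** The sum counts the integers in [0, z[, so it is the ceiling of z; it controls the approximation
    of a function by its superlevel sets. *)
Lemma count_layers (N : nat) (z : R) : 0 <= z -> z <= N%:R ->
  z <= \sum_(k < N) (k%:R < z)%R%:R <= z + 1.
Proof.
move=> z0; elim: N => [|N IHN] zN; first by rewrite big_ord0; lra.
rewrite big_ord_recr/=; case: (ltP N%:R z) => Nz.
  have -> : \sum_(i < N) ((nat_of_ord i)%:R < z)%R%:R = N%:R :> R.
    rewrite (eq_bigr (fun=> 1)) ?sumr_const ?card_ord// => i _.
    by rewrite (lt_trans _ Nz)// ltr_nat.
  have {}zN : z <= N%:R + 1 by rewrite natr1.
  by rewrite [true%:R]mulr1n; lra.
by rewrite addr0; exact: IHN.
Qed.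

(** For g with values in [0, 1], the indicators of g > k / N, k < N, sum to N g within 1. An affine
    rescaling gives the general case. *)
Lemma lip_approximable_bmeas (t : R) (f : borel V -> R) :
  bmeas f -> lip_approximable t f.
Proof.
have unit (g : borel V -> R) : measurable_fun setT g -> (forall x, 0 <= g x <= 1) ->
    lip_approximable t g.
  move=> mg g01; have bg := bmeas_itv mg g01.
  apply: lip_approximable_lim => // e e0.
  pose N := (Num.truncn e^-1).+1.
  have N0 : 0 < N%:R :> R by rewrite ltr0n.
  have Ne : N%:R^-1 <= e.
    by rewrite -[leRHS]invrK lef_pV2 ?posrE ?invr_gt0// ltW// truncnS_gt.
  clearbody N.
  pose A k : set (borel V) := g @^-1` `]k%:R / N%:R, +oo[%classic.
  have mA k : measurable (A k) by rewrite -[A k]setTI; exact: mg.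
  pose q n (x : borel V) : R := N%:R^-1 * \sum_(k < n) \1_(A k) x.
  have lq n : lip_approximable t (q n).
    apply: lip_approximableZ; elim: n => [|n IHn].
      rewrite (_ : (fun _ => _) = cst 0); first exact/lip_approximable_lip/lip_cst.
      by apply/funext => x; rewrite big_ord0.
    rewrite (_ : (fun _ => _) = (fun x => \sum_(k < n) \1_(A k) x + \1_(A n) x)).
      by apply: lip_approximableD => //; case: (lip_set_measurable t (mA n)).
    by apply/funext => x; rewrite big_ord_recr.
  exists (q N) => //; apply: le_trans _ Ne; have [bq _] := lq N.
  rewrite -[leRHS](gexp_cst V t); apply: le_gexp => [||x].
  - exact: bmeas_gint (bmeas_norm (bmeasB bg bq)).
  - exact: gint_cst.
  have /andP[g0 g1] := g01 x.
  have z0 : 0 <= N%:R * g x by rewrite mulr_ge0.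
  have zN : N%:R * g x <= N%:R by rewrite ler_piMr.
  have /andP[] := count_layers z0 zN.
  have -> : \sum_(k < N) ((nat_of_ord k)%:R < N%:R * g x)%R%:R = N%:R * q N x.
    rewrite /q mulrA mulfV ?mul1r ?gt_eqF//; apply: eq_bigr => k _.
    rewrite indicE /A; congr (_%:R); congr nat_of_bool.
    rewrite mulrC -ltr_pdivrMr//; apply/idP/idP => h.
      by apply/mem_set; rewrite /= in_itv/= andbT.
    by move/set_mem: h; rewrite /= in_itv/= andbT.
  move=> q1 q2; rewrite /= -(ler_pM2l N0) -[X in X * `|_|]gtr0_norm// -normrM.
  by rewrite mulrBr mulfV ?gt_eqF// ler_norml; lra.
move=> bf; have [mf [B fB]] := bf.
have B0 : 0 <= B := le_trans (normr_ge0 _) (fB 0).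
have B10 : 0 < 2 * B + 1 by lra.
pose g x := (2 * B + 1)^-1 * (f x + B).
have lg : lip_approximable t g.
  apply: unit; first by apply: measurable_funM => //; exact: measurable_funD.
  move=> x; have := fB x; rewrite ler_norml => /andP[f1 f2].
  rewrite /g mulrC; apply/andP; split; first by rewrite divr_ge0 ?(ltW B10)//; lra.
  by rewrite ler_pdivrMr//; lra.
rewrite (_ : f = (fun x => (2 * B + 1) * g x + cst (- B) x)).
  apply: lip_approximableD; first exact: lip_approximableZ.
  exact/lip_approximable_lip/lip_cst.
by apply/funext => x; rewrite /g /= mulrA mulfV ?gt_eqF// mul1r addrK.
Qed.

(** With a Lipschitz h close to phi in L^1 at time 2 T, P_s phi - phi = P_s (phi - h) + (P_s h - h)
    + (h - phi). By the semigroup law the first term, averaged at time T, costs at most the mean of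
    |phi - h| at time T + s. *)
Lemma heat_cvg (T : R) (phi : borel V -> R) : 0 < T -> bmeas phi ->
  forall e, 0 < e -> exists2 s0, 0 < s0 & forall s, 0 < s -> s <= s0 ->
  gexp T (fun x => `|heat s phi x - phi x|) <= e.
Proof.
move=> T0 bphi e e0; have [C C0 CP] := gexp_comparison V T0.
have e88 : e / 8 + e / 8 <= e / 4 by lra.
have e444 : e / 4 + e / 4 + e / 4 <= e by lra.
pose e1 := e / (4 * (C + 1)).
have C10 : 0 < C + 1 by lra.
have e10 : 0 < e1 by rewrite divr_gt0// mulr_gt0.
have Ce1 : C * e1 <= e / 4.
  have -> : e / 4 = (C + 1) * e1 by rewrite /e1; field; rewrite gt_eqF.
  by apply: ler_wpM2r; [exact: ltW|lra].
have [_ /(_ e1 e10)[h [bh [l l0 hl]] phe]] := lip_approximable_bmeas (2 * T) bphi.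
have bd := bmeas_norm (bmeasB bphi bh).
set n : R := (\dim {:V})%:R; have n0 : 0 <= n by [].
(* An increment r of h satisfies |r| <= e / 8 + 2 r^2 / e and r^2 <= l |y|^2; for s <= s1 the mean
   of this bound is at most e / 4. *)
pose s1 := e ^+ 2 / (16 * (l * n + 1)).
have ln1 : 0 < l * n + 1 by rewrite ltr_wpDl// mulr_ge0.
have s10 : 0 < s1 by rewrite divr_gt0 ?exprn_gt0// mulr_gt0.
exists (Num.min T s1); first by rewrite lt_min T0.
move=> s s0; rewrite le_min => /andP[sT ss1].
have hs x : `|heat s h x - h x| <= e / 4.
  have i1 := bmeas_gint s (bmeas_translate x bh).
  have i2 := gint_cst V s (h x).
  rewrite /heat -[X in _ - X](gexp_cst V s) -(gexpB i1 i2).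
  have i3 := gintB i1 i2.
  apply: le_trans (gexp_norm i3) _.
  have [iN EN] := gexp_sqnorm V s0.
  have ib : gint s (fun y : borel V => cst (e / 8) y + 2 * l / e * dotp V y y).
    by apply: gintD (gint_cst _ _ _) _; exact: gintZ.
  apply: le_trans (le_gexp (gint_norm i3) ib _) _.
    move=> y /=; have := hl x y; set r := h (x + y) - h x => rl.
    have -> : 2 * l / e * dotp V y y = 2 / e * (l * dotp V y y) by field; rewrite gt_eqF.
    have := ler_wpM2l (_ : 0 <= 2 / e) rl; rewrite divr_ge0 ?(ltW e0)// => /(_ isT).
    have : `|r| <= e / 8 + 2 / e * r ^+ 2.
      rewrite -[r ^+ 2]real_normK ?num_real// -subr_ge0.
      have -> : e / 8 + 2 / e * `|r| ^+ 2 - `|r| = (e / 2 - 2 * `|r|) ^+ 2 / (2 * e).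
        by field; rewrite gt_eqF.
      by rewrite divr_ge0 ?sqr_ge0// mulr_ge0// ltW.
    by move=> h1 h2; apply: le_trans h1 _; rewrite lerD2l.
  rewrite (gexpD (gint_cst _ _ _) (gintZ _ iN)) gexp_cst (gexpZ _ iN).
  have le0 : 0 <= 2 * l / e by rewrite divr_ge0 ?mulr_ge0// ltW.
  have := ler_wpM2l le0 EN; rewrite -/n.
  have : 2 * l / e * (n * s) <= e / 8.
    apply: (@le_trans _ _ (2 * l / e * (n * s1))).
      by apply: ler_wpM2l => //; exact: ler_wpM2l.
    have -> : 2 * l / e * (n * s1) = e / 8 * (l * n / (l * n + 1)).
      by rewrite /s1; field; rewrite !gt_eqF.
    rewrite ler_piMr ?divr_ge0 ?(ltW e0)// ler_pdivrMr// mul1r.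
    by rewrite lerDl.
  by move=> h1 h2; exact: le_trans (lerD (lexx _) (le_trans h2 h1)) e88.
have bhphi := bmeas_heat s bphi; have bhh := bmeas_heat s bh.
have i0 := bmeas_gint T (bmeas_norm (bmeasB bhphi bphi)).
have bhd := bmeas_heat s bd.
have i1 := bmeas_gint T bhd.
have i2 := gint_cst V T (e / 4).
have i3 := bmeas_gint T bd.
apply: le_trans (le_gexp i0 (gintD (gintD i1 i2) i3) _) _.
  move=> x /=; apply: le_trans (ler_distD (h x) _ _) _; rewrite [X in _ + X]distrC.
  apply: lerD => //; apply: le_trans (ler_distD (heat s h x) _ _) _.
  apply: lerD => //.
  have j1 := bmeas_gint s (bmeas_translate x bphi).
  have j2 := bmeas_gint s (bmeas_translate x bh).
  by rewrite /heat -(gexpB j1 j2); exact: gexp_norm (gintB j1 j2).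
rewrite (gexpD (gintD i1 i2) i3) (gexpD i1 i2) gexp_cst.
have E1 : gexp T (heat s (fun x => `|phi x - h x|)) = gexp (T + s) (fun x => `|phi x - h x|).
  have z (t : R) (f : borel V -> R) : heat t f 0 = gexp t f.
    by apply: eq_gexp => y; rewrite add0r.
  by rewrite -!z (heat_heat 0 T0 s0 bd).
have d0 x : 0 <= `|phi x - h x| by [].
have dle (a : R) : T <= a -> a <= 2 * T -> gexp a (fun x => `|phi x - h x|) <= e / 4.
  move=> Ta aT; apply: le_trans (CP a _ Ta aT bd d0) _.
  exact: le_trans (ler_wpM2l C0 phe) Ce1.
have TT : 2 * T = T + T by rewrite mulrDl mul1r.
have T1 : T <= T + s by rewrite lerDl ltW.
have T2 : T + s <= 2 * T by rewrite TT lerD2l.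
have T3 : T <= 2 * T by rewrite TT lerDl ltW.
have D1 := dle _ T1 T2; have D2 := dle _ (lexx T) T3.
rewrite [X in X + _ + _]E1; apply: le_trans e444.
exact: lerD (lerD D1 (lexx _)) D2.
Qed.

End heat_continuity.

(** * From Gaussian to Lebesgue integrals *)

Section powR_products.
Context {R : realType}.

Lemma cvg_powR (T : Type) (G : set_system T) (f : T -> R) (a p : R) : Filter G ->
  0 < a -> f x @[x --> G] --> a -> (f x) `^ p @[x --> G] --> a `^ p.
Proof.
move=> FG a0 fa; apply: (@cvg_comp _ _ _ f (fun z => z `^ p) _ _ _ fa).
have : derivable (fun z : R => z `^ p) a 1.
  by apply: derivable_powR; rewrite in_itv/= andbT.
by move/derivable1_diffP/differentiable_continuous.
Qed.

Lemma cvg_prod_powR (T : Type) (G : set_system T) n (f : 'I_n -> T -> R)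
    (a p : 'I_n -> R) : Filter G ->
  (forall i, (f i x) `^ p i @[x --> G] --> a i `^ p i) ->
  \prod_i (f i x) `^ p i @[x --> G] --> \prod_i a i `^ p i.
Proof. by move=> FG h; apply: cvg_big => //; exact: mul_continuous. Qed.

Lemma le_prod_powR_right n (X : R) (b d : 'I_n -> R) :
  (forall j, 0 <= b j) -> (forall j, 0 < d j) ->
  (forall h, 0 < h -> h < 1 -> X <= \prod_j (b j + h) `^ d j) ->
  X <= \prod_j b j `^ d j.
Proof.
move=> b0 d0 hX.
have cv : \prod_j (b j + h) `^ d j @[h --> 0^'+] --> \prod_j b j `^ d j.
  (* A power is differentiable away from 0; at 0 its one-sided limit uses d j > 0. *)
  apply: cvg_prod_powR => j; have [bj|bj] := eqVneq (b j) 0.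
    rewrite bj powR0 ?gt_eqF//; under eq_cvg do rewrite add0r.
    exact: powR_cvg0.
  apply: cvg_powR; first by rewrite lt0r bj b0.
  rewrite -[X in _ --> X]addr0; apply: cvgD; first exact: cvg_cst.
  exact: cvg_at_right_filter cvg_id.
rewrite -(cvg_lim _ cv)//; apply: limr_ge; first by apply/cvg_ex; exists (\prod_j b j `^ d j).
near=> h; apply: hX; first by near: h; exact: nbhs_right_gt.
by near: h; exact: nbhs_right_lt.
Unshelve. all: by end_near. Qed.

Lemma prod_powR_expR n (a p : 'I_n -> R) : (forall i, 0 < a i) ->
  \prod_i a i `^ p i = expR (\sum_i p i * ln (a i)).
Proof.
move=> a0; rewrite expR_sum; apply: eq_bigr => i _.
by rewrite /powR gt_eqF.
Qed.

End powR_products.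

Section heat_log_continuity.
Context {R : realType} (V : euclid R).

(** exp f - exp g <= exp B |f - g|, and ln p - ln q <= (p - q) / q with q >= exp (- B): these two
    factors exp B explain [e1]. *)
Lemma ln_gexp_expR_heat (T B : R) (phi : borel V -> R) (e : R) :
  0 < T -> 0 < e -> measurable_fun setT phi -> (forall x, `|phi x| <= B) ->
  exists2 s0, 0 < s0 & forall s, 0 < s -> s <= s0 ->
  `|ln (gexp T (fun x => expR (heat s phi x))) - ln (gexp T (fun x => expR (phi x)))| <= e.
Proof.
move=> T0 e0 mphi phiB.
have bphi : bmeas phi by split => //; exists B.
pose e1 := e / expR B ^+ 2.
have E0 : 0 < expR B := expR_gt0 B.
have e10 : 0 < e1 by rewrite divr_gt0// exprn_gt0.
have e1E : expR B * (expR B * e1) = e by rewrite /e1; field; rewrite gt_eqF.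
have [s0 s00 hs] := heat_cvg T0 bphi e10; exists s0 => // s s_gt0 ss0.
have := hs s s_gt0 ss0; set w := heat s phi => wphi.
have bw : bmeas w by exact: bmeas_heat.
have wB x : - B <= w x <= B by apply: heat_itv => // y; rewrite -ler_norml.
have pB x : - B <= phi x <= B by rewrite -ler_norml.
clearbody w.
have key (f g : borel V -> R) : bmeas f -> bmeas g ->
    (forall x, - B <= f x <= B) -> (forall x, - B <= g x <= B) ->
    gexp T (fun x => `|f x - g x|) <= e1 ->
    ln (gexp T (fun x => expR (f x))) - ln (gexp T (fun x => expR (g x))) <= e.
  move=> bf bg fB gB fg.
  have bE (h : borel V -> R) : bmeas h -> (forall x, - B <= h x <= B) ->
      bmeas (fun x => expR (h x)) /\ expR (- B) <= gexp T (fun x => expR (h x)).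
    move=> [mh _] hB.
    have mE : measurable_fun setT (fun x => expR (h x)) by exact: measurableT_comp.
    have EB x : expR (- B) <= expR (h x) <= expR B by rewrite !ler_expR.
    have bE := bmeas_itv mE EB; split => //.
    by have /andP[] := gexp_bounds (bmeas_gint T bE) EB.
  have [bF F1] := bE f bf fB; have [bG G1] := bE g bg gB.
  have iF := bmeas_gint T bF; have iG := bmeas_gint T bG.
  have ifg := bmeas_gint T (bmeas_norm (bmeasB bf bg)).
  have FG : gexp T (fun x => expR (f x)) - gexp T (fun x => expR (g x)) <= expR B * e1.
    rewrite -(gexpB iF iG); apply: le_trans (ler_wpM2l (ltW E0) fg).
    rewrite -(gexpZ _ ifg); apply: le_gexp; [exact: gintB|exact: gintZ|move=> x].
    apply: (@le_trans _ _ (expR (f x) * (f x - g x))).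
      have := expR_ge1Dx (g x - f x).
      have -> : expR (g x) = expR (f x) * expR (g x - f x) by rewrite -expRD addrC subrK.
      have := expR_gt0 (f x); nra.
    apply: le_trans (ler_wpM2l (expR_ge0 _) (ler_norm _)) _.
    by apply: ler_wpM2r => //; rewrite ler_expR; case/andP: (fB x).
  have p0 : 0 < gexp T (fun x => expR (f x)) by exact: lt_le_trans (expR_gt0 _) F1.
  have q0 : 0 < gexp T (fun x => expR (g x)) by exact: lt_le_trans (expR_gt0 _) G1.
  move: (gexp T (fun x => expR (f x))) (gexp T (fun x => expR (g x))) p0 q0 F1 G1 FG => p q p0 q0 F1 G1 FG.
  rewrite -ln_div ?posrE//.
  have pq0 : 0 < p / q by rewrite divr_gt0.
  have : ln (p / q) <= p / q - 1.
    have h1 : -1 < p / q - 1 by lra.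
    by have := le_ln1Dx h1; rewrite [1 + _]addrC subrK.
  move/le_trans; apply.
  have -> : p / q - 1 = (p - q) / q by field; rewrite gt_eqF.
  rewrite ler_pdivrMr//; apply: le_trans FG _.
  have Bq : 1 <= expR B * q.
    by rewrite -[leLHS](expRxMexpNx_1 B); apply: ler_wpM2l => //; exact: ltW.
  have : 0 <= expR B * e1 by rewrite mulr_ge0// ltW.
  rewrite -e1E; nra.
rewrite ler_norml; apply/andP; split; last exact: key.
rewrite lerNl opprB; apply: key => //.
by rewrite (eq_gexp _ (fun x => distrC (phi x) (w x))).
Qed.

End heat_log_continuity.

Section gaussian_inequality.
Context {R : realType} {k m : nat}.
Variables (E : 'I_k -> euclid R) (F : 'I_m -> euclid R).
Variables (c : 'I_k -> R) (d : 'I_m -> R) (Q : 'Hom(dsum E, dsum F)).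
Hypotheses (c0 : forall i, 0 < c i) (d0 : forall j, 0 < d j).
Hypothesis geom : FRBL_geometric c d Q.

(** The smoothed functions exp (P_s (ln f)) and exp (P_s (ln g)) inherit the pointwise inequality
    exactly and are regular, so [heat_iter] applies to them; then s tends to 0. *)
Lemma gauss_frbl_pos (m0 M0 : R) (f : forall i, borel (E i) -> R)
    (g : forall j, borel (F j) -> R) (n : nat) :
  0 < m0 -> m0 <= M0 -> (0 < n)%N ->
  (forall i, measurable_fun setT (f i)) -> (forall i x, m0 <= f i x <= M0) ->
  (forall j, measurable_fun setT (g j)) -> (forall j y, m0 <= g j y <= M0) ->
  (forall x : dsum E, \sum_i c i * ln (f i (dsum_proj E i x)) <=
    \sum_j d j * ln (g j (dsum_proj F j (Q x)))) ->
  \sum_i c i * ln (gexp (n%:R ^+ 2) (f i)) <= \sum_j d j * ln (gexp (n%:R ^+ 2) (g j)).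
Proof.
move=> m00 mM n0 mf fb mg gb fg.
set T : R := n%:R ^+ 2; have T0 : 0 < T by rewrite exprn_gt0// ltr0n.
pose B := `|ln m0| + `|ln M0|.
have B0 : 0 <= B by rewrite addr_ge0.
have lnB (V : euclid R) (h : borel V -> R) : (forall x, m0 <= h x <= M0) ->
    forall x, `|ln (h x)| <= B.
  move=> hb x; have /andP[h1 h2] := hb x.
  have h0 : 0 < h x by exact: lt_le_trans h1.
  have l1 : ln m0 <= ln (h x) by rewrite ler_ln ?posrE.
  have l2 : ln (h x) <= ln M0 by rewrite ler_ln ?posrE// (lt_le_trans h0).
  have a1 := ler_norm (- ln m0); have a2 := ler_norm (ln M0); rewrite normrN in a1.
  have a3 := normr_ge0 (ln m0); have a4 := normr_ge0 (ln M0).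
  by rewrite /B ler_norml; apply/andP; split; lra.
have lnK' (V : euclid R) (h : borel V -> R) : (forall x, m0 <= h x <= M0) ->
    (fun x => expR (ln (h x))) = h.
  move=> hb; apply/funext => x; rewrite lnK// posrE.
  by have /andP[+ _] := hb x; exact: lt_le_trans.
have mlf i := measurable_ln_comp (mf i); have mlg j := measurable_ln_comp (mg j).
have lf i := lnB _ _ (fb i); have lg j := lnB _ _ (gb j).
(* Each logarithm may err by e / D; weighted by the c i and d j, the errors sum to at most e. *)
pose D := \sum_i c i + \sum_j d j + 1.
have D0 : 0 < D by rewrite ltr_wpDl// addr_ge0// sumr_ge0// => i _; exact: ltW.
apply/ler_addgt0Pr => e e0.
have eD0 : 0 < e / D by rewrite divr_gt0.
have hf i := ln_gexp_expR_heat T0 eD0 (mlf i) (lf i).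
have hg j := ln_gexp_expR_heat T0 eD0 (mlg j) (lg j).
have /choice[sf sfP] : forall i, exists s0 : R, 0 < s0 /\ forall s, 0 < s -> s <= s0 ->
    `|ln (gexp T (fun x => expR (heat s (fun y => ln (f i y)) x))) -
      ln (gexp T (fun x => expR (ln (f i x))))| <= e / D.
  by move=> i; have [s0 ? ?] := hf i; exists s0.
have /choice[sg sgP] : forall j, exists s0 : R, 0 < s0 /\ forall s, 0 < s -> s <= s0 ->
    `|ln (gexp T (fun x => expR (heat s (fun y => ln (g j y)) x))) -
      ln (gexp T (fun x => expR (ln (g j x))))| <= e / D.
  by move=> j; have [s0 ? ?] := hg j; exists s0.
have sf0 i : 0 < sf i := proj1 (sfP i).
have sg0 j : 0 < sg j := proj1 (sgP j).
(* 1 / S lies below every threshold; the summand 1 keeps S positive even without indices. *)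
pose S := \sum_i (sf i)^-1 + \sum_j (sg j)^-1 + 1.
have Sf0 : 0 <= \sum_i (sf i)^-1 by apply: sumr_ge0 => i _; rewrite invr_ge0 ltW.
have Sg0 : 0 <= \sum_j (sg j)^-1 by apply: sumr_ge0 => i _; rewrite invr_ge0 ltW.
have S0 : 0 < S by rewrite ltr_wpDl// addr_ge0.
pose s := S^-1; have s0 : 0 < s by rewrite invr_gt0.
have le_inv l (a : 'I_l -> R) i : (forall i, 0 < a i) -> (a i)^-1 <= \sum_i (a i)^-1.
  move=> a0; rewrite (bigD1 i)//= lerDl.
  by apply: sumr_ge0 => l' _; rewrite invr_ge0 ltW.
have ssf i : s <= sf i.
  rewrite -[leRHS]invrK lef_pV2 ?posrE ?invr_gt0//.
  by have := le_inv _ sf i sf0; rewrite /S; lra.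
have ssg j : s <= sg j.
  rewrite -[leRHS]invrK lef_pV2 ?posrE ?invr_gt0//.
  by have := le_inv _ sg j sg0; rewrite /S; lra.
have cf i := proj2 (sfP i) s s0 (ssf i).
have cg j := proj2 (sgP j) s s0 (ssg j).
have [L [K [L0 K0 reg]]] := regular_expR_heat s0 B0.
pose ff i x := expR (heat s (fun y => ln (f i y)) x).
pose gg j x := expR (heat s (fun y => ln (g j y)) x).
have bf i : bmeas (fun y => ln (f i y)) by split => //; exists B.
have bg j : bmeas (fun y => ln (g j y)) by split => //; exists B.
have rf i : regular (expR (- B)) (expR B) L K (ff i) by exact: reg.
have rg j : regular (expR (- B)) (expR B) L K (gg j) by exact: reg.
have fg' (x : dsum E) : \sum_i c i * ln (f i (dsum_proj E i x)) <=
    \sum_j d j * ln (g j (dsum_proj F j (Q x))) + 0 by rewrite addr0.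
have fgs (x : dsum E) : \sum_i c i * ln (ff i (dsum_proj E i x)) <=
    \sum_j d j * ln (gg j (dsum_proj F j (Q x))).
  have := gexp_coupling geom s0 bf bg fg' x; rewrite addr0.
  under eq_bigr do rewrite -[gexp s _]expRK.
  by under [in leRHS]eq_bigr do rewrite -[gexp s _]expRK.
have EB : expR (- B) <= expR B by rewrite ler_expR; lra.
have := heat_iter c0 d0 geom (expR_gt0 (- B)) EB L0 K0 n0 rf
  (fun j => let: And3 h _ _ := rg j in h) (fun j => let: And3 _ h _ := rg j in h) fgs.
have z (V : euclid R) (h : borel V -> R) : heat T h 0 = gexp T h.
  by apply: eq_gexp => y; rewrite add0r.
rewrite -/T => main.
have e1 : \sum_i c i * ln (gexp T (f i)) <=
    \sum_i c i * ln (heat T (ff i) 0) + (\sum_i c i) * (e / D).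
  rewrite mulr_suml -big_split/=; apply: ler_sum => i _; rewrite -mulrDr.
  apply: ler_wpM2l; first exact: ltW.
  rewrite z -lerBlDl -[in leLHS](lnK' _ _ (fb i)).
  by apply: le_trans (ler_norm _) _; rewrite distrC; exact: cf.
have e2 : \sum_j d j * ln (heat T (gg j) 0) <=
    \sum_j d j * ln (gexp T (g j)) + (\sum_j d j) * (e / D).
  rewrite mulr_suml -big_split/=; apply: ler_sum => j _; rewrite -mulrDr.
  apply: ler_wpM2l; first exact: ltW.
  rewrite z -lerBlDl -[g j in leLHS](lnK' _ _ (gb j)).
  by apply: le_trans (ler_norm _) _; exact: cg.
apply: le_trans e1 _; apply: le_trans (lerD main (lexx _)) _.
apply: le_trans (lerD e2 (lexx _)) _; rewrite -addrA lerD2l -mulrDl.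
rewrite mulrA ler_pdivrMr// mulrC; apply: ler_wpM2l; first exact: ltW.
by rewrite /D addrC lerDl.
Qed.

End gaussian_inequality.

Section clamping.
Context {R : realType} {k m : nat}.
Variables (c : 'I_k -> R) (d : 'I_m -> R).
Hypotheses (c0 : forall i, 0 < c i) (d0 : forall j, 0 < d j).

(* [eps] is so small that one [a i < eps] settles the inequality by itself, and
   [L] so large that one [b j > L] does. *)
Lemma clamp_sum_ln (M h : R) : 1 <= M -> 0 < h -> h < 1 ->
  exists eps L : R, [/\ 0 < eps, eps <= 1, 1 <= L &
  forall (a : 'I_k -> R) (b : 'I_m -> R), (forall i, 0 <= a i <= M) ->
  (forall j, 0 <= b j) -> \prod_i a i `^ c i <= \prod_j b j `^ d j ->
  \sum_i c i * ln (Num.max (a i) eps) <= \sum_j d j * ln (Num.min (b j + h) L)].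
Proof.
move=> M1 h0 h1; have M0 : 0 < M by lra.
have lM : 0 <= ln M by exact: ln_ge0.
have lh : ln h <= 0 by rewrite ln_le0// ltW.
pose A := \sum_i c i * ln M; pose H := \sum_j d j * ln h.
have A0 : 0 <= A by apply: sumr_ge0 => i _; rewrite mulr_ge0// ltW.
have H0 : H <= 0 by apply: sumr_le0 => j _; rewrite mulr_ge0_le0// ltW.
(* A bounds the left sum from above, H the right sum from below. As [wc] >= W / c i and [wd] >= W /
   d j, a single clamped term makes up for the whole gap W. *)
pose W := A - H; have W0 : 0 <= W by rewrite /W; lra.
pose wc := \sum_i W / c i; pose wd := \sum_j W / d j.
have wc0 : 0 <= wc by apply: sumr_ge0 => i _; rewrite divr_ge0// ltW.
have wd0 : 0 <= wd by apply: sumr_ge0 => i _; rewrite divr_ge0// ltW.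
have Wc i : W <= c i * wc.
  rewrite mulrC -ler_pdivrMr// /wc (bigD1 i)//= lerDl.
  by apply: sumr_ge0 => l _; rewrite divr_ge0// ltW.
have Wd j : W <= d j * wd.
  rewrite mulrC -ler_pdivrMr// /wd (bigD1 j)//= lerDl.
  by apply: sumr_ge0 => l _; rewrite divr_ge0// ltW.
exists (expR (- wc)), (expR wd).
have e0 := expR_gt0 (- wc); have L0 := expR_gt0 wd.
have e1 : expR (- wc) <= 1 by rewrite expR_le1; lra.
have L1 : 1 <= expR wd by rewrite -expR0 ler_expR.
split => // a b aM b0 ab.
have lf i : ln (Num.max (a i) (expR (- wc))) <= ln M.
  have /andP[_ a2] := aM i.
  by rewrite ler_ln ?posrE ?lt_max ?e0 ?orbT// ge_max a2 (le_trans e1).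
have lg j : ln h <= ln (Num.min (b j + h) (expR wd)).
  have := b0 j => bj; rewrite ler_ln ?posrE ?lt_min// ?L0 ?andbT ?le_min; last by lra.
  by apply/andP; split; lra.
have sf : \sum_i c i * ln (Num.max (a i) (expR (- wc))) <= A.
  by apply: ler_sum => i _; apply: ler_wpM2l; rewrite ?lf// ltW.
have sg : H <= \sum_j d j * ln (Num.min (b j + h) (expR wd)).
  by apply: ler_sum => j _; apply: ler_wpM2l; rewrite ?lg// ltW.
have [/existsP[j Lj]|/existsPn nL] := boolP [exists j, expR wd < b j + h].
  apply: le_trans sf _.
  rewrite -[leLHS](subrK H) -lerBrDr -sumrB (bigD1 j)//=.
  rewrite -[leLHS]addr0; apply: lerD; last first.
    apply: sumr_ge0 => l _; rewrite subr_ge0; apply: ler_wpM2l; rewrite ?lg//.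
    exact: ltW.
  rewrite min_r; last exact: ltW.
  rewrite expRK -/W; apply: le_trans (Wd j) _.
  by rewrite lerBrDr gerDl mulr_ge0_le0// ltW.
have [/existsP[i ei]|/existsPn ne] := boolP [exists i, a i < expR (- wc)].
  apply: le_trans _ sg; rewrite -[leRHS](subrK A) -lerBlDr -sumrB (bigD1 i)//=.
  rewrite -[leRHS]addr0; apply: lerD; last first.
    apply: sumr_le0 => l _; rewrite subr_le0; apply: ler_wpM2l; rewrite ?lf//.
    exact: ltW.
  rewrite max_r; last exact: ltW.
  have := Wc i; have : 0 <= c i * ln M by rewrite mulr_ge0// ltW.
  by rewrite expRK /W mulrN; lra.
have aE i : Num.max (a i) (expR (- wc)) = a i by rewrite max_l// leNgt ne.
have bE j : Num.min (b j + h) (expR wd) = b j + h by rewrite min_l// leNgt nL.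
have a0 i : 0 < a i by apply: lt_le_trans e0 _; rewrite leNgt ne.
have bh0 j : 0 < b j + h by rewrite ltr_wpDl.
under eq_bigr do rewrite aE.
under [in leRHS]eq_bigr do rewrite bE.
rewrite -ler_expR -!prod_powR_expR//; apply: le_trans ab _.
apply: ler_prod => j _; rewrite powR_ge0/=.
by apply: ge0_ler_powR; rewrite ?nnegrE ?b0// ?lerDl; exact: ltW.
Qed.

End clamping.

Section gaussian_frbl.
Context {R : realType} {k m : nat}.
Variables (E : 'I_k -> euclid R) (F : 'I_m -> euclid R).
Variables (c : 'I_k -> R) (d : 'I_m -> R) (Q : 'Hom(dsum E, dsum F)).
Hypotheses (c0 : forall i, 0 < c i) (d0 : forall j, 0 < d j).
Hypothesis geom : FRBL_geometric c d Q.

(** The g j may be unbounded, so they enter through upper bounds b j of their integrals. A constant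
    h > 0 added to them keeps them away from 0, and [le_prod_powR_right] removes it. *)
Lemma gauss_frbl (M : R) (f : forall i, borel (E i) -> R)
    (g : forall j, borel (F j) -> R) (b : 'I_m -> R) (n : nat) :
  0 <= M -> (0 < n)%N ->
  (forall i, measurable_fun setT (f i)) -> (forall i x, 0 <= f i x <= M) ->
  (forall j, measurable_fun setT (g j)) -> (forall j y, 0 <= g j y) ->
  (forall j, 0 <= b j) ->
  (forall j, \int[gauss (F j) (n%:R ^+ 2)]_y (g j y)%:E <= (b j)%:E)%E ->
  (forall x : dsum E, \prod_i (f i (dsum_proj E i x)) `^ c i <=
    \prod_j (g j (dsum_proj F j (Q x))) `^ d j) ->
  \prod_i (gexp (n%:R ^+ 2) (f i)) `^ c i <= \prod_j b j `^ d j.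
Proof.
move=> M0 n0 mf fM mg g0 b0 gb fg.
set T : R := n%:R ^+ 2 in gb *.
apply: le_prod_powR_right => // h h0 h1.
have M11 : 1 <= M + 1 by rewrite lerDr.
have [eps [L [e0 e1 L1 clamp]]] := clamp_sum_ln c0 d0 M11 h0 h1.
pose ff i x := Num.max (f i x) eps; pose gg j y := Num.min (g j y + h) L.
have mff i : measurable_fun setT (ff i) by exact: (measurable_maxr (mf i)).
have mgh j : measurable_fun setT (fun y => g j y + h) by exact: measurable_funD.
have mgg j : measurable_fun setT (gg j) by exact: (measurable_minr (mgh j)).
(* As eps <= 1, h < 1 and L >= 1, the number eps h is a common lower bound of [ff] and [gg]. *)
have eh0 : 0 < eps * h by rewrite mulr_gt0.
have ehe : eps * h <= eps by rewrite ger_pMr// ltW.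
have ehh : eps * h <= h by rewrite ger_pMl.
have ffb i x : eps * h <= ff i x <= M + 1 + L.
  have /andP[f0 f1] := fM i x.
  by rewrite le_max ge_max; apply/andP; split; [apply/orP; right|apply/andP; split; lra].
have ggb j y : eps * h <= gg j y <= M + 1 + L.
  have := g0 j y => gj; rewrite le_min ge_min.
  by apply/andP; split; [apply/andP; split; lra|apply/orP; right; lra].
have eM : eps * h <= M + 1 + L by lra.
have ffgg (x : dsum E) : \sum_i c i * ln (ff i (dsum_proj E i x)) <=
    \sum_j d j * ln (gg j (dsum_proj F j (Q x))).
  apply: (clamp (fun i => f i (dsum_proj E i x)) (fun j => g j (dsum_proj F j (Q x)))) => //.
  by move=> i; have /andP[f0 f1] := fM i (dsum_proj E i x); rewrite f0/=; lra.
have key := gauss_frbl_pos c0 d0 geom eh0 eM n0 mff ffb mgg ggb ffgg.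
have iff i : gint T (ff i) := bmeas_gint T (bmeas_itv (mff i) (ffb i)).
have igg j : gint T (gg j) := bmeas_gint T (bmeas_itv (mgg j) (ggb j)).
have iF i : gint T (f i) := bmeas_gint T (bmeas_itv (mf i) (fM i)).
have posf i : 0 < gexp T (ff i).
  by have /andP[+ _] := gexp_bounds (iff i) (ffb i); exact: lt_le_trans.
have posg j : 0 < gexp T (gg j).
  by have /andP[+ _] := gexp_bounds (igg j) (ggb j); exact: lt_le_trans.
have le_f i : 0 <= gexp T (f i) <= gexp T (ff i).
  apply/andP; split; first by apply: gexp_ge0 => x; case/andP: (fM i x).
  by apply: (le_gexp (iF i) (iff i)) => x; rewrite le_max lexx.
have le_g j : gexp T (gg j) <= b j + h.
  rewrite -lee_fin -(gexpE (igg j)) EFinD.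
  apply: (@le_trans _ _ (\int[gauss (F j) T]_y ((g j y)%:E + h%:E))%E).
    apply: ge0_le_integral => //.
    - by move=> y _; rewrite lee_fin; case/andP: (ggb j y) => + _; apply: le_trans; exact: ltW.
    - by apply/measurable_EFinP; exact: mgg.
    - by apply/measurable_EFinP; exact: mgh.
    - by move=> y _; rewrite -EFinD lee_fin ge_min lexx.
  rewrite ge0_integralD//; first by rewrite integral_gauss_cst leeD2r.
  - by move=> y _; rewrite lee_fin.
  - by apply/measurable_EFinP; exact: mg.
  - by move=> y _; rewrite lee_fin ltW.
apply: (@le_trans _ _ (\prod_i (gexp T (ff i)) `^ c i)).
  apply: ler_prod => i _; rewrite powR_ge0/=; have /andP[l1 l2] := le_f i.
  by apply: ge0_ler_powR; rewrite ?nnegrE//; exact: ltW.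
apply: (@le_trans _ _ (\prod_j (gexp T (gg j)) `^ d j)).
  by rewrite !prod_powR_expR// ler_expR.
apply: ler_prod => j _; rewrite powR_ge0/=.
apply: ge0_ler_powR; rewrite ?nnegrE//; first exact: ltW.
  exact: ltW.
by rewrite addr_ge0// ltW.
Qed.

End gaussian_frbl.

Section extended_limits.
Context {R : realType}.

Lemma integral_eq0_support d (T : measurableType d) (mu : {measure set T -> \bar R})
    (f g : T -> R) : measurable_fun setT f -> measurable_fun setT g ->
  (forall x, 0 <= f x) -> (forall x, 0 <= g x) -> (forall x, f x = 0 -> g x = 0) ->
  (\int[mu]_x (f x)%:E = 0)%E -> (\int[mu]_x (g x)%:E = 0)%E.
Proof.
move=> /measurable_EFinP mf /measurable_EFinP mg f0 g0 fg If.
have absE (h : T -> R) : (forall x, 0 <= h x) ->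
    (\int[mu]_x (h x)%:E = \int[mu]_x `|(EFin \o h) x|)%E.
  by move=> h0; apply: eq_integral => x _; rewrite /= ger0_norm.
rewrite (absE _ g0); rewrite (absE _ f0) in If.
apply/(ae_eq_integral_abs _ measurableT mg).
move/(ae_eq_integral_abs _ measurableT mf): If; apply: filterS => x /(_ I)/= fx _.
by case: fx => /fg ->.
Qed.

(** Truncating the sequences at finite levels 0 < y i <= I i bounds the product of the powers of the
    y i by P. An infinite I i would let that product grow past P, so all the limits are finite. *)
Lemma le_prod_poweR_lim n (c : 'I_n -> R) (a : nat -> 'I_n -> R) (I : 'I_n -> \bar R)
    (P : R) : (forall i, 0 < c i) -> (forall l i, 0 <= a l i) ->
  (forall i, (a l i)%:E @[l --> \oo] --> I i) -> (forall i, 0 < I i)%E ->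
  (\forall l \near \oo, \prod_i a l i `^ c i <= P) ->
  (\prod_i I i `^ c i <= P%:E)%E.
Proof.
move=> c0 a0 aI I0 aP.
have key (y : 'I_n -> R) : (forall i, 0 < y i) -> (forall i, (y i)%:E <= I i)%E ->
    \prod_i y i `^ c i <= P.
  move=> y0 yI.
  have cv i : Num.min (a l i) (y i) @[l --> \oo] --> y i.
    apply/cvgrPdist_lt => e e0.
    have op : nbhs (I i) [set z : \bar R | ((y i - e)%:E < z)%E].
      apply: open_ereal_gt'; apply: lt_le_trans (yI i).
      by rewrite lte_fin; lra.
    have al : \forall l \near \oo, y i - e < a l i by exact: aI i _ op.
    near=> l; have al' : y i - e < a l i by near: l.
    by rewrite ltr_norml; apply/andP; split; case: (leP (a l i) (y i)) => ?; lra.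
  have cvp : \prod_i (Num.min (a l i) (y i)) `^ c i @[l --> \oo] --> \prod_i y i `^ c i.
    by apply: cvg_prod_powR => i; apply: cvg_powR.
  rewrite -(cvg_lim _ cvp)//; apply: limr_le; first by apply/cvg_ex; eexists; exact: cvp.
  apply: filterS aP => l; apply: le_trans; apply: ler_prod => i _; rewrite powR_ge0/=.
  by apply: ge0_ler_powR; rewrite ?nnegrE ?le_min ?a0/= ?ge_min ?lexx ?orbT//; exact: ltW.
have [fin|] := pselect (forall i, I i \is a fin_num).
  have IE i : I i = (fine (I i))%:E by rewrite fineK.
  under eq_bigr do rewrite IE poweR_EFin.
  rewrite prodEFin lee_fin; apply: key => i; last by rewrite -IE.
  by rewrite -lte_fin -IE.
move=> /existsNP[i0 /negP Ii0].
have Iy i : I i \isn't a fin_num -> I i = +oo%E.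
  by move=> h; have := I0 i; case: (I i) h => // r; rewrite fin_numE.
pose y i := if I i \is a fin_num then fine (I i) else 1.
have y0 i : 0 < y i.
  by rewrite /y; case: ifPn => // Ii; rewrite -lte_fin fineK.
have yI i : ((y i)%:E <= I i)%E.
  by rewrite /y; case: ifPn => Ii; [rewrite fineK|rewrite (Iy _ Ii) leey].
pose kap := \prod_(i | i != i0) y i `^ c i.
have kap0 : 0 < kap by apply: prodr_gt0 => i _; exact: powR_gt0.
(* With this value at i0 the product of the powers equals |P| + 1. *)
pose z := ((`|P| + 1) / kap) `^ (c i0)^-1.
have w0 : 0 < (`|P| + 1) / kap by rewrite divr_gt0// ltr_wpDl.
have zE : z `^ c i0 = (`|P| + 1) / kap.
  by rewrite /z -powRrM mulVf ?gt_eqF// powRr1// ltW.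
exfalso; have := key (fun i => if i == i0 then z else y i).
rewrite (bigD1 i0)//= eqxx.
rewrite (eq_bigr (fun i => y i `^ c i)) => [|i /negPf ->//].
rewrite -/kap zE divfK ?gt_eqF//.
move=> h; have : `|P| + 1 <= P.
  apply: h => i; case: eqP => [ii0|_] //; first exact: powR_gt0.
  by rewrite Iy ?leey// ii0.
by have := ler_norm P; lra.
Unshelve. all: by end_near. Qed.

End extended_limits.

Section gaussian_volume.
Context {R : realType} (V : euclid R).

Lemma gexp_volume (t : R) (f : borel V -> R) : 0 < t -> bmeas f -> (forall x, 0 <= f x) ->
  (\int[volume V]_x (f x * gauss_kernel t x)%:E)%E =
  (gexp t f * gauss_mass t ^+ \dim {:V})%:E.
Proof.
move=> t0 bf f0; have Z0 : 0 < gauss_mass t ^+ \dim {:V}.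
  by rewrite exprn_gt0// gauss_mass_gt0.
have [mf _] := bf.
have Ef := @integral_gauss R V t (EFin \o f) t0.
rewrite EFinM -(gexpE (bmeas_gint t bf)).
rewrite [X in _ = (X * _)%E]Ef; last 2 first.
- exact/measurable_EFinP.
- by move=> x; rewrite lee_fin.
rewrite -muleA -EFinM mulVf ?gt_eqF// mule1; apply: eq_integral => x _.
by rewrite EFinM.
Qed.

Lemma integral_gauss_le (t : R) (f : borel V -> R) : 0 < t -> measurable_fun setT f ->
  (forall x, 0 <= f x) ->
  (\int[gauss V t]_x (f x)%:E <=
   \int[volume V]_x (f x)%:E * ((gauss_mass t ^+ \dim {:V})^-1)%:E)%E.
Proof.
move=> t0 mf f0; rewrite [leLHS](@integral_gauss R V t (EFin \o f) t0); last 2 first.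
- exact/measurable_EFinP.
- by move=> x; rewrite lee_fin.
apply: lee_wpmul2r; first by rewrite lee_fin invr_ge0 exprn_ge0// gauss_mass_ge0.
apply: ge0_le_integral => //.
- by move=> x _; rewrite mule_ge0// lee_fin ?gauss_kernel_ge0.
- apply: emeasurable_funM; apply/measurable_EFinP; first exact: mf.
  exact: measurable_gauss_kernel.
- by apply/measurable_EFinP.
- move=> x _; rewrite -EFinM lee_fin ler_piMr//.
  by rewrite expR_le1 oppr_le0 divr_ge0 ?dotp_ge0// mulr_ge0// ltW.
Qed.

(** Using n both as truncation level and as standard deviation makes the integrands increase with n,
    so monotone convergence applies. *)
Lemma cvg_integral_truncated (f : borel V -> R) : measurable_fun setT f ->
  (forall x, 0 <= f x) ->
  (\int[volume V]_x (Num.min (f x) n%:R * gauss_kernel (n%:R ^+ 2) x)%:E)%E @[n --> \oo]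
    --> (\int[volume V]_x (f x)%:E)%E.
Proof.
move=> mf f0.
pose h n x := (Num.min (f x) n%:R * gauss_kernel (n%:R ^+ 2 : R) x)%:E.
have h0 n x : (0 <= h n x)%E.
  by rewrite lee_fin mulr_ge0 ?gauss_kernel_ge0// le_min f0 ler0n.
have mh n : measurable_fun setT (h n).
  apply/measurable_EFinP; apply: measurable_funM; first exact: measurable_minr.
  exact: measurable_gauss_kernel.
have hh x : {homo h^~ x : n l / (n <= l)%N >-> (n <= l)%E}.
  move=> n l nl; rewrite lee_fin.
  (* For n = 0 the kernel is 1, since 0^-1 = 0; the truncation at level 0 saves monotonicity. *)
  case: n nl => [|n] nl; first by rewrite min_r// mul0r; have := h0 l x; rewrite lee_fin.
  have nR : n.+1%:R <= l%:R :> R by rewrite ler_nat.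
  apply: ler_pM; rewrite ?gauss_kernel_ge0 ?le_min ?f0 ?ler0n//.
  - by rewrite ge_min lexx/= ge_min nR orbT.
  - by apply: gauss_kernel_homo; rewrite ?exprn_gt0// lerXn2r ?nnegrE.
have hlim x : limn (h^~ x) = (f x)%:E.
  apply/cvg_lim => //; apply: cvg_EFin; first by apply: nearW => n; rewrite /h fin_numE.
  rewrite -[f x]mulr1; apply: cvgM.
    apply: cvg_near_cst; near=> n.
    rewrite min_l//; near: n; exact: nbhs_infty_ger.
  rewrite -[X in _ --> X](@expR0 R); apply: continuous_cvg; first exact: continuous_expR.
  rewrite -[X in _ --> X]oppr0; apply: cvgN.
  have D0 := dotp_ge0 (x : V); set D := dotp V x x in D0 *.
  apply/cvgr0Pnorm_le => e e0; near=> n.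
  have n1 : 1 <= n%:R :> R by near: n; exact: nbhs_infty_ger.
  have n2 : D / e <= n%:R by near: n; exact: nbhs_infty_ger.
  have nn : n%:R <= 2 * n%:R ^+ 2 :> R by nra.
  rewrite ler_pdivrMr// in n2.
  have p0 : 0 < 2 * n%:R ^+ 2 :> R by lra.
  rewrite ger0_norm; last by rewrite divr_ge0// ltW.
  by rewrite ler_pdivrMr//; apply: le_trans n2 _; rewrite mulrC; apply: ler_wpM2l => //; exact: ltW.
have -> : (\int[volume V]_x (f x)%:E = \int[volume V]_x (limn (h^~ x)))%E.
  by apply: eq_integral => x _; rewrite hlim.
exact: (cvg_monotone_convergence (mu := volume V) measurableT mh
  (fun n x _ => h0 n x) (fun x _ => hh x)).
Unshelve. all: by end_near. Qed.

End gaussian_volume.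

(** * The inequality with constant 1 and its optimality *)

Section forward_reverse.
Context {R : realType} {k m : nat}.
Variables (E : 'I_k -> euclid R) (F : 'I_m -> euclid R).
Variables (c : 'I_k -> R) (d : 'I_m -> R) (Q : 'Hom(dsum E, dsum F)).
Hypotheses (datum : FRBL_datum E F c d) (geom : FRBL_geometric c d Q).

Let c0 i : 0 < c i. Proof. by case: datum. Qed.
Let d0 j : 0 < d j. Proof. by case: datum. Qed.

(** The dimension condition enters here: with z a Gaussian mass, the normalisations cancel between
    the two sides. *)
Lemma prod_scaling (z : R) : 0 < z ->
  \prod_i (z ^+ \dim {:E i}) `^ c i = \prod_j (z ^+ \dim {:F j}) `^ d j.
Proof.
move=> z0; rewrite !prod_powR_expR; [|by move=> ?; exact: exprn_gt0..].
have [_ _ cd] := datum.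
have lnE (a : R) n : a * ln (z ^+ n) = a * n%:R * ln z.
  by rewrite lnXn// -[ln z *+ n]mulr_natl mulrA.
under eq_bigr do rewrite lnE.
under [in RHS]eq_bigr do rewrite lnE.
by rewrite -!mulr_suml cd.
Qed.

(** Since 0 * oo = 0, a null g j0 makes the right side vanish even next to an infinite integral. The
    indicators of the sets where f and g are positive satisfy the same hypothesis and have finite
    Gaussian integrals, so [gauss_frbl] yields a null f i. *)
Lemma FRBL_null (f : forall i, borel (E i) -> R) (g : forall j, borel (F j) -> R) j0 :
  (forall i, measurable_fun setT (f i)) -> (forall i x, 0 <= f i x) ->
  (forall j, measurable_fun setT (g j)) -> (forall j y, 0 <= g j y) ->
  (forall x : dsum E, \prod_i (f i (dsum_proj E i x)) `^ c i <=
    \prod_j (g j (dsum_proj F j (Q x))) `^ d j) ->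
  (\int[volume (F j0)]_y (g j0 y)%:E = 0)%E ->
  exists i, (\int[volume (E i)]_x (f i x)%:E = 0)%E.
Proof.
move=> mf f0 mg g0 fg gj0.
have mind (V : euclid R) (h : borel V -> R) : measurable_fun setT h ->
    measurable_fun setT (fun x => (0 < h x)%R%:R : R).
  move=> mh; rewrite (_ : (fun _ => _) = \1_(h @^-1` `]0, +oo[)).
    by apply: measurable_indic; rewrite -[X in measurable X]setTI; exact: mh.
  by apply/funext => x; rewrite indicE; congr ((nat_of_bool _)%:R); apply/idP/idP; rewrite inE/= in_itv/= andbT.
have ind01 (V : euclid R) (h : borel V -> R) x : 0 <= ((0 < h x)%R%:R : R) <= 1.
  by case: (0 < h x)%R; rewrite ?lexx ?ler01 ?lexx.
have ind0 (V : euclid R) (h : borel V -> R) x : h x = 0 -> (0 < h x)%R%:R = 0 :> R.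
  by move=> ->; rewrite ltxx.
pose ff i x : R := (0 < f i x)%R%:R; pose gg j y : R := (0 < g j y)%R%:R.
have ffgg (x : dsum E) : \prod_i (ff i (dsum_proj E i x)) `^ c i <=
    \prod_j (gg j (dsum_proj F j (Q x))) `^ d j.
  have [/existsP[i fi]|/existsPn nf] := boolP [exists i, f i (dsum_proj E i x) == 0].
    rewrite (bigD1 i)//= /ff (eqP fi) ltxx powR0 ?gt_eqF// mul0r.
    by apply: prodr_ge0 => j _; exact: powR_ge0.
  have fp : 0 < \prod_i (f i (dsum_proj E i x)) `^ c i.
    by apply: prodr_gt0 => i _; apply: powR_gt0; rewrite lt0r nf f0.
  have gp := lt_le_trans fp (fg x).
  have gj j : 0 < g j (dsum_proj F j (Q x)).
    rewrite lt0r g0 andbT; apply: contraTneq gp => gj.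
    by rewrite (bigD1 j)//= gj powR0 ?gt_eqF// mul0r ltxx.
  rewrite [leRHS]big1 => [|j _]; last by rewrite /gg gj powR1.
  rewrite big1 => [//|i _]; rewrite /ff (_ : (0 < _) = true) ?powR1//.
  by rewrite lt0r nf f0.
have T0 : 0 < 1%:R ^+ 2 :> R by rewrite exprn_gt0.
have bgg j : gint (1%:R ^+ 2) (gg j) := bmeas_gint _ (bmeas_itv (mind _ _ (mg j)) (ind01 _ (g j))).
have bff i : bmeas (ff i) := bmeas_itv (mind _ _ (mf i)) (ind01 _ (f i)).
have gg0 : gexp (1%:R ^+ 2) (gg j0) = 0.
  apply: gexp_eqE; apply/eqP; rewrite eq_le; apply/andP; split; last first.
    by apply: integral_ge0 => x _; rewrite lee_fin; case/andP: (ind01 _ (g j0) x).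
  apply: le_trans (integral_gauss_le T0 (mind _ _ (mg j0)) _) _.
    by move=> x; case/andP: (ind01 _ (g j0) x).
  have -> : (\int[volume (F j0)]_y (gg j0 y)%:E = 0)%E; last by rewrite mul0e.
  apply: (integral_eq0_support (mg j0) (mind _ _ (mg j0)) (g0 j0) _ _ gj0) => x.
    by case/andP: (ind01 _ (g j0) x).
  exact: ind0.
have := gauss_frbl (b := fun j => gexp (1%:R ^+ 2) (gg j)) c0 d0 geom ler01 (ltn0Sn 0)
  (fun i => mind _ _ (mf i)) (fun i => ind01 _ (f i)) (fun j => mind _ _ (mg j))
  (fun j y => proj1 (andP (ind01 _ (g j) y)))
  (fun j => gexp_ge0 _ (fun y => proj1 (andP (ind01 _ (g j) y)))) _ ffgg.
rewrite [X in _ <= X](bigD1 j0)//= gg0 powR0 ?gt_eqF// mul0r => h.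
have {h} : \prod_i gexp (1%:R ^+ 2) (ff i) `^ c i == 0.
  rewrite eq_le prodr_ge0 ?andbT => [|i _]; last exact: powR_ge0.
  by apply: h => j; rewrite (gexpE (bgg j)).
rewrite prodf_seq_eq0 => /hasP[i _ /= /eqP /powR_eq0_eq0 fi]; exists i.
have mk : measurable_fun setT (fun x : borel (E i) => ff i x * gauss_kernel (1%:R ^+ 2 : R) x).
  apply: measurable_funM; first exact: mind.
  exact: measurable_gauss_kernel.
have ff0 x : 0 <= ff i x by case/andP: (ind01 _ (f i) x).
apply: (integral_eq0_support mk (mf i) _ (f0 i)).
- by move=> x; rewrite mulr_ge0 ?gauss_kernel_ge0.
- move=> x /eqP; rewrite mulf_eq0 [X in _ || X]gt_eqF ?gauss_kernel_gt0// orbF /ff.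
  have := f0 i x; rewrite le0r => /orP[/eqP//|->]; by rewrite oner_eq0.
- by rewrite (gexp_volume T0 (bff i) ff0) fi mul0r.
Qed.

Lemma FRBL_finite (f : forall i, borel (E i) -> R) (g : forall j, borel (F j) -> R)
    (b : 'I_m -> R) :
  (forall i, measurable_fun setT (f i)) -> (forall i x, 0 <= f i x) ->
  (forall j, measurable_fun setT (g j)) -> (forall j y, 0 <= g j y) ->
  (forall x : dsum E, \prod_i (f i (dsum_proj E i x)) `^ c i <=
    \prod_j (g j (dsum_proj F j (Q x))) `^ d j) ->
  (forall i, 0 < \int[volume (E i)]_x (f i x)%:E)%E ->
  (forall j, \int[volume (F j)]_y (g j y)%:E = (b j)%:E)%E ->
  (\prod_i (\int[volume (E i)]_x (f i x)%:E) `^ c i <= (\prod_j b j `^ d j)%:E)%E.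
Proof.
move=> mf f0 mg g0 fg If gb.
have b0 j : 0 <= b j.
  by rewrite -lee_fin -gb; apply: integral_ge0 => y _; rewrite lee_fin.
pose fn (n : nat) i x := Num.min (f i x) n%:R.
have fn0 n i x : 0 <= fn n i x <= n%:R by rewrite le_min f0 ge_min lexx orbT ler0n.
have mfn n i : measurable_fun setT (fn n i) by exact: (measurable_minr (mf i)).
pose T (n : nat) : R := n%:R ^+ 2; pose z n : R := gauss_mass (T n).
pose a n i := gexp (T n) (fn n i) * z n ^+ \dim {:E i}.
have aE n i : (0 < n)%N -> (a n i)%:E =
    (\int[volume (E i)]_x (fn n i x * gauss_kernel (T n) x)%:E)%E.
  move=> n0; have T0 : 0 < T n by rewrite exprn_gt0// ltr0n.
  rewrite (gexp_volume T0 (bmeas_itv (mfn n i) (fn0 n i)))// => x.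
  by case/andP: (fn0 n i x).
have fp n i : 0 <= gexp (T n) (fn n i).
  by apply: gexp_ge0 => x; case/andP: (fn0 n i x).
apply: (le_prod_poweR_lim (a := a)) => //.
- by move=> n i; rewrite mulr_ge0// exprn_ge0// gauss_mass_ge0.
- move=> i; apply: cvg_trans (cvg_integral_truncated (mf i) (f0 i)).
  by apply: near_eq_cvg; near=> n; rewrite aE//; near: n; exact: nbhs_infty_gt.
near=> n; have n0 : (0 < n)%N by near: n; exact: nbhs_infty_gt.
have T0 : 0 < T n by rewrite exprn_gt0// ltr0n.
have z0 : 0 < z n by exact: gauss_mass_gt0.
(* Dividing by the Gaussian mass turns the Lebesgue integral b j into a bound for the Gaussian
   integral; [prod_scaling] cancels these factors against those of [a]. *)
pose bz j := b j * (z n ^+ \dim {:F j})^-1.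
have bz0 j : 0 <= bz j by rewrite mulr_ge0// invr_ge0 exprn_ge0// ltW.
have gbz j : (\int[gauss (F j) (T n)]_y (g j y)%:E <= (bz j)%:E)%E.
  by apply: le_trans (integral_gauss_le T0 (mg j) (g0 j)) _; rewrite gb -EFinM.
have fgn (x : dsum E) : \prod_i (fn n i (dsum_proj E i x)) `^ c i <=
    \prod_j (g j (dsum_proj F j (Q x))) `^ d j.
  apply: le_trans (fg x); apply: ler_prod => i _; rewrite powR_ge0/=.
  have /andP[l1 _] := fn0 n i (dsum_proj E i x).
  by apply: ge0_ler_powR; rewrite ?nnegrE ?ge_min ?lexx//; exact: ltW.
have := gauss_frbl c0 d0 geom (ler0n R n) n0 (mfn n) (fn0 n) mg g0 bz0 gbz fgn.
rewrite -/(T n) => main.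
have zE i : 0 <= z n ^+ i by rewrite exprn_ge0// ltW.
under eq_bigr do rewrite /a powRM//.
rewrite big_split/= prod_scaling//; apply: (@le_trans _ _ (
  (\prod_j bz j `^ d j) * \prod_j (z n ^+ \dim {:F j}) `^ d j)).
  by apply: ler_wpM2r => //; apply: prodr_ge0 => j _; exact: powR_ge0.
rewrite -big_split/= le_eqVlt; apply/orP; left; apply/eqP; apply: eq_bigr => j _.
by rewrite -powRM// /bz divfK// gt_eqF// exprn_gt0.
Unshelve. all: by end_near. Qed.

Lemma FRBL_inequality1 : FRBL_inequality c d Q 1%E.
Proof.
move=> f g mf f0 mg g0 fg; rewrite mul1e.
rewrite -[leLHS]/(\prod_i (\int[volume (E i)]_x (f i x)%:E) `^ c i)%E.
rewrite -[leRHS]/(\prod_j (\int[volume (F j)]_y (g j y)%:E) `^ d j)%E.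
have If0 i : (0 <= \int[volume (E i)]_x (f i x)%:E)%E.
  by apply: integral_ge0 => x _; rewrite lee_fin.
have Ig0 j : (0 <= \int[volume (F j)]_x (g j x)%:E)%E.
  by apply: integral_ge0 => x _; rewrite lee_fin.
(* A null f i settles the claim. Otherwise no g j is null, by [FRBL_null], so an infinite one makes
   the whole right side infinite. *)
have [[i fi]|nf] := pselect (exists i, (\int[volume (E i)]_x (f i x)%:E = 0)%E).
  rewrite (bigD1 i)//= fi poweR0r ?gt_eqF// mul0e.
  by apply: prode_ge0 => j _; exact: poweR_ge0.
have Ifp i : (0 < \int[volume (E i)]_x (f i x)%:E)%E.
  by rewrite lt0e If0 andbT; apply/eqP => fi; apply: nf; exists i.
have Igp j : (0 < \int[volume (F j)]_x (g j x)%:E)%E.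
  rewrite lt0e Ig0 andbT; apply/eqP => gj; apply: nf.
  exact: FRBL_null mf f0 mg g0 fg gj.
have [[j gj]|ng] := pselect (exists j, (\int[volume (F j)]_x (g j x)%:E = +oo)%E).
  rewrite [leRHS](bigD1 j)//= gj poweRyr ?gt_eqF// gt0_mulye ?leey//.
  apply: (big_ind (fun x : \bar R => 0 < x)%E) => [|x y|i _]; rewrite ?lte01 ?poweR_gt0//.
  exact: mule_gt0.
have Igb j : (\int[volume (F j)]_x (g j x)%:E)%E =
    (fine (\int[volume (F j)]_x (g j x)%:E)%E)%:E.
  rewrite fineK// ge0_fin_numE// ltey; apply/eqP => gj; apply: ng.
  by exists j.
apply: le_trans (FRBL_finite mf f0 mg g0 fg Ifp Igb) _.
rewrite -prodEFin; under [leRHS]eq_bigr do rewrite Igb poweR_EFin.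
exact: lexx.
Qed.

(** For standard Gaussians the pointwise hypothesis is the operator inequality read at x, and both
    products of integrals are the same positive number. *)
Lemma FRBL_inequality_ge1 C : FRBL_inequality c d Q C -> (1 <= C)%E.
Proof.
move=> hC; pose f i : borel (E i) -> R := gauss_kernel 1.
pose g j : borel (F j) -> R := gauss_kernel 1.
have fg (x : dsum E) : \prod_i (f i (dsum_proj E i x)) `^ c i <=
    \prod_j (g j (dsum_proj F j (Q x))) `^ d j.
  rewrite !prod_powR_expR; [|by move=> ?; exact: gauss_kernel_gt0..].
  rewrite ler_expR; have := drift_cost geom x.
  have lnE (V : euclid R) (y : V) : ln (gauss_kernel 1 y) = - (dotp V y y) * 2^-1 :> R.
    by rewrite expRK mulr1 mulNr.
  under [X in _ -> _ <= X]eq_bigr do rewrite lnE mulrA mulrN.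
  under [X in _ -> X <= _]eq_bigr do rewrite lnE mulrA mulrN.
  by rewrite -!mulr_suml !sumrN => h; rewrite ler_pM2r// lerN2.
have z0 : 0 < gauss_mass 1 :> R by exact: gauss_mass_gt0.
have := hC f g (fun i => @measurable_gauss_kernel R (E i) 1) (fun i x => gauss_kernel_ge0 1 x)
  (fun j => @measurable_gauss_kernel R (F j) 1) (fun j x => gauss_kernel_ge0 1 x) fg.
have IE (V : euclid R) : (\int[lebesgue V]_x (gauss_kernel 1 x)%:E =
    (gauss_mass 1 ^+ \dim {:V} : R)%:E)%E.
  exact: (integral_gauss_kernel V ltr01).
under eq_bigr do rewrite IE poweR_EFin.
under [X in (_ <= _ * X)%E -> _]eq_bigr do rewrite IE poweR_EFin.
rewrite !prodEFin prod_scaling//.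
set P := \prod_j _; have P0 : 0 < P.
  by apply: prodr_gt0 => j _; rewrite powR_gt0// exprn_gt0.
case: C hC => [r _|_ _|_]; last 2 first.
- exact: leey.
- by rewrite gt0_mulNye ?lte_fin.
by rewrite -EFinM !lee_fin ler_pMl.
Qed.

End forward_reverse.

Theorem corollary1 (R : realType) (k m : nat)
    (E : 'I_k -> euclid R) (F : 'I_m -> euclid R)
    (c : 'I_k -> R) (d : 'I_m -> R) (Q : 'Hom(dsum E, dsum F)) :
  FRBL_datum E F c d -> FRBL_geometric c d Q ->
  FRBL_constant c d Q = 1%E.
Proof.
move=> datum geom; apply: xget_unique => [|C [C1 Clb]].
  split; first exact: FRBL_inequality1.
  by move=> C; exact: FRBL_inequality_ge1.
apply/eqP; rewrite eq_le (FRBL_inequality_ge1 datum geom C1) andbT.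
by apply: Clb; exact: FRBL_inequality1.
Qed.
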